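(* Let $V(\cdot)$ be the Maxwell operator pencil in $L^2(\Omega)^3\oplus L^2(\Omega)^3$ given by $$V(\omega)=\begin{pmatrix}-\mathrm{i}\sigma & \mathrm{i}\operatorname{curl}\\ -\mathrm{i}\operatorname{curl}_0 & 0\end{pmatrix}-\omega\begin{pmatrix}\varepsilon&0\\0&\mu\end{pmatrix},\qquad \operatorname{dom}V(\omega)=H_0(\operatorname{curl},\Omega)\oplus H(\operatorname{curl},\Omega),\quad \omega\in\mathbb{C},$$ and let $\lambda_{\min}^\Omega:=\min\sigma(\operatorname{curl}\operatorname{curl}_0|_{H(\operatorname{div}0,\Omega)})\ge 0$. Then $$\sigma(V)\subset \mathrm{i}\Big[-\frac{\sigma_{\max}}{\varepsilon_{\min}},0\Big]\cup\Big\{\omega\in\mathbb{C}\setminus\mathrm{i}\mathbb{R}:\ \operatorname{Im}\omega\in\Big[-\frac12\frac{\sigma_{\max}}{\varepsilon_{\min}},-\frac12\frac{\sigma_{\min}}{\varepsilon_{\max}}\Big],\ (\operatorname{Re}\omega)^2-3(\operatorname{Im}\omega)^2+2\frac{\sigma_{\max}}{\varepsilon_{\min}}|\operatorname{Im}\omega|\ge\frac{\lambda_{\min}^\Omega}{\varepsilon_{\max}\mu_{\max}}\Big\}.$$ In particular, if $\lambda_{\min}^\Omega>0$, then $$\sigma(V)\cap\bigg(\Big(-\Big(\frac{\lambda_{\min}^\Omega}{\varepsilon_{\max}\mu_{\max}}\Big)^{1/2},0\Big)\cup\Big(0,\Big(\frac{\lambda_{\min}^\Omega}{\varepsilon_{\max}\mu_{\max}}\Big)^{1/2}\Big)\bigg)=\emptyset,$$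 and if $\lambda_{\min}^\Omega>\frac13\frac{\sigma_{\max}^2\varepsilon_{\max}\mu_{\max}}{\varepsilon_{\min}^2}$, then $\sigma(V)\cap\mathrm{i}\mathbb{R}\subset\mathrm{i}\big[-\frac{\sigma_{\max}}{\varepsilon_{\min}},0\big]$ is isolated from $\sigma(V)\setminus\mathrm{i}\mathbb{R}$ (i.e. the two sets have positive distance).
   Context: $\Omega\subset\mathbb{R}^3$ is a (possibly unbounded) domain with Lipschitz boundary. The coefficients $\varepsilon,\mu,\sigma\in L^\infty(\Omega,\mathbb{R}^{3\times3})$ are symmetric, non-negative matrix-valued functions, and $\varepsilon_{\min},\varepsilon_{\max},\mu_{\min},\mu_{\max},\sigma_{\min},\sigma_{\max}$ are constants such that a.e. in $\Omega$ and for all $\eta\in\mathbb{R}^3$, $|\eta|=1$: $0<\varepsilon_{\min}\le\eta\cdot\varepsilon\eta\le\varepsilon_{\max}$, $0<\mu_{\min}\le\eta\cdot\mu\eta\le\mu_{\max}$, $0\le\sigma_{\min}\le\eta\cdot\sigma\eta\le\sigma_{\max}$. All function spaces are complex. $H(\operatorname{curl},\Omega)=\{u\in L^2(\Omega)^3:\operatorname{curl}u\in L^2(\Omega)^3\}$; $H_0(\operatorname{curl},\Omega)=\{u\in H(\operatorname{curl},\Omega):\nu\times u|_{\partial\Omega}=0\}$, with $\nu$ the outward unit normal; $H(\operatorname{div}0,\Omega)=\{u\in L^2(\Omega)^3:\operatorname{div}u=0\}$, a closed subspace of $L^2(\Omega)^3$. As operators in $L^2(\Omega)^3$, $\operatorname{curl}$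 has domain $H(\operatorname{curl},\Omega)$ and $\operatorname{curl}_0=\operatorname{curl}^*$ acts as $\operatorname{curl}$ on domain $H_0(\operatorname{curl},\Omega)$. The operator $\operatorname{curl}\operatorname{curl}_0|_{H(\operatorname{div}0,\Omega)}$ is the self-adjoint operator in the Hilbert space $H(\operatorname{div}0,\Omega)$ with domain $\{u\in H_0(\operatorname{curl},\Omega)\cap H(\operatorname{div}0,\Omega):\operatorname{curl}u\in H(\operatorname{curl},\Omega)\}$. For a pencil $T(\cdot)$ of closed operators, $\rho(T)$ is the set of $\omega\in\mathbb{C}$ for which $T(\omega)$ is boundedly invertible (bijective from its domain onto the space), and $\sigma(T)=\mathbb{C}\setminus\rho(T)$. *)

(* Defs.v *)
From HB Require Import structures.
From mathcomp Require Import all_boot all_order all_algebra complex.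
From mathcomp Require Import all_classical all_reals all_analysis.

Set Implicit Arguments.
Unset Strict Implicit.
Unset Printing Implicit Defensive.

Import Order.TTheory GRing.Theory Num.Theory.
Import numFieldNormedType.Exports.

Local Open Scope classical_set_scope.
Local Open Scope ring_scope.
Local Open Scope complex_scope.

(* R^3 is the product R * R * R: it carries both the product topology and the
   product sigma-algebra of the library. *)
Notation R3 R :=
  (measurableTypeR R * measurableTypeR R * measurableTypeR R)%type.

(* Values of L^2(Omega)^3 functions are complex column vectors.  Functions are
   defined on all of R^3; only their restriction to Omega matters, and elements
   of L^2 are identified when they agree a.e. in Omega (relation eqae). *)
Notation vfield R := (R3 R -> 'cV[R[i]]_3).
Notation mfield R := (R3 R -> 'M[R]_3).

Section Domain.
Context {R : realType}.
Implicit Types Omega : set (R3 R).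

Definition leb : {measure set (measurableTypeR R) -> \bar R} :=
  @lebesgue_measure R.

Definition leb3 : {measure set (R3 R) -> \bar R} :=
  ((leb \x leb) \x leb)%E.

Definition vec (x : R3 R) : 'cV[R]_3 :=
  \col_(i < 3) [:: x.1.1; x.1.2; x.2]`_i.

Definition domain Omega := [/\ Omega !=set0, open Omega & connected Omega].

(* Near each boundary point p, after a rotation/reflection Q about p, Omega is
   the region below the graph of a Lipschitz function of two variables. *)
Definition lipschitz_boundary Omega :=
  forall p : R3 R, (closure Omega `\` interior Omega) p ->
  exists Q : 'M[R]_3, exists gamma : R * R -> R,
  [/\ Q *m Q^T = 1%:M,
      [lipschitz gamma s | s in setT] &
      \forall x \near p, Omega x <->
        let y := Q *m vec (x - p) in
        y (inord 2) 0 < gamma (y (inord 0) 0, y (inord 1) 0)].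

End Domain.

Section TestFunctions.
Context {R : realType}.
Implicit Types (Omega : set (R3 R)) (phi : R3 R -> R).

Definition basis3 (i : 'I_3) : R3 R :=
  match val i with 0 => (1, 0, 0) | 1 => (0, 1, 0) | _ => (0, 0, 1) end.

Definition partial (i : 'I_3) phi : R3 R -> R :=
  fun x => 'D_(basis3 i) phi x.

Fixpoint Ck (n : nat) phi : Prop :=
  match n with
  | 0 => continuous phi
  | m.+1 => (forall i x, derivable phi x (basis3 i)) /\
            (forall i, Ck m (partial i phi))
  end.

Definition smooth phi := forall n, Ck n phi.

Definition test_function Omega phi :=
  let supp := closure [set x | phi x != 0] in
  [/\ smooth phi, compact supp & supp `<=` Omega].

Definition test_field Omega (Phi : R3 R -> 'cV[R]_3) :=
  forall i, test_function Omega (fun x => Phi x i 0).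

Definition classical_grad phi (x : R3 R) : 'cV[R]_3 :=
  \col_i partial i phi x.

(* Indices are added modulo 3. *)
Definition classical_curl (Phi : R3 R -> 'cV[R]_3) (x : R3 R) :
    'cV[R]_3 :=
  \col_(i < 3) (partial (i + 1) (fun y => Phi y (i + 1 + 1) 0) x -
                partial (i + 1 + 1) (fun y => Phi y (i + 1) 0) x).

End TestFunctions.

Section L2.
Context {R : realType}.
Variable Omega : set (R3 R).
Implicit Types u v w : vfield R.

Definition eqae u v := {ae leb3, forall x, Omega x -> u x = v x}.

Definition normsq (a : 'cV[R[i]]_3) : R :=
  \sum_(k < 3) (complex.Re (a k 0) ^+ 2 + complex.Im (a k 0) ^+ 2).

Definition L2 : set (vfield R) := [set u : vfield R |
  (forall k, measurable_fun Omega (fun x => complex.Re (u x k 0) : R) /\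
             measurable_fun Omega (fun x => complex.Im (u x k 0) : R)) /\
  (\int[leb3]_(x in Omega) (normsq (u x))%:E < +oo)%E].

Definition L2norm u : R := Num.sqrt (\int[leb3]_(x in Omega) normsq (u x)).

Definition cintegral (f : R3 R -> R[i]) : R[i] :=
  (\int[leb3]_(x in Omega) complex.Re (f x)) +i*
  (\int[leb3]_(x in Omega) complex.Im (f x)).

Definition cmx m n (A : 'M[R]_(m, n)) : 'M[R[i]]_(m, n) :=
  map_mx (real_complex R) A.

(* the bilinear pairing, without complex conjugation *)
Definition pairing u v : R[i] :=
  cintegral (fun x => \sum_(k < 3) u x k 0 * v x k 0).

End L2.

(* Unbounded operators are given by their graphs: curl Omega u w means that
   u is in the domain of curl, w is in L^2(Omega)^3 and curl u = w. *)
Section Operators.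
Context {R : realType}.
Variable Omega : set (R3 R).
Implicit Types u v w f g : vfield R.

Definition curl u w := [/\ L2 Omega u, L2 Omega w &
  forall Phi, test_field Omega Phi ->
    pairing Omega w (fun x => cmx (Phi x)) =
    pairing Omega u (fun x => cmx (classical_curl Phi x))].

Definition Hcurl : set (vfield R) := [set u : vfield R | exists w, curl u w].

(* The duality pairing <nu x u, v> over the boundary, for u, v in H(curl) with
   cu = curl u and cv = curl v, as defined by Green's formula. *)
Definition tangential_trace u cu v cv : R[i] :=
  pairing Omega cu v - pairing Omega u cv.

(* The trace nu x u of a field of H(curl) exists only as a functional, through
   Green's formula.  Requiring it to vanish on all of H(curl) makes curl0 the
   adjoint of curl. *)
Definition curl0 u w := curl u w /\
  forall v cv, curl v cv -> tangential_trace u w v cv = 0.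

Definition H0curl : set (vfield R) := [set u : vfield R | exists w, curl0 u w].

Definition Hdiv0 : set (vfield R) := [set u : vfield R | L2 Omega u /\
  forall phi, test_function Omega phi ->
    pairing Omega u (fun x => cmx (classical_grad phi x)) = 0].

(* curl curl0 restricted to H(div 0) *)
Definition curlcurl0 u w := [/\ Hdiv0 u, Hdiv0 w &
  exists2 cu, curl0 u cu & curl cu w].

Definition curlcurl0_pencil (z : R[i]) u f :=
  exists2 w, curlcurl0 u w &
    eqae Omega f (fun x => w x - z *: u x).

End Operators.

Section Spectrum.
Context {R : realType} {E : Type}.
Variables (K : set E) (eqE : E -> E -> Prop) (nrm : E -> R).

(* T is the graph of an operator in the space K, whose elements are identified
   along eqE.  T is bijective from its domain onto K with bounded inverse. *)
Definition boundedly_invertible (T : E -> E -> Prop) :=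
  exists C : R, forall f, K f -> exists u,
    [/\ T u f, nrm u <= C * nrm f & forall u', T u' f -> eqE u' u].

Definition resolvent_set (T : R[i] -> E -> E -> Prop) : set R[i] :=
  [set z | boundedly_invertible (T z)].

Definition spectrum (T : R[i] -> E -> E -> Prop) : set R[i] :=
  ~` resolvent_set T.

End Spectrum.

Section Maxwell.
Context {R : realType}.
Variable Omega : set (R3 R).

Definition spectrum_curlcurl0 : set R[i] :=
  spectrum (Hdiv0 Omega) (eqae Omega) (L2norm Omega) (curlcurl0_pencil Omega).

Definition lambda_min : R :=
  inf [set x : R | spectrum_curlcurl0 x%:C].

(* The order on R[i] is the partial one, so this also says that S is real. *)
Definition is_minimum (S : set R[i]) (x : R) :=
  S x%:C /\ forall z, S z -> x%:C <= z.

Definition bounded_coefficient (A : mfield R) :=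
  [/\ forall i j, measurable_fun Omega (fun x => A x i j : R),
      exists M : R, {ae leb3, forall x, Omega x -> forall i j, `|A x i j| <= M},
      {ae leb3, forall x, Omega x -> (A x)^T = A x} &
      {ae leb3, forall x, Omega x ->
        forall eta : 'cV[R]_3, 0 <= (eta^T *m A x *m eta) 0 0}].

Definition form_bounds (A : mfield R) (lo hi : R) :=
  {ae leb3, forall x, Omega x ->
    forall eta : 'cV[R]_3, (eta^T *m eta) 0 0 = 1 ->
      lo <= (eta^T *m A x *m eta) 0 0 <= hi}.

Definition L2pair : set (vfield R * vfield R) :=
  [set U : vfield R * vfield R | L2 Omega U.1 /\ L2 Omega U.2].

Definition eqae_pair (U V : vfield R * vfield R) :=
  eqae Omega U.1 V.1 /\ eqae Omega U.2 V.2.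

Definition L2pair_norm (U : vfield R * vfield R) : R :=
  Num.sqrt (L2norm Omega U.1 ^+ 2 + L2norm Omega U.2 ^+ 2).

Definition maxwell (eps mu sigma : mfield R) (omega : R[i])
    (U F : vfield R * vfield R) :=
  exists cu cv : vfield R, [/\ curl0 Omega U.1 cu, curl Omega U.2 cv &
    eqae_pair F
      ((fun x => - 'i *: (cmx (sigma x) *m U.1 x) + 'i *: cv x
                 - omega *: (cmx (eps x) *m U.1 x)),
       (fun x => - 'i *: cu x - omega *: (cmx (mu x) *m U.2 x)))].

Definition spectrum_maxwell (eps mu sigma : mfield R) : set R[i] :=
  spectrum L2pair eqae_pair L2pair_norm (maxwell eps mu sigma).

End Maxwell.

Definition imaginary_axis {R : realType} : set R[i] :=
  [set z | complex.Re z = 0].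

Definition imaginary_segment {R : realType} (a b : R) : set R[i] :=
  [set z | complex.Re z = 0 /\ a <= complex.Im z <= b].

(* Main.v *)
From HB Require Import structures.
Require Import Defs.
From mathcomp Require Import all_boot all_order all_algebra complex.
From mathcomp Require Import ring lra.
From mathcomp Require Import all_classical all_reals all_analysis measurable_realfun.
Import Order.TTheory GRing.Theory Num.Theory.
Import numFieldNormedType.Exports.
Set Implicit Arguments.
Unset Strict Implicit.
Unset Printing Implicit Defensive.
Local Open Scope classical_set_scope.
Local Open Scope ring_scope.
Local Open Scope complex_scope.

(** Let V(omega)(u, v) = (f, g) with omega = x + i y, and let e, s and n be the
    forms <eps u, u>, <sigma u, u> and <mu v, v>.  As curl0 and curl are
    adjoint to each other, the curl terms cancel in <f, u> - <v, g>, and the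
    real and imaginary parts of what remains are, up to sign,

      x (n - e)   and   y (n + e) + s                                 [balance]

    Consider first f = g = 0, so that both vanish.  Since s lies between
    (sigma_min / eps_max) e and (sigma_max / eps_min) e, the second identity
    confines the spectrum on the imaginary axis to the segment.  Off the axis
    n = e, hence s = - 2 y e, and y lies in the strip.

    The last condition of the enclosure comes from the spectral gap.
    Split u into a divergence-free part u0 and a part killed by curl0
    [helmholtz].  Then curl0 u0 = curl0 u = i omega mu v, so that

      lambda |u0|^2 <= |omega mu v|^2 <= |omega|^2 mu_max n        [curl_bound]

    while testing the first row of the system with u0 gives

      |omega|^2 n = Re (omega <omega eps u + i sigma u, u0>)         [balance0]

    The right-hand side is estimated by Young's inequality in the norm of eps
    [energy_young].  With Lam = lambda / (eps_max mu_max), so that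
    Lam <eps u0, u0> <= |omega|^2 n, and tau = sigma_max / eps_min, the best
    parameter in that inequality yields

      Lam n <= |omega|^2 e + (2 y + tau) s,

    and inserting n = e and s = - 2 y e turns this into
    Lam <= x^2 - 3 y^2 - 2 tau y, where y <= 0.

    With data f, g the same computation holds up to errors, which are absorbed
    [estimate_axis, estimate_strip, estimate_gap, absorb]: outside the enclosure
    V(omega) is bounded below [maxwell_lower_bound].  The coefficients being
    real and symmetric, complex conjugation carries the adjoint of V(omega) to
    V(omega) itself; a vector orthogonal to the range therefore comes from the
    kernel, which is trivial, and V(omega) is boundedly invertible
    [maxwell_resolvent].

    That lambda is the minimum of the spectrum of curl curl0 on divergence-free
    fields is proved by identifying both with the infimum of
    |curl0 u|^2 / |u|^2 over these fields.  The operator is self-adjoint by von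
    Neumann's argument [curlcurl_selfadjoint]; lower bounds of its form put
    every point off the half-line that starts at the infimum in the resolvent
    set; and the infimum itself is in the spectrum because otherwise it could be
    increased [curlcurl_minimum].

    All this uses only a complete inner product, possibly degenerate, and a
    pair of operators adjoint to each other.  For fields on Omega, completeness
    is the Riesz-Fischer theorem, the adjoint pair comes from integration by
    parts of test fields [curl_pair_L2], and a bump function yields a field with
    non-zero curl [nonzero_curl], without which the infimum above would be over
    the empty set.

    The two corollaries are elementary: a real omega has y = 0, and
    3 y^2 - 2 tau |y| >= - tau^2 / 3 bounds x^2 from below off the axis. *)

(** * Complex numbers and two real inequalities *)

Section ReIm.
Context {R : realType}.
Implicit Types x y : R[i].

Lemma reD x y : complex.Re (x + y) = complex.Re x + complex.Re y.
Proof. by case: x; case: y. Qed.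
Lemma imD x y : complex.Im (x + y) = complex.Im x + complex.Im y.
Proof. by case: x; case: y. Qed.
Lemma reN x : complex.Re (- x) = - complex.Re x. Proof. by case: x. Qed.
Lemma imN x : complex.Im (- x) = - complex.Im x. Proof. by case: x. Qed.
Lemma reM x y : complex.Re (x * y) =
  complex.Re x * complex.Re y - complex.Im x * complex.Im y.
Proof. by case: x; case: y. Qed.
Lemma imM x y : complex.Im (x * y) =
  complex.Re x * complex.Im y + complex.Im x * complex.Re y.
Proof. by case: x; case: y. Qed.
Lemma reJ x : complex.Re (conjc x) = complex.Re x. Proof. by case: x. Qed.
Lemma imJ x : complex.Im (conjc x) = - complex.Im x. Proof. by case: x. Qed.
Definition reimE := (reD, imD, reN, imN, reM, imM, reJ, imJ).

Lemma complex_eq x y : complex.Re x = complex.Re y ->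
  complex.Im x = complex.Im y -> x = y.
Proof. by case: x; case: y => a b c d /= -> ->. Qed.

Lemma conjcD x y : conjc (x + y) = conjc x + conjc y.
Proof. by apply: complex_eq; rewrite !reimE // opprD. Qed.
Lemma conjcM x y : conjc (x * y) = conjc x * conjc y.
Proof. by apply: complex_eq; rewrite !reimE; ring. Qed.
Lemma conjcN x : conjc (- x) = - conjc x.
Proof. by apply: complex_eq; rewrite !reimE. Qed.

Definition csq x := complex.Re x ^+ 2 + complex.Im x ^+ 2.

Lemma csq_ge0 x : 0 <= csq x.
Proof. by rewrite addr_ge0 ?sqr_ge0. Qed.

(** A quadratic polynomial that stays non-negative has a non-positive
    discriminant; this is the source of every Cauchy-Schwarz inequality
    below. *)
Lemma discr_le (a r s : R) : 0 <= s ->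
  (forall t, 0 <= a - 2 * t * r + t ^+ 2 * s) -> r ^+ 2 <= a * s.
Proof.
move=> s0 h; have [s_eq0|s_neq0] := eqVneq s 0.
  rewrite s_eq0 mulr0; have [->|r0] := eqVneq r 0; first by rewrite expr0n.
  have := h ((a + 1) / (2 * r)); rewrite s_eq0 mulr0 addr0.
  have -> : 2 * ((a + 1) / (2 * r)) * r = a + 1.
    by field; rewrite r0.
  by rewrite opprD addrA subrr sub0r; lra.
have sp : 0 < s by rewrite lt0r s_neq0.
have := h (r / s).
have -> : a - 2 * (r / s) * r + (r / s) ^+ 2 * s = (a * s - r ^+ 2) / s.
  by field.
by rewrite pmulr_lge0 ?invr_gt0 // subr_ge0.
Qed.

Lemma le0_of_small (x K : R) : 0 <= K ->
  (forall e, 0 < e -> x <= e * K) -> x <= 0.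
Proof.
move=> K0 h; rewrite leNgt; apply/negP => x0.
have K1 : 0 < K + 1 by lra.
have := h (x / (K + 1)) (divr_gt0 x0 K1).
rewrite mulrAC ler_pdivlMr //; nra.
Qed.
End ReIm.

(** * Complete semi-definite inner products *)

(** Definiteness is not required, so that square-integrable functions can be
    used as vectors without a quotient: a function vanishing almost everywhere
    is a vector of length zero. *)
Record semi_inner (R : realType) (V : lmodType R[i]) (dot : V -> V -> R[i]) :
  Prop := SemiInner {
  dotDl : forall u v w, dot (u + v) w = dot u w + dot v w;
  dotZl : forall a u v, dot (a *: u) v = a * dot u v;
  dotC : forall u v, dot v u = conjc (dot u v);
  dot_ge0 : forall u, 0 <= dot u u }.

Section SemiInner.
Context {R : realType} {V : lmodType R[i]} (dot : V -> V -> R[i]).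
Hypothesis hd : semi_inner dot.
Implicit Types (u v w : V) (a : R[i]) (M : set V).

Definition sqn u : R := complex.Re (dot u u).

Lemma dotDr u v w : dot u (v + w) = dot u v + dot u w.
Proof. by rewrite (dotC hd) (dotDl hd) conjcD; rewrite -!(dotC hd). Qed.
Lemma dotZr a u v : dot u (a *: v) = conjc a * dot u v.
Proof. by rewrite (dotC hd) (dotZl hd) conjcM -!(dotC hd). Qed.
Lemma dotNl u v : dot (- u) v = - dot u v.
Proof. by rewrite -scaleN1r (dotZl hd) mulN1r. Qed.
Lemma dotNr u v : dot u (- v) = - dot u v.
Proof. by rewrite (dotC hd) dotNl conjcN -(dotC hd). Qed.
Lemma dotBl u v w : dot (u - v) w = dot u w - dot v w.
Proof. by rewrite (dotDl hd) dotNl. Qed.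
Lemma dotBr u v w : dot u (v - w) = dot u v - dot u w.
Proof. by rewrite dotDr dotNr. Qed.
Lemma dot0l u : dot 0 u = 0.
Proof. by rewrite -(subrr 0) dotBl subrr. Qed.
Lemma dot0r u : dot u 0 = 0.
Proof. by rewrite -(subrr 0) dotBr subrr. Qed.
Definition dotE := (dotDr, dotZr, dotNl, dotNr, dot0l, dot0r,
  dotDl hd, dotZl hd).

Lemma im_dotvv u : complex.Im (dot u u) = 0.
Proof. by have := dot_ge0 hd u; rewrite lecE => /andP[/eqP]. Qed.
Lemma dotvv u : dot u u = (sqn u)%:C.
Proof. by apply: complex_eq; rewrite // im_dotvv. Qed.
Lemma sqn_ge0 u : 0 <= sqn u.
Proof. by have := dot_ge0 hd u; rewrite lecE => /andP[]. Qed.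
Lemma re_dotC u v : complex.Re (dot v u) = complex.Re (dot u v).
Proof. by rewrite (dotC hd) reJ. Qed.
Lemma im_dotC u v : complex.Im (dot v u) = - complex.Im (dot u v).
Proof. by rewrite (dotC hd) imJ. Qed.

Lemma sqn0 : sqn 0 = 0. Proof. by rewrite /sqn dot0l. Qed.
Lemma sqnN u : sqn (- u) = sqn u.
Proof. by rewrite /sqn dotNl dotNr opprK. Qed.
Lemma sqnD u v : sqn (u + v) = sqn u + 2 * complex.Re (dot u v) + sqn v.
Proof.
by rewrite /sqn !dotE !reimE (re_dotC u v); ring.
Qed.
Lemma sqnB u v : sqn (u - v) = sqn u - 2 * complex.Re (dot u v) + sqn v.
Proof. by rewrite sqnD sqnN dotNr reN; ring. Qed.
Lemma sqnBC u v : sqn (u - v) = sqn (v - u).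
Proof. by rewrite -sqnN opprB. Qed.
Lemma sqnZ a u : sqn (a *: u) = csq a * sqn u.
Proof.
rewrite {1}/sqn !dotE !reimE im_dotvv /csq /sqn; ring.
Qed.
Lemma parallelogram u v : sqn (u + v) + sqn (u - v) = 2 * sqn u + 2 * sqn v.
Proof. by rewrite sqnB sqnD; ring. Qed.
Lemma sqnD_le u v : sqn (u + v) <= 2 * sqn u + 2 * sqn v.
Proof. by rewrite -parallelogram lerDl sqn_ge0. Qed.

Lemma re_cauchy_schwarz u v : complex.Re (dot u v) ^+ 2 <= sqn u * sqn v.
Proof.
apply: discr_le => [|t]; first exact: sqn_ge0.
have := sqn_ge0 (u - t%:C *: v).
rewrite sqnB sqnZ /csq !dotE !reimE /=.
by congr (0 <= _); ring.
Qed.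

Lemma im_cauchy_schwarz u v : complex.Im (dot u v) ^+ 2 <= sqn u * sqn v.
Proof.
have := re_cauchy_schwarz u ('i *: v).
by rewrite sqnZ !dotE !reimE /csq /= !(mul0r, oppr0, sub0r, expr0n, expr1n, add0r, mul1r, mulN1r, opprK).
Qed.

Lemma dot_null u v : sqn u = 0 -> dot u v = 0.
Proof.
move=> u0; apply: complex_eq; apply/eqP; rewrite -sqrf_eq0 eq_le sqr_ge0 andbT.
  by have := re_cauchy_schwarz u v; rewrite u0 mul0r.
by have := im_cauchy_schwarz u v; rewrite u0 mul0r.
Qed.

(** Closedness is phrased with approximations rather than with limits of
    sequences: the closed subspaces below are orthogonal complements, and for
    these one nearby point is enough. *)
Definition adherent M u := forall e, 0 < e -> exists2 m, M m & sqn (u - m) < e.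
Definition closed_set M := forall u, adherent M u -> M u.
Definition subspace M := M 0 /\ forall a u v, M u -> M v -> M (a *: u + v).
Definition cauchy_seq (s : nat -> V) := forall e, 0 < e ->
  exists N, forall m n, (N <= m)%N -> (N <= n)%N -> sqn (s m - s n) < e.
Definition limit_seq (s : nat -> V) l := forall e, 0 < e ->
  exists N, forall n, (N <= n)%N -> sqn (s n - l) < e.
Definition complete_form :=
  forall s, cauchy_seq s -> exists l, limit_seq s l.

Definition ortho M : set V := [set u | forall m, M m -> dot u m = 0].

Lemma subspace_ortho M : subspace (ortho M).
Proof.
split=> [m _|a u v hu hv m Mm]; first exact: dot0l.
by rewrite !dotE hu // hv // mulr0 addr0.
Qed.

(** Cauchy-Schwarz makes the form continuous. *)
Lemma adherent_dot M u v : adherent M u ->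
  (forall m, M m -> dot m v = 0) -> dot u v = 0.
Proof.
move=> hu hM.
have h e : 0 < e -> exists2 d, sqn d < e & dot u v = dot d v.
  move=> /hu[m Mm sm]; exists (u - m) => //.
  by rewrite dotBl (hM m) // subr0.
apply: complex_eq; apply/eqP; rewrite -sqrf_eq0 eq_le sqr_ge0 andbT /=;
  apply: (le0_of_small (sqn_ge0 v)) => e /h[d de ->].
- apply: le_trans (re_cauchy_schwarz d v) _.
  by rewrite ler_wpM2r ?sqn_ge0 // ltW.
- apply: le_trans (im_cauchy_schwarz d v) _.
  by rewrite ler_wpM2r ?sqn_ge0 // ltW.
Qed.

Lemma closed_ortho M : closed_set (ortho M).
Proof.
by move=> u hu m Mm; apply: (adherent_dot hu) => v; apply.
Qed.

Lemma inv_gt0 (n : nat) : 0 < (n.+1%:R)^-1 :> R.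
Proof. by rewrite invr_gt0 ltr0n. Qed.

Lemma inv_small (e : R) : 0 < e -> exists N, forall n, (N <= n)%N ->
  (n.+1%:R)^-1 < e.
Proof.
move=> e0; exists (Num.truncn e^-1) => n Nn.
have ei : 0 <= e^-1 by rewrite invr_ge0 ltW.
rewrite -[e]invrK ltf_pV2 ?posrE ?invr_gt0 ?ltr0n //.
have := Num.Theory.truncnS_gt e^-1.
move=> /lt_le_trans; apply; by rewrite ler_nat.
Qed.

Lemma limit_adherent M (s : nat -> V) l :
  (forall n, M (s n)) -> limit_seq s l -> adherent M l.
Proof.
move=> hM hl e /hl[N hN]; exists (s N) => //; rewrite sqnBC; exact: hN.
Qed.

Lemma subspaceD M u v : subspace M -> M u -> M v -> M (u + v).
Proof. by move=> [_ h] Mu Mv; rewrite -[u]scale1r; apply: h. Qed.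
Lemma subspaceZ M a u : subspace M -> M u -> M (a *: u).
Proof. by move=> [h0 h] Mu; rewrite -[_ *: _]addr0; apply: h. Qed.
Lemma subspaceB M u v : subspace M -> M u -> M v -> M (u - v).
Proof.
by move=> h Mu Mv; rewrite -scaleN1r; apply: subspaceD => //; apply: subspaceZ.
Qed.

(** The nearest point: a minimising sequence is Cauchy by the parallelogram
    law, and almost minimal points are almost orthogonal by the discriminant
    criterion. *)
Theorem projection M f : complete_form -> subspace M -> closed_set M ->
  exists2 p, M p & ortho M (f - p).
Proof.
move=> hc hM cM.
pose D := [set sqn (f - m) | m in M].
have D0 : D !=set0 by exists (sqn (f - 0)); exists 0 => //; case: hM.
have Dlb : has_lbound D by exists 0 => _ [m _ <-]; exact: sqn_ge0.
have Dinf : has_inf D by split.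
pose d := inf D.
have dle m : M m -> d <= sqn (f - m).
  by move=> Mm; apply: ge_inf => //; exists m.
have hp n : exists2 p, M p & sqn (f - p) < d + (n.+1%:R)^-1.
  by have [_ [p Mp <-] ?] := inf_adherent (inv_gt0 n) Dinf; exists p.
pose p n := s2val (cid2 (hp n)).
have Mp n : M (p n) by exact: s2valP (cid2 (hp n)).
have pd n : sqn (f - p n) < d + (n.+1%:R)^-1 by exact: s2valP' (cid2 (hp n)).
have cp : cauchy_seq p.
  move=> e e0; have [N hN] := inv_small (divr_gt0 e0 (ltr0n R 4)).
  exists N => m n Nm Nn.
  have := parallelogram (f - p n) (f - p m).
  have -> : f - p n - (f - p m) = p m - p n.
    by rewrite opprB addrC addrA subrK.
  have -> : f - p n + (f - p m) = 2 *: (f - (2^-1 *: (p n + p m))).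
    rewrite scalerBr scalerA mulfV ?pnatr_eq0 // scale1r scaler_nat mulr2n.
    by rewrite opprD addrACA.
  have := dle (2^-1 *: (p n + p m)) (subspaceZ _ hM (subspaceD hM (Mp n) (Mp m))).
  rewrite sqnZ.
  have -> : csq (2 : R[i]) = 4.
    rewrite /csq; have -> : (2 : R[i]) = 2%:C by rewrite rmorph_nat.
    by rewrite /=; ring.
  have := pd n; have := pd m; have := hN n Nn; have := hN m Nm.
  move: (sqn _) (sqn _) (sqn _) (sqn _) => a b c g.
  set i1 := n.+1%:R^-1; set i2 := m.+1%:R^-1; lra.
have [l hl] := hc _ cp; exists l.
  exact: cM (limit_adherent Mp hl).
have re0 m : M m -> complex.Re (dot (f - l) m) = 0.
  move=> Mm; apply/eqP; rewrite -sqrf_eq0 eq_le sqr_ge0 andbT.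
  have K0 : 0 <= 4 * sqn m by rewrite mulr_ge0 ?sqn_ge0.
  apply: (le0_of_small K0) => e e0.
  have [N1 hN1] := inv_small e0; have [N2 hN2] := hl _ e0.
  pose n := maxn N1 N2.
  have h1 := hN1 n (leq_maxl _ _); have h2 := hN2 n (leq_maxr _ _).
  have -> : f - l = (f - p n) + (p n - l) by rewrite addrA subrK.
  rewrite (dotDl hd) reD.
  have r1 : complex.Re (dot (f - p n) m) ^+ 2 <= e * sqn m.
    apply: discr_le => [|t]; first exact: sqn_ge0.
    have Mt : M (p n + t%:C *: m) by apply: subspaceD => //; apply: subspaceZ.
    have := dle _ Mt.
    rewrite opprD addrA sqnB sqnZ /csq dotZr !reimE /= => hh.
    by have := pd n; move: h1; set i := n.+1%:R^-1; lra.
  have r2 : complex.Re (dot (p n - l) m) ^+ 2 <= e * sqn m.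
    apply: le_trans (re_cauchy_schwarz _ _) _.
    by rewrite ler_wpM2r ?sqn_ge0 // ltW.
  move: r1 r2; set x := complex.Re _; set y := complex.Re _ => r1 r2.
  have := sqr_ge0 (x - y); nra.
move=> m Mm; apply: complex_eq; first exact: re0.
have := re0 _ (subspaceZ 'i hM Mm).
by rewrite dotZr !reimE /= mul0r mulN1r sub0r opprK.
Qed.

End SemiInner.

Section Product.
Context {R : realType} {V W : lmodType R[i]}.
Variables (dot : V -> V -> R[i]) (dot' : W -> W -> R[i]).
Hypotheses (hd : semi_inner dot) (hd' : semi_inner dot').

Definition dotp (x y : V * W) := dot x.1 y.1 + dot' x.2 y.2.

Lemma semi_inner_prod : semi_inner dotp.
Proof.
split=> [u v w|a u v|u v|u]; rewrite /dotp /=.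
- by rewrite !(dotDl hd) !(dotDl hd') addrACA.
- by rewrite !(dotZl hd) !(dotZl hd') mulrDr.
- by rewrite (dotC hd) (dotC hd') conjcD.
- by rewrite addr_ge0 // ?(dot_ge0 hd) // (dot_ge0 hd').
Qed.

Lemma sqn_prod x : sqn dotp x = sqn dot x.1 + sqn dot' x.2.
Proof. by rewrite /sqn reD. Qed.

Lemma complete_prod : complete_form dot -> complete_form dot' ->
  complete_form dotp.
Proof.
move=> h1 h2 u hu.
have [|l1 hl1] := h1 (fun n => (u n).1).
  move=> e /hu[N hN]; exists N => m n Nm Nn; apply: le_lt_trans (hN _ _ Nm Nn).
  by rewrite sqn_prod lerDl (sqn_ge0 hd').
have [|l2 hl2] := h2 (fun n => (u n).2).
  move=> e /hu[N hN]; exists N => m n Nm Nn; apply: le_lt_trans (hN _ _ Nm Nn).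
  by rewrite sqn_prod lerDr (sqn_ge0 hd).
exists (l1, l2) => e e0; have e2 : 0 < e / 2 by lra.
have [N1 hN1] := hl1 _ e2; have [N2 hN2] := hl2 _ e2.
exists (maxn N1 N2) => n; rewrite geq_max => /andP[/hN1 n1 /hN2 n2].
by rewrite sqn_prod /=; lra.
Qed.
End Product.

Section Range.
Context {R : realType} {V : lmodType R[i]} (dot : V -> V -> R[i]).
Hypothesis hd : semi_inner dot.
Hypothesis hc : complete_form dot.

(** A closed relation that is bounded below has a closed range, because
    preimages of a Cauchy sequence form a Cauchy sequence; the projection onto
    the range then solves the equation up to a vector orthogonal to it. *)
Theorem range_projection (T : set (V * V)) (C : R) f :
  subspace T -> closed_set (dotp dot dot) T ->
  (forall x, T x -> sqn dot x.1 <= C * sqn dot x.2) ->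
  exists2 x, T x & forall y, T y -> dot (f - x.2) y.2 = 0.
Proof.
move=> sT cT hT.
pose M := [set x.2 | x in T].
have sM : subspace M.
  split; first by exists 0 => //; case: sT.
  move=> a _ _ [x Tx <-] [y Ty <-]; exists (a *: x + y) => //.
  by case: sT => _; apply.
have C1 : 0 < `|C| + 1 by rewrite ltr_wpDl.
have hT' x : T x -> sqn dot x.1 <= (`|C| + 1) * sqn dot x.2.
  move=> /hT /le_trans; apply; rewrite ler_wpM2r ?(sqn_ge0 hd) //.
  by apply: le_trans (ler_norm _) _; rewrite lerDl.
have cM : closed_set dot M.
  move=> l hl.
  have hx n : exists2 x, T x & sqn dot (l - x.2) < (n.+1%:R)^-1.
    by have [_ [x Tx <-] ?] := hl _ (inv_gt0 n); exists x.
  pose x n := s2val (cid2 (hx n)).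
  have Tx n : T (x n) by exact: s2valP (cid2 (hx n)).
  have xl n : sqn dot (l - (x n).2) < (n.+1%:R)^-1.
    exact: s2valP' (cid2 (hx n)).
  have [|u hu] := hc (s := fun n => (x n).1).
    move=> e e0; have [N hN] := inv_small (divr_gt0 (divr_gt0 e0 C1) (ltr0n R 4)).
    exists N => m n Nm Nn.
    have := hT' _ (subspaceB sT (Tx m) (Tx n)) => /= /le_lt_trans; apply.
    rewrite -ltr_pdivlMl // mulrC.
    have -> : (x m).2 - (x n).2 = (l - (x n).2) - (l - (x m).2).
      by rewrite opprB [RHS]addrC addrA subrK.
    apply: le_lt_trans (sqnD_le hd _ _) _; rewrite (sqnN hd).
    have := xl n; have := xl m; have := hN _ Nm; have := hN _ Nn.
    set i1 := n.+1%:R^-1; set i2 := m.+1%:R^-1; lra.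
  exists (u, l) => //; apply: cT => e e0.
  have e2 : 0 < e / 2 by lra.
  have [N1 hN1] := inv_small e2; have [N2 hN2] := hu _ e2.
  pose n := maxn N1 N2; exists (x n) => //.
  rewrite sqn_prod /= (sqnBC hd).
  have := hN2 n (leq_maxr _ _); have := hN1 n (leq_maxl _ _); have := xl n.
  set i1 := n.+1%:R^-1; lra.
have [_ [x Tx <-] hx] := projection hd f hc sM cM.
by exists x => // y Ty; apply: hx; exists y.
Qed.

End Range.

(** * The operator curl curl0 on divergence-free vectors *)

Section AdjointPair.
Context {R : realType} {V : lmodType R[i]} (dot : V -> V -> R[i]).
Variables (T0 T1 : V -> V -> Prop) (G : set V).

(** The abstract form of the pair (curl0, curl): two relations that are the
    adjoint of each other, together with vectors (the gradients) killed by the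
    first one.  The orthogonal complement of these vectors plays the role of
    H(div 0). *)
Record curl_pair : Prop := CurlPair {
  adj0 : forall u c,
    T0 u c <-> (forall v d, T1 v d -> dot c v = dot u d);
  adj1 : forall v d,
    T1 v d <-> (forall u c, T0 u c -> dot d u = dot v c);
  grad0 : forall g, G g -> T0 g 0 }.

Definition divfree : set V := ortho dot G.

Definition curlcurl u w :=
  [/\ divfree u, divfree w & exists2 c, T0 u c & T1 c w].

Definition curlcurl_pencil (z : R[i]) u f :=
  exists2 w, curlcurl u w & sqn dot (f - (w - z *: u)) = 0.

Definition null_eq u v := sqn dot (u - v) = 0.

Definition hnorm u := Num.sqrt (sqn dot u).

Definition curlcurl_spectrum := spectrum divfree null_eq hnorm curlcurl_pencil.

(** The infimum of the Rayleigh quotients of the operator curlcurl. *)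
Definition curl_bottom := inf [set x : R | exists u c,
  [/\ divfree u, T0 u c, sqn dot u != 0 & x = sqn dot c / sqn dot u]].

Hypothesis hd : semi_inner dot.
Hypothesis hc : complete_form dot.
Hypothesis hT : curl_pair.

Let hp : semi_inner (dotp dot dot) := semi_inner_prod hd hd.

Lemma null_refl u : null_eq u u.
Proof. by rewrite /null_eq subrr sqn0. Qed.
Lemma null_sym u v : null_eq u v -> null_eq v u.
Proof. by rewrite /null_eq sqnBC. Qed.

Lemma null_adherent (M : set V) u v : M u -> null_eq u v -> adherent dot M v.
Proof. by move=> Mu uv e e0; exists u => //; rewrite (sqnBC hd) uv. Qed.

Lemma dot_null_eq u v w : null_eq u v -> dot u w = dot v w.
Proof.
by move=> uv; apply/eqP; rewrite -subr_eq0 -(dotBl hd) (dot_null hd).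
Qed.

Lemma adherent_fst (M : set (V * V)) x :
  adherent (dotp dot dot) M x -> adherent dot [set m.1 | m in M] x.1.
Proof.
move=> hx e /hx[m Mm]; rewrite sqn_prod => h; exists m.1; first by exists m.
by apply: le_lt_trans h; rewrite lerDl (sqn_ge0 hd).
Qed.

Lemma adherent_snd (M : set (V * V)) x :
  adherent (dotp dot dot) M x -> adherent dot [set m.2 | m in M] x.2.
Proof.
move=> hx e /hx[m Mm]; rewrite sqn_prod => h; exists m.2; first by exists m.
by apply: le_lt_trans h; rewrite lerDr (sqn_ge0 hd).
Qed.

Lemma adherentS (M N : set V) x : M `<=` N -> adherent dot M x ->
  adherent dot N x.
Proof. by move=> MN hx e /hx[m Mm ?]; exists m => //; exact: MN. Qed.

Definition graph (T : V -> V -> Prop) : set (V * V) := [set x | T x.1 x.2].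

Lemma dotp_graph u c v d :
  dotp dot dot (u, c) (- d, v) = dot c v - dot u d.
Proof. by rewrite /dotp /= (dotNr hd) addrC. Qed.

(** The graph of an adjoint is the orthogonal complement of a rotated graph. *)
Lemma closed_adjoint (S T : V -> V -> Prop) :
  (forall u c, T u c <-> (forall v d, S v d -> dot c v = dot u d)) ->
  closed_set (dotp dot dot) (graph T).
Proof.
move=> hTS [u c] hu; apply/hTS => v d Svd; apply/eqP.
rewrite -subr_eq0 -dotp_graph; apply/eqP/(adherent_dot hp hu) => -[a b] /= Tab.
by rewrite dotp_graph (iffLR (hTS _ _) Tab v d Svd) subrr.
Qed.

Lemma subspace_adjoint (S T : V -> V -> Prop) :
  (forall u c, T u c <-> (forall v d, S v d -> dot c v = dot u d)) ->
  subspace (graph T).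
Proof.
move=> hTS; split; first by apply/hTS => v d _; rewrite !(dot0l hd).
move=> a [u c] [u' c'] /hTS h /hTS h'; apply/hTS => v d Svd /=.
by rewrite !(dotE hd) (h _ _ Svd) (h' _ _ Svd).
Qed.

Lemma closed0 : closed_set (dotp dot dot) (graph T0).
Proof. exact: closed_adjoint (adj0 hT). Qed.
Lemma subspace0 : subspace (graph T0).
Proof. exact: subspace_adjoint (adj0 hT). Qed.
Lemma subspace1 : subspace (graph T1).
Proof. exact: subspace_adjoint (adj1 hT). Qed.
Lemma T0Z a u c : T0 u c -> T0 (a *: u) (a *: c).
Proof. by move=> h; have := subspaceZ a subspace0 (u := (u, c)) h. Qed.
Lemma T0B u c v d : T0 u c -> T0 v d -> T0 (u - v) (c - d).
Proof. by move=> h k; have := subspaceB subspace0 (u := (u, c)) (v := (v, d)) h k. Qed.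
Lemma T0D u c v d : T0 u c -> T0 v d -> T0 (u + v) (c + d).
Proof. by move=> h k; have := subspaceD subspace0 (u := (u, c)) (v := (v, d)) h k. Qed.
Lemma T1Z a u c : T1 u c -> T1 (a *: u) (a *: c).
Proof. by move=> h; have := subspaceZ a subspace1 (u := (u, c)) h. Qed.
Lemma T1D u c v d : T1 u c -> T1 v d -> T1 (u + v) (c + d).
Proof. by move=> h k; have := subspaceD subspace1 (u := (u, c)) (v := (v, d)) h k. Qed.

Lemma subspace_divfree : subspace divfree.
Proof. exact: subspace_ortho. Qed.
Lemma closed_divfree : closed_set dot divfree.
Proof. exact: closed_ortho. Qed.
Lemma divfree_null u v : divfree u -> null_eq u v -> divfree v.
Proof. by move=> h uv; apply: closed_divfree (null_adherent h uv). Qed.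
(** The divergence of a curl vanishes because the curl of a gradient does. *)
Lemma divfree_range v d : T1 v d -> divfree d.
Proof.
by move=> h g /(grad0 hT) h0; rewrite (iffLR (adj1 hT _ _) h _ _ h0) (dot0r hd).
Qed.

Lemma T0_null u c u' c' : T0 u c -> null_eq u u' -> null_eq c c' -> T0 u' c'.
Proof.
move=> h uu cc; apply: (closed0 (u := (u', c'))) => e e0; exists (u, c) => //.
rewrite sqn_prod /= -/(null_eq u' u); have := null_sym uu; have := null_sym cc.
by rewrite /null_eq => -> ->; rewrite addr0.
Qed.

Lemma T1_null u c c' : T1 u c -> null_eq c c' -> T1 u c'.
Proof.
move=> h cc; apply/(adj1 hT) => v d Tvd.
by rewrite -(iffLR (adj1 hT _ _) h _ _ Tvd) (dot_null_eq _ cc).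
Qed.

(** The Helmholtz decomposition.  A vector orthogonal to divfree is its own
    projection onto the kernel of T0, up to a null vector: the remainder is
    orthogonal to the gradients, hence divergence free. *)
Lemma helmholtz u : exists2 u0, divfree u0 &
  T0 (u - u0) 0 /\ forall k, divfree k -> dot (u - u0) k = 0.
Proof.
have [u0 Ku0 hu0] := projection hd u hc subspace_divfree closed_divfree.
exists u0 => //; split=> //; set g := u - u0.
pose N := [set n | T0 n 0].
have sN : subspace N.
  split; first by have [] := subspace0.
  move=> a n m Nn Nm; have := T0D (T0Z a Nn) Nm.
  by rewrite scaler0 addr0.
have cN : closed_set dot N.
  move=> n hn; apply: (closed0 (u := (n, 0))) => e /hn[m Nm h].
  by exists (m, 0) => //; rewrite sqn_prod /= subr0 (sqn0 hd) addr0.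
have [n Nn hn] := projection hd g hc sN cN.
have Kh : divfree (g - n) by move=> k /(grad0 hT); apply: hn.
apply: (T0_null Nn); last exact: null_refl.
have E : dot n (g - n) = 0 by rewrite (dotC hd) hn //; apply: complex_eq; rewrite //= oppr0.
by apply: null_sym; rewrite /null_eq /sqn (dotBl hd) E (hu0 _ Kh) subr0.
Qed.

Lemma adj_curl u c v d : T0 u c -> T1 v d -> dot d u = dot v c.
Proof. by move=> h /(adj1 hT); apply. Qed.

(** von Neumann's argument for 1 + T1 T0: project (f, 0) onto the graph of
    T0. *)
Lemma curlcurl1_surj f : divfree f -> exists2 u, divfree u & curlcurl u (f - u).
Proof.
move=> Kf.
have [[u c] /= Tuc huc] := projection hp (f, 0) (complete_prod hd hd hc hc)
  subspace0 closed0.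
have T1c : T1 c (f - u).
  apply/(adj1 hT) => v d Tvd; have := huc (v, d) Tvd.
  by rewrite /dotp /= (dotBl hd 0) (dot0l hd) sub0r => /eqP; rewrite subr_eq0 => /eqP.
have Ku : divfree u.
  have := subspaceB subspace_divfree Kf (divfree_range T1c).
  by rewrite opprB addrC subrK.
by exists u => //; split=> //; [exact: divfree_range T1c|exists c].
Qed.

Lemma curlcurl_sym u w v q : curlcurl u w -> curlcurl v q -> dot w v = dot u q.
Proof.
move=> [_ _ [c uc cw]] [_ _ [d vd dq]].
rewrite (adj_curl vd cw) [RHS](dotC hd) (adj_curl uc dq).
by rewrite (dotC hd d).
Qed.

(** Self-adjointness: a symmetric operator A with 1 + A onto is its own
    adjoint. *)
Lemma curlcurl_selfadjoint u w : divfree u -> divfree w ->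
  (forall v q, curlcurl v q -> dot w v = dot u q) -> curlcurl u w.
Proof.
move=> Ku Kw h.
have Kf : divfree (w + u) by exact: subspaceD subspace_divfree _ _.
have [u' Ku' Au'] := curlcurl1_surj Kf.
set w' := w + u - u' in Au'.
have uu' : null_eq u' u.
  apply: null_sym; rewrite /null_eq /sqn.
  have Kd : divfree (u - u') by exact: subspaceB subspace_divfree _ _.
  have [v Kv Av] := curlcurl1_surj Kd.
  rewrite {2}(_ : u - u' = (u - u' - v) + v); last by rewrite subrK.
  rewrite (dotDr hd) !(dotBl hd _ _ _) -(h _ _ Av) -(curlcurl_sym Au' Av).
  rewrite /w' (dotBl hd) (dotDl hd).
  set a := dot w v; set b := dot u v; set d := dot u' v.
  by rewrite (_ : a - (a + b - d) + (b - d) = 0) //; ring.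
case: Au' => _ _ [c u'c cw']; split=> //; exists c.
  exact: T0_null u'c uu' (null_refl _).
apply: T1_null cw' _; rewrite /null_eq /w'.
by rewrite [w + u]addrC addrAC addrK (sqnBC hd).
Qed.

Lemma subspace_curlcurl : subspace (graph curlcurl).
Proof.
split.
  have [? _] := subspace_divfree; split=> //; exists 0.
    by have [] := subspace0.
  by have [] := subspace1.
move=> a [u w] [v q] [Ku Kw [c uc cw]] [Kv Kq [d vd dq]].
have [_ h] := subspace_divfree.
split; [exact: h|exact: h|exists (a *: c + d)].
  exact: T0D (T0Z a uc) vd.
exact: T1D (T1Z a cw) dq.
Qed.

Lemma curlcurl_null u w w' : curlcurl u w -> null_eq w w' -> curlcurl u w'.
Proof.
move=> [Ku Kw [c uc cw]] ww; split=> //; first exact: divfree_null ww.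
by exists c => //; exact: T1_null cw ww.
Qed.

Lemma pencilP z u f : curlcurl_pencil z u f <-> curlcurl u (f + z *: u).
Proof.
split=> [[w uw h]|h]; last first.
  by exists (f + z *: u) => //; rewrite addrK subrr (sqn0 hd).
apply: curlcurl_null uw _; apply: null_sym; rewrite /null_eq.
by rewrite opprB addrA in h.
Qed.

Lemma closed_pencil z : closed_set (dotp dot dot) (graph (curlcurl_pencil z)).
Proof.
move=> [u f] hx; apply/pencilP.
have Ku : divfree u.
  apply: closed_divfree; apply: adherentS (adherent_fst hx).
  by move=> _ [[v q] /pencilP[Kv _ _] <-].
have Kf : divfree f.
  apply: closed_divfree; apply: adherentS (adherent_snd hx).
  move=> _ [[v q] /pencilP[/= Kv Kw _] <-] /=.
  have := subspaceB subspace_divfree Kw (subspaceZ z subspace_divfree Kv).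
  by rewrite addrK.
apply: curlcurl_selfadjoint => //.
  exact: subspaceD subspace_divfree Kf (subspaceZ z subspace_divfree Ku).
move=> v q Avq.
have E a b : dotp dot dot (a, b) (conjc z *: v - q, v) =
    dot (b + z *: a) v - dot a q.
  rewrite /dotp /= !(dotE hd).
  rewrite (_ : conjc (conjc z) = z); last by case: (z) => x y /=; rewrite opprK.
  by ring.
apply/eqP; rewrite -subr_eq0 -E; apply/eqP.
apply: (adherent_dot hp hx) => -[a b] /pencilP /= Aab.
by rewrite E (curlcurl_sym Aab Avq) subrr.
Qed.

Lemma subspace_pencil z : subspace (graph (curlcurl_pencil z)).
Proof.
have [s0 s] := subspace_curlcurl.
split; first by apply/pencilP; rewrite /= scaler0 addr0; exact: s0.
move=> a [u f] [v g] /pencilP /= h /pencilP /= k; apply/pencilP => /=.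
have := s a (u, f + z *: u) (v, g + z *: v) h k; rewrite /graph /=.
by congr (curlcurl _ _); rewrite !scalerDr scalerA mulrC -scalerA addrACA.
Qed.

Lemma bottom_set_lb : has_lbound [set x : R | exists u c,
  [/\ divfree u, T0 u c, sqn dot u != 0 & x = sqn dot c / sqn dot u]].
Proof.
by exists 0 => _ [u [c [_ _ _ ->]]]; rewrite divr_ge0 ?(sqn_ge0 hd).
Qed.

Lemma bottom_le u c : divfree u -> T0 u c ->
  curl_bottom * sqn dot u <= sqn dot c.
Proof.
move=> Ku uc; have [->|u0] := eqVneq (sqn dot u) 0.
  by rewrite mulr0 (sqn_ge0 hd).
rewrite -ler_pdivlMr ?lt0r ?u0 ?(sqn_ge0 hd) //.
by apply: ge_inf; [exact: bottom_set_lb|exists u, c].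
Qed.

(** Guarantees that some divergence-free vector is not killed by T0. *)
Hypothesis hK : exists u c d, [/\ T0 u c, T1 c d & sqn dot c != 0].

(** The divergence-free part of u has the same image c under T0, and is not
    null since dot c c = dot d u0. *)
Lemma bottom_set0 : [set x : R | exists u c,
  [/\ divfree u, T0 u c, sqn dot u != 0 & x = sqn dot c / sqn dot u]] !=set0.
Proof.
have [u [c [d [uc cd c0]]]] := hK.
have [u0 Ku0 [hN _]] := helmholtz u.
have u0c : T0 u0 c by have := T0B uc hN; rewrite opprB addrC subrK subr0.
exists (sqn dot c / sqn dot u0), u0, c; split=> //.
apply: contraNN c0 => /eqP n0.
by rewrite /sqn -(adj_curl u0c cd) (dotC hd) (dot_null hd).
Qed.

Lemma bottom_ge0 : 0 <= curl_bottom.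
Proof.
apply: lb_le_inf; first exact: bottom_set0.
by move=> _ [u [c [_ _ _ ->]]]; rewrite divr_ge0 ?(sqn_ge0 hd).
Qed.

(** Off the half-line starting at the bottom, the form |c|^2 - z|u|^2 is
    controlled from below by its real or by its imaginary part. *)
Lemma pencil_lower_bound z : ~ (curl_bottom%:C <= z) ->
  exists2 C : R, 0 < C & forall u f, curlcurl_pencil z u f ->
    sqn dot u <= C * sqn dot f.
Proof.
move=> hz.
have form u f : curlcurl_pencil z u f -> exists2 c, divfree u /\ T0 u c &
    dot f u = (sqn dot c)%:C - z * (sqn dot u)%:C.
  move=> /pencilP[Ku _ [c uc cw]]; exists c => //.
  have := adj_curl uc cw; rewrite (dotDl hd) (dotZl hd) !(dotvv hd) => <-.
  by rewrite addrK.
have [iz|iz] := eqVneq (complex.Im z) 0.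
  have rz : 0 < curl_bottom - complex.Re z.
    rewrite subr_gt0 ltNge; apply/negP => h; apply: hz.
    by rewrite lecE /= iz eqxx.
  set k := _ - _ in rz; exists (k ^+ 2)^-1; first by rewrite invr_gt0 exprn_gt0.
  move=> u f /form[c [Ku uc] E].
  have := congr1 (@complex.Re R) E; rewrite !reimE iz /= mul0r subr0 => Er.
  have h1 : k * sqn dot u <= complex.Re (dot f u).
    by rewrite Er /k mulrBl lerD2r bottom_le.
  have h2 := re_cauchy_schwarz hd f u.
  have su := sqn_ge0 hd u.
  rewrite mulrC ler_pdivlMr ?exprn_gt0 //.
  have [->|u0] := eqVneq (sqn dot u) 0; first by rewrite mul0r (sqn_ge0 hd).
  have up : 0 < sqn dot u by rewrite lt0r u0.
  rewrite -(ler_pM2r up); apply: le_trans h2.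
  rewrite (_ : _ * _ * _ = (k * sqn dot u) ^+ 2); last by ring.
  by rewrite ler_pXn2r ?nnegrE ?mulr_ge0 ?(ltW rz) //; apply: le_trans h1; rewrite mulr_ge0 ?(ltW rz).
exists (complex.Im z ^+ 2)^-1; first by rewrite invr_gt0 exprn_even_gt0.
move=> u f /form[c [Ku uc] E].
have := congr1 (@complex.Im R) E; rewrite !reimE /= mulr0 !add0r => Er.
have h2 := im_cauchy_schwarz hd f u.
have su := sqn_ge0 hd u.
rewrite mulrC ler_pdivlMr ?exprn_even_gt0 //.
have [->|u0] := eqVneq (sqn dot u) 0; first by rewrite mul0r (sqn_ge0 hd).
have up : 0 < sqn dot u by rewrite lt0r u0.
rewrite -(ler_pM2r up); apply: le_trans h2; rewrite Er.
by rewrite le_eqVlt; apply/orP; left; apply/eqP; ring.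
Qed.

Lemma dot_conjZ z u v : dot u (z *: v) = dot (conjc z *: u) v.
Proof. by rewrite (dotZr hd) (dotZl hd). Qed.

Lemma conjcI (z : R[i]) : conjc (conjc z) = z.
Proof. by case: z => a b /=; rewrite opprK. Qed.

(** By self-adjointness a divergence-free vector orthogonal to the range at z
    solves the homogeneous equation at the conjugate of z, and the lower bound
    there makes it null. *)
Lemma pencil_resolvent z : ~ (curl_bottom%:C <= z) -> ~ curlcurl_spectrum z.
Proof.
move=> hz; apply; have [C C0 hC] := pencil_lower_bound hz.
have hz' : ~ (curl_bottom%:C <= conjc z).
  by move=> h; apply: hz; move: h; case: (z) => a b; rewrite !lecE /= oppr_eq0.
have [C' C'0 hC'] := pencil_lower_bound hz'.
exists (Num.sqrt C) => f Kf.
have [|[u p] /= up hr] := range_projection hd hc (T := graph (curlcurl_pencil z))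
  (C := C) f (@subspace_pencil z) (@closed_pencil z).
  by move=> [u g]; exact: hC.
have Kp : divfree p.
  have /pencilP[Ku Kw _] := up.
  have := subspaceB subspace_divfree Kw (subspaceZ z subspace_divfree Ku).
  by rewrite addrK.
have Kr : divfree (f - p) by exact: subspaceB subspace_divfree _ _.
have : curlcurl_pencil (conjc z) (f - p) 0.
  apply/pencilP; rewrite add0r; apply: curlcurl_selfadjoint => //.
    exact: subspaceZ subspace_divfree _.
  move=> v q Avq; rewrite -dot_conjZ.
  have := hr (v, q - z *: v); rewrite /graph /= (dotBr hd) => h.
  apply/eqP; rewrite eq_sym -subr_eq0; apply/eqP; apply: h.
  by apply/pencilP; rewrite subrK.
move=> /hC'; rewrite (sqn0 hd) mulr0 => r0.
have fp : null_eq f p by apply/eqP; rewrite eq_le r0 (sqn_ge0 hd).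
have uf : curlcurl_pencil z u f.
  apply/pencilP; move/pencilP: up => /curlcurl_null; apply.
  by rewrite /null_eq opprD addrACA subrr addr0; exact: null_sym.
exists u; split=> //.
  by rewrite /hnorm -sqrtrM ?(ltW C0) // ler_sqrt ?mulr_ge0 ?(sqn_ge0 hd) ?(ltW C0) //; exact: hC.
move=> u' u'f; have := subspaceB (@subspace_pencil z) (u := (u', f)) (v := (u, f)) u'f uf.
move=> /hC; rewrite /= subrr (sqn0 hd) mulr0 => h.
by apply/eqP; rewrite eq_le h (sqn_ge0 hd).
Qed.

(** Were the bottom in the resolvent set, the solution w of (A - bottom) w = u
    would be controlled by u, and the non-negativity of the form at u - t w
    with t = 1/C would push the bottom up by 1/C. *)
Lemma bottom_spectrum : curlcurl_spectrum curl_bottom%:C.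
Proof.
move=> [C0 hC0]; set lam := curl_bottom in hC0.
pose C := `|C0| + 1.
have Cp : 0 < C by rewrite ltr_wpDl.
suff h u c : divfree u -> T0 u c -> (lam + C^-1) * sqn dot u <= sqn dot c.
  have : lam + C^-1 <= lam.
    apply: lb_le_inf; first exact: bottom_set0.
    move=> _ [u [c [Ku uc u0 ->]]].
    by rewrite ler_pdivlMr ?lt0r ?u0 ?(sqn_ge0 hd) //; exact: h.
  by rewrite gerDl leNgt invr_gt0 Cp.
move=> Ku uc; have [w [/pencilP[Kw _ [cw wcw cwq]] nw _]] := hC0 u Ku.
set q := u + lam%:C *: w in cwq.
have wC : sqn dot w <= C ^+ 2 * sqn dot u.
  rewrite -[sqn dot w]sqr_sqrtr ?(sqn_ge0 hd) //.
  rewrite -[sqn dot u]sqr_sqrtr ?(sqn_ge0 hd) // -exprMn.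
  rewrite ler_pXn2r ?nnegrE ?mulr_ge0 ?sqrtr_ge0 ?(ltW Cp) //.
  apply: le_trans nw _; rewrite ler_wpM2r ?sqrtr_ge0 //.
  by apply: le_trans (ler_norm _) _; rewrite lerDl.
have uw : complex.Re (dot u w) <= C * sqn dot u.
  have h := re_cauchy_schwarz hd u w; have su := sqn_ge0 hd u.
  apply: le_trans (ler_norm _) _.
  rewrite -[X in _ <= X]ger0_norm ?mulr_ge0 ?(ltW Cp) //.
  rewrite -ler_sqr ?nnegrE // !real_normK ?num_real //.
  apply: le_trans h _; rewrite exprMn mulrC expr2 mulrA.
  by rewrite ler_wpM2r.
have e1 := congr1 (@complex.Re R) (adj_curl uc cwq).
have e2 := congr1 (@complex.Re R) (adj_curl wcw cwq).
move: e1 e2; rewrite /q !(dotDl hd) !(dotZl hd) !reimE /= !mul0r !subr0.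
rewrite -/(sqn dot u) -/(sqn dot w) -/(sqn dot cw) => e1 e2.
pose t := C^-1.
have := bottom_le (subspaceB subspace_divfree Ku (subspaceZ t%:C subspace_divfree Kw))
  (T0B uc (T0Z t%:C wcw)).
rewrite -/lam !(sqnB hd) !(sqnZ hd) !(dotZr hd) !reimE /csq /= !oppr0 !mul0r !subr0.
rewrite expr0n /= addr0 (re_dotC hd cw c) -e1 -e2.
have -> : complex.Re (dot w u) = complex.Re (dot u w) by rewrite (re_dotC hd).
set a := sqn dot u; set b := complex.Re _; set d := sqn dot w.
have tt : t * b <= a by rewrite /t mulrC ler_pdivrMr // mulrC.
have t0 : 0 <= t by rewrite invr_ge0 ltW.
have : t ^+ 2 * b <= t * a by rewrite expr2 -mulrA ler_wpM2l.
rewrite -/t; set x := sqn dot c; nra.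
Qed.

Theorem curlcurl_minimum : is_minimum curlcurl_spectrum curl_bottom.
Proof.
split; first exact: bottom_spectrum.
by move=> z Sz; apply: contrapT => /pencil_resolvent; apply.
Qed.

End AdjointPair.

(** * Scalar estimates for the energy balance *)

Section RealEstimates.
Context {R : realType}.
Implicit Types x y tau rho Lam d e s n : R.

(** In the three estimates below, e, s and n stand for the forms of eps,
    sigma and mu at a solution, omega = x + i y, and d bounds the
    contributions of the right-hand side.  On the axis only the imaginary part
    of the energy balance carries information. *)
Lemma estimate_axis y tau : 0 <= tau -> y < - tau \/ 0 < y ->
  exists2 C, 0 <= C & forall e s n d, 0 <= e -> 0 <= n -> 0 <= s <= tau * e ->
    `|y * (n + e) + s| <= d -> e + n <= C * d.
Proof.
move=> t0 [yt|y0].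
  have g0 : 0 < - y - tau by lra.
  exists (- y - tau)^-1; first by rewrite invr_ge0 ltW.
  move=> e s n d e0 n0 /andP[s0 se]; rewrite ler_norml => /andP[h _].
  rewrite mulrC ler_pdivlMr //; nra.
exists y^-1; first by rewrite invr_ge0 ltW.
move=> e s n d e0 n0 /andP[s0 se]; rewrite ler_norml => /andP[_ h].
rewrite mulrC ler_pdivlMr //; nra.
Qed.

(** Off the axis n is close to e, so that s is close to - 2 y e, which is
    incompatible with the bounds on s outside the strip. *)
Lemma estimate_strip x y tau rho : x != 0 -> 2 * y + tau < 0 \/ 0 < 2 * y + rho ->
  exists2 C, 0 <= C & forall e s n d, 0 <= e -> rho * e <= s <= tau * e ->
    `|x * (n - e)| <= d -> `|y * (n + e) + s| <= d -> e + n <= C * d.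
Proof.
move=> x0 hy; pose k := `|x|^-1; pose g := if 2 * y + tau < 0 then
  - (2 * y + tau) else 2 * y + rho.
have xp : 0 < `|x| by rewrite normr_gt0.
have k0 : 0 < k by rewrite invr_gt0.
have g0 : 0 < g by rewrite /g; case: ifP => // h; [lra|case: hy; rewrite ?h].
exists (2 * (1 + `|y| * k) / g + k).
  by rewrite addr_ge0 ?divr_ge0 ?mulr_ge0 ?addr_ge0 ?mulr_ge0 // ltW.
move=> e s n d e0 /andP[se1 se2] h1 h2.
have hne : `|n - e| <= k * d.
  by rewrite mulrC ler_pdivlMr // mulrC -normrM.
have h : `|2 * y * e + s| <= (1 + `|y| * k) * d.
  rewrite (_ : _ + s = y * (n + e) + s - y * (n - e)); last by ring.
  apply: le_trans (ler_normB _ _) _; rewrite mulrDl mul1r; apply: lerD => //.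
  by rewrite normrM -mulrA ler_wpM2l.
have ge : g * e <= (1 + `|y| * k) * d.
  move: h; rewrite ler_norml => /andP[a b]; rewrite /g; case: ifP => h.
    rewrite lerNl in a; apply: le_trans a; nra.
  apply: le_trans b; nra.
have e1 : e <= (1 + `|y| * k) / g * d.
  by rewrite mulrAC ler_pdivlMr // mulrC.
have := le_trans (ler_norm _) hne.
have -> : (2 * (1 + `|y| * k) / g + k) * d = 2 * ((1 + `|y| * k) / g * d) + k * d.
  by ring.
lra.
Qed.

(** Here e0 is the form of eps at the divergence-free part and Lam * e0 is
    bounded by |omega|^2 n up to an error, which is the spectral gap of
    curl curl0.  The quadratic inequality in t is optimal at
    t = Lam / |omega|^2. *)
Lemma estimate_gap x y tau Lam : x != 0 -> 0 <= 2 * y + tau -> 0 < Lam ->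
  x ^+ 2 - 3 * y ^+ 2 - 2 * tau * y < Lam ->
  exists2 C, 0 <= C & forall e s n d e0 r0 r1,
    `|x * (n - e)| <= d -> `|y * (n + e) + s| <= d ->
    Lam * e0 <= (x ^+ 2 + y ^+ 2) * n + r1 ->
    (forall t, 2 * t * ((x ^+ 2 + y ^+ 2) * n - r0) <=
       t ^+ 2 * (x ^+ 2 + y ^+ 2) * e0 + (x ^+ 2 + y ^+ 2) * e +
       (2 * y + tau) * s) ->
    `|r0| <= d -> r1 <= d -> e + n <= C * d.
Proof.
move=> x0 hy L0 hL; pose k := `|x|^-1; pose W := x ^+ 2 + y ^+ 2.
have xp : 0 < `|x| by rewrite normr_gt0.
have k0 : 0 < k by rewrite invr_gt0.
have W0 : 0 < W by apply: ltr_pwDl; rewrite ?sqr_ge0 ?exprn_even_gt0.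
pose g := Lam - (x ^+ 2 - 3 * y ^+ 2 - 2 * tau * y).
have g0 : 0 < g by rewrite subr_gt0.
pose D := Lam * k + (2 * y + tau) * (1 + `|y| * k) + 3 * (Lam / W).
have D0 : 0 <= D.
  have [k' L' W'] := And3 (ltW k0) (ltW L0) (ltW W0).
  rewrite /D; apply: addr_ge0; last by rewrite mulr_ge0 // divr_ge0.
  by apply: addr_ge0; apply: mulr_ge0 => //; rewrite addr_ge0 ?mulr_ge0.
exists (2 * (D / g) + k).
  by rewrite addr_ge0 ?(ltW k0) // mulr_ge0 // divr_ge0 // ltW.
move=> e s n d e0 r0 r1 h1 h2 h3 h4 h5 h6.
have hne : `|n - e| <= k * d.
  by rewrite mulrC ler_pdivlMr // mulrC -normrM.
have h : `|2 * y * e + s| <= (1 + `|y| * k) * d.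
  rewrite (_ : _ + s = y * (n + e) + s - y * (n - e)); last by ring.
  apply: le_trans (ler_normB _ _) _; rewrite mulrDl mul1r; apply: lerD => //.
  by rewrite normrM -mulrA ler_wpM2l.
have hq : Lam * n <= W * e + (2 * y + tau) * s + Lam / W * (r1 + 2 * r0).
  have := h4 (Lam / W); rewrite -/W => h4'.
  have a1 : (Lam / W) ^+ 2 * W * e0 = Lam / W * (Lam * e0).
    by field; exact: lt0r_neq0.
  have a2 : 2 * (Lam / W) * (W * n - r0) = 2 * Lam * n - Lam / W * (2 * r0).
    by field; exact: lt0r_neq0.
  have a3 : Lam / W * (Lam * e0) <= Lam / W * (W * n + r1).
    by rewrite ler_wpM2l // divr_ge0 ?ltW.
  have a4 : Lam / W * (W * n + r1) = Lam * n + Lam / W * r1.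
    by field; exact: lt0r_neq0.
  move: h4'; rewrite a1 a2 => h4'; rewrite [Lam / W * (r1 + _)]mulrDr.
  move: h4' a3; rewrite a4 -/W; set u1 := Lam / W * (Lam * e0); set u2 := Lam / W * (2 * r0).
  set u3 := Lam / W * r1; lra.
have e1 : g * e <= D * d.
  have b1 : - (k * d) <= n - e by move: hne; rewrite ler_norml => /andP[].
  have b2 : 2 * y * e + s <= (1 + `|y| * k) * d by exact: le_trans (ler_norm _) h.
  have b3 : Lam / W * (r1 + 2 * r0) <= Lam / W * (3 * d).
    rewrite ler_wpM2l ?divr_ge0 ?(ltW L0) ?(ltW W0) //.
    by have := le_trans (ler_norm _) h5; lra.
  have b4 : (2 * y + tau) * (2 * y * e + s) <=
      (2 * y + tau) * ((1 + `|y| * k) * d) by rewrite ler_wpM2l.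
  have b5 : Lam * - (k * d) <= Lam * (n - e) by rewrite ler_wpM2l // ltW.
  have -> : g * e = Lam * n - Lam * (n - e) - W * e + 2 * y * (2 * y + tau) * e.
    by rewrite /g /W; ring.
  have -> : D * d = Lam * (k * d) + (2 * y + tau) * ((1 + `|y| * k) * d)
      + Lam / W * (3 * d) by rewrite /D; ring.
  move: hq b3 b4 b5; set LW := Lam / W; lra.
have e2 : e <= D / g * d by rewrite mulrAC ler_pdivlMr // mulrC.
have := le_trans (ler_norm _) hne; rewrite mulrDl -mulrA; lra.
Qed.

(** Young's inequality in the form in which Cauchy-Schwarz bounds are
    absorbed. *)
Lemma young (r a b h : R) : 0 < h -> 0 <= a -> 0 <= b ->
  r ^+ 2 <= a * b -> `|r| <= (h * b + a / h) / 2.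
Proof.
move=> h0 a0 b0 hr; have ah : 0 <= a / h by rewrite divr_ge0 // ltW.
have q0 : 0 <= (h * b + a / h) / 2.
  by rewrite divr_ge0 // addr_ge0 // mulr_ge0 // ltW.
rewrite -ler_sqr ?nnegrE //.
rewrite real_normK ?num_real //; apply: le_trans hr _.
have -> : a * b = (a / h) * (h * b) by field; exact: lt0r_neq0.
have := sqr_ge0 (a / h - h * b); set p := a / h; set q := h * b; nra.
Qed.

(** The parameter h of Young's inequality is chosen so small that the multiple
    of the unknown N moves to the left-hand side. *)
Lemma absorb (kap C : R) : 0 < kap -> 0 <= C ->
  exists2 C', 0 < C' & forall N F : R, 0 <= N -> 0 <= F ->
    (forall h, 0 < h <= 1 -> kap * N <= C * (h * N + F / h)) -> N <= C' * F.
Proof.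
move=> k0 C0; pose h := Num.min 1 (kap / (2 * (C + 1))).
have C1 : 0 < 2 * (C + 1) by lra.
have h0 : 0 < h by rewrite /h lt_min ltr01 divr_gt0.
have h1 : h <= 1 by rewrite /h ge_min lexx.
have hk : C * h <= kap / 2.
  have : h <= kap / (2 * (C + 1)) by rewrite /h ge_min lexx orbT.
  rewrite ler_pdivlMr // => ?; lra.
exists (2 * (C + 1) / (h * kap)); first by rewrite divr_gt0 // mulr_gt0.
move=> N F N0 F0 /(_ h); rewrite h0 h1 => /(_ isT) H.
have Fh : 0 <= F / h by rewrite divr_ge0 // ltW.
have -> : 2 * (C + 1) / (h * kap) * F = (2 * (C + 1) * (F / h)) / kap.
  by field; rewrite !lt0r_neq0.
rewrite ler_pdivlMr //; move: H Fh; set q := F / h; nra.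
Qed.
End RealEstimates.

(** * The abstract Maxwell pencil *)

Section MaxwellSystem.
Context {R : realType} {V : lmodType R[i]} (dot : V -> V -> R[i]).
Variables (T0 T1 : V -> V -> Prop) (G : set V) (cj : V -> V).

Definition qform (A : V -> V) u : R := complex.Re (dot (A u) u).

(** A bounded real symmetric matrix function, acting by multiplication: being
    real is expressed by commuting with the conjugation cj. *)
Record coefficient (A : V -> V) (lo hi : R) : Prop := Coefficient {
  coefD : forall u v, A (u + v) = A u + A v;
  coefZ : forall a u, A (a *: u) = a *: A u;
  coefC : forall u v, dot (A u) v = dot u (A v);
  coefJ : forall u, A (cj u) = cj (A u);
  coef_lo : forall u, lo * sqn dot u <= qform A u;
  coef_hi : forall u, qform A u <= hi * sqn dot u }.

Record conjugation : Prop := Conjugation {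
  cjD : forall u v, cj (u + v) = cj u + cj v;
  cjZ : forall a u, cj (a *: u) = conjc a *: cj u;
  cjK : forall u, cj (cj u) = u;
  cj_dot : forall u v, dot (cj u) (cj v) = conjc (dot u v);
  cj_T1 : forall v d, T1 v d -> T1 (cj v) (cj d) }.

Definition mpencil (E M S : V -> V) (w : R[i]) (U F : V * V) :=
  exists c d, [/\ T0 U.1 c, T1 U.2 d,
    null_eq dot F.1 (- 'i%R *: S U.1 + 'i%R *: d - w *: E U.1) &
    null_eq dot F.2 (- 'i%R *: c - w *: M U.2)].

Hypothesis hd : semi_inner dot.
Hypothesis hc : complete_form dot.
Hypothesis hT : curl_pair dot T0 T1 G.
Hypothesis hJ : conjugation.

Lemma coef_im A lo hi u : coefficient A lo hi -> complex.Im (dot (A u) u) = 0.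
Proof.
move=> hA; have := congr1 (@complex.Im R) (coefC hA u u).
rewrite (im_dotC hd (A u) u); lra.
Qed.

(** Cauchy-Schwarz for the form of A, at the vectors u and A u. *)
Lemma coef_sqn A lo hi u : 0 <= lo -> coefficient A lo hi ->
  sqn dot (A u) <= hi * qform A u.
Proof.
move=> lo0 hA.
have q0 v : 0 <= qform A v.
  by apply: le_trans (coef_lo hA v); rewrite mulr_ge0 ?(sqn_ge0 hd).
have h : sqn dot (A u) ^+ 2 <= qform A u * qform A (A u).
  apply: discr_le => [|t]; first exact: q0.
  have := q0 (u + (- t)%:C *: A u).
  rewrite /qform (coefD hA) (coefZ hA) !(dotE hd) (coefC hA (A u) u).
  rewrite !reimE /= oppr0 !mul0r !subr0 /sqn.
  by congr (0 <= _); ring.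
have [->|a0] := eqVneq (sqn dot (A u)) 0.
  have [s0|s0] := eqVneq (sqn dot u) 0.
    by rewrite /qform (dotC hd) (dot_null hd) //= mulr0.
  rewrite mulr_ge0 //; have := le_trans (coef_lo hA u) (coef_hi hA u).
  have up : 0 < sqn dot u by rewrite lt0r s0 (sqn_ge0 hd).
  by rewrite ler_pM2r //; exact: le_trans.
have ap : 0 < sqn dot (A u) by rewrite lt0r a0 (sqn_ge0 hd).
rewrite -(ler_pM2r ap) -expr2; apply: le_trans h _.
by rewrite mulrAC mulrC ler_wpM2r // (coef_hi hA).
Qed.

Variables (E M S : V -> V) (emin emax mmin mmax smin smax : R).
Hypotheses (hE : coefficient E emin emax) (hM : coefficient M mmin mmax)
  (hS : coefficient S smin smax).
Hypotheses (emin0 : 0 < emin) (mmin0 : 0 < mmin) (smin0 : 0 <= smin).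

Local Notation pencil := (mpencil E M S).

(** The formal adjoint of the pencil. *)
Definition pencil_adj w (U F : V * V) :=
  exists c d, [/\ T0 U.1 c, T1 U.2 d,
    null_eq dot F.1 ('i%R *: S U.1 + 'i%R *: d - conjc w *: E U.1) &
    null_eq dot F.2 (- 'i%R *: c - conjc w *: M U.2)].

(** The change of sign in the second component compensates for the sign that
    conjugation gives to the factor i in front of the curls. *)
Definition flip (U : V * V) := (cj U.1, - cj U.2).

Lemma cjN u : cj (- u) = - cj u.
Proof.
rewrite -scaleN1r (cjZ hJ) (_ : conjc (-1 : R[i]) = -1) ?scaleN1r //.
by apply: complex_eq; rewrite !reimE //= !oppr0.
Qed.
Lemma cjB u v : cj (u - v) = cj u - cj v.
Proof. by rewrite (cjD hJ) cjN. Qed.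
Lemma cj_sqn u : sqn dot (cj u) = sqn dot u.
Proof. by rewrite /sqn (cj_dot hJ) reJ. Qed.
Lemma cj_null u v : null_eq dot u v -> null_eq dot (cj u) (cj v).
Proof. by rewrite /null_eq -cjB cj_sqn. Qed.
Lemma cj_T0 u c : T0 u c -> T0 (cj u) (cj c).
Proof.
move=> h; apply/(adj0 hT) => v d vd.
rewrite -[v](cjK hJ) -[d](cjK hJ) !(cj_dot hJ); congr conjc.
by apply: (iffLR (adj0 hT _ _) h); apply: cj_T1.
Qed.
Lemma flipK U : flip (flip U) = U.
Proof. by case: U => u v; rewrite /flip /= cjN !(cjK hJ) opprK. Qed.
Lemma null_N u v : null_eq dot u v -> null_eq dot (- u) (- v).
Proof. by rewrite /null_eq -opprD sqnN. Qed.

Lemma conjci : conjc ('i%R : R[i]) = - 'i%R.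
Proof. by apply: complex_eq; rewrite //= oppr0. Qed.
Lemma conjcNi : conjc (- 'i%R : R[i]) = 'i%R.
Proof. by apply: complex_eq; rewrite !reimE //= ?oppr0 ?opprK. Qed.

(** Complex conjugation turns the adjoint pencil into the pencil itself,
    because the coefficients are real and symmetric. *)
Lemma pencil_adj_flip w U F : pencil_adj w U F -> pencil w (flip U) (flip F).
Proof.
move=> [c [d [h0 h1 n1 n2]]]; exists (cj c), (- cj d).
split; first exact: cj_T0.
- by have := T1Z hd hT (-1) (cj_T1 hJ h1); rewrite !scaleN1r.
- have := cj_null n1; rewrite cjB (cjD hJ) !(cjZ hJ) -!(coefJ hE) -!(coefJ hS).
  by rewrite conjcI conjci /= scalerN !scaleNr.
- have := null_N (cj_null n2); rewrite cjB !(cjZ hJ) -!(coefJ hM) conjcNi.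
  rewrite conjcI /= -[- cj U.2]scaleN1r (coefZ hM) scaleN1r scalerN opprK.
  by rewrite opprB addrC scaleNr.
Qed.

(** Hence the pencil is closed.  Test pairs with one vanishing component recover
    the membership in the domains of T0 and T1 separately, the values of the two
    curls being read off from the equation. *)
Lemma pencilP_adj w U F : pencil w U F <->
  (forall Y Z, pencil_adj w Y Z -> dotp dot dot F Y = dotp dot dot U Z).
Proof.
case: U F => u v [f g]; split.
  move=> [c [d [h0 h1 n1 n2]]] [a b] [y z] [c' [d' [k0 k1 m1 m2]]] /=.
  rewrite /dotp /= (dot_null_eq hd _ n1) (dot_null_eq hd _ n2).
  rewrite (dotC hd y) (dotC hd z) (dot_null_eq hd _ m1) (dot_null_eq hd _ m2).
  rewrite -!(dotC hd) !(dotE hd) conjci conjcNi conjcI.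
  rewrite (coefC hS) (coefC hE) (coefC hM).
  rewrite -(adj_curl hT k0 h1) (iffLR (adj0 hT _ _) h0 _ _ k1).
  by rewrite /=; ring.
move=> h; pose d := - 'i%R *: (f + 'i%R *: S u + w *: E u).
pose c := 'i%R *: (g + w *: M v).
have ii : 'i%R * 'i%R = -1 :> R[i] by rewrite -expr2 sqrCi.
exists c, d; split=> /=.
- apply/(adj0 hT) => b d' bd'.
  have := h (0, b) ('i%R *: d', - conjc w *: M b); rewrite /dotp /= => hh.
  have /hh {hh} : pencil_adj w (0, b) ('i%R *: d', - conjc w *: M b).
    exists 0, d'; split=> //=; first by have [] := subspace0 hd hT.
      rewrite -[0 : V](scale0r 0) (coefZ hS) (coefZ hE) !scale0r !scaler0.
      by rewrite add0r subr0; exact: null_refl.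
    by rewrite scaler0 add0r scaleNr; exact: null_refl.
  rewrite (dot0r hd) add0r !(dotE hd) conjci conjcN conjcI (coefC hM) => ->.
  rewrite mulrDr; ring: ii.
- apply/(adj1 hT) => a c' ac'.
  have := h (a, 0) ('i%R *: S a - conjc w *: E a, - 'i%R *: c').
  rewrite /dotp /= => hh.
  have /hh {hh} : pencil_adj w (a, 0) ('i%R *: S a - conjc w *: E a, - 'i%R *: c').
    exists c', 0; split=> //=; first by have [] := subspace1 hd hT.
      by rewrite scaler0 addr0; exact: null_refl.
    rewrite -[0 : V](scale0r 0) (coefZ hM) !scale0r !scaler0 subr0.
    exact: null_refl.
  rewrite (dot0r hd) addr0 !(dotE hd) conjci conjcNi conjcI.
  rewrite (coefC hS) (coefC hE) => ->; ring: ii.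
- rewrite /d scalerA mulrN ii opprK scale1r.
  rewrite (_ : _ - _ = f); first exact: null_refl.
  by rewrite addrA addrK addrC scaleNr addrK.
- rewrite /c scalerA mulNr ii opprK scale1r addrK; exact: null_refl.
Qed.

Let hp : semi_inner (dotp dot dot) := semi_inner_prod hd hd.

Lemma closed_maxwell w :
  closed_set (dotp (dotp dot dot) (dotp dot dot)) (graph (pencil w)).
Proof. exact: closed_adjoint hp _ _ (@pencilP_adj w). Qed.

Lemma subspace_maxwell w : subspace (graph (pencil w)).
Proof. exact: subspace_adjoint hp _ _ (@pencilP_adj w). Qed.

Lemma dotp_flip U F : dotp dot dot (flip U) (flip F) = conjc (dotp dot dot U F).
Proof.
by rewrite /dotp /= (dotNl hd) (dotNr hd) opprK !(cj_dot hJ) conjcD.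
Qed.

(** A vector orthogonal to the range is, after conjugation, in the kernel;
    hence a lower bound alone gives bounded invertibility. *)
Lemma maxwell_resolvent w C :
  (forall U F, pencil w U F ->
     sqn (dotp dot dot) U <= C * sqn (dotp dot dot) F) ->
  boundedly_invertible setT (null_eq (dotp dot dot)) (hnorm (dotp dot dot))
    (pencil w).
Proof.
move=> hC; have [C0 hC0] : exists C0 : R, 0 <= C0 /\ (forall U F, pencil w U F ->
     sqn (dotp dot dot) U <= C0 * sqn (dotp dot dot) F).
  exists `|C|; split=> // U F /hC /le_trans; apply.
  by rewrite ler_wpM2r ?(sqn_ge0 hp) // ler_norm.
have {hC} hC := hC0.2; have {}hC0 := hC0.1.
exists (Num.sqrt C0) => F _.
have [|[U P] /= UP hr] := range_projection hp (complete_prod hd hd hc hc)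
  (T := graph (pencil w)) (C := C0) F (@subspace_maxwell w) (@closed_maxwell w).
  by move=> [U P]; exact: hC.
have r0 : null_eq (dotp dot dot) F P.
  have : pencil w (flip (F - P)) 0.
    apply/pencilP_adj => Y Z YZ; rewrite (dot0l hp) -[Z]flipK dotp_flip.
    rewrite (hr (flip Y, flip Z)); first by apply: complex_eq; rewrite //= oppr0.
    exact: pencil_adj_flip.
  move=> /hC; rewrite (sqn0 hp) mulr0 => h.
  apply/eqP; rewrite eq_le (sqn_ge0 hp) andbT.
  by move: h; rewrite /sqn dotp_flip reJ.
have UF : pencil w U F.
  apply: (closed_maxwell (u := (U, F))).
  move=> e e0; exists (U, P) => //.
  by rewrite sqn_prod /= subrr (sqn0 hp) add0r r0.
exists U; split=> //.
  by rewrite /hnorm -sqrtrM // ler_sqrt ?mulr_ge0 ?(sqn_ge0 hp) //; exact: hC.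
move=> U' UF'.
have := subspaceB (@subspace_maxwell w) (u := (U', F)) (v := (U, F)) UF' UF.
move=> /hC; rewrite /= subrr (sqn0 hp) mulr0 => h.
by apply/eqP; rewrite eq_le h (sqn_ge0 hp).
Qed.

Lemma qform_ge0 A lo hi u : 0 <= lo -> coefficient A lo hi -> 0 <= qform A u.
Proof.
by move=> l0 hA; apply: le_trans (coef_lo hA u); rewrite mulr_ge0 ?(sqn_ge0 hd).
Qed.

(** The square of w eps u + i sigma u in the norm of the inverse of eps is
    expanded, and sigma eps^-1 sigma <= (smax/emin) sigma bounds its last term.
    The dual norm is unfolded into a Young inequality so that no inverse
    appears. *)
Lemma energy_young (w : R[i]) u v :
  2 * complex.Re (dot (w *: E u + 'i%R *: S u) v) <=
  qform E v + csq w * qform E u + (2 * complex.Im w + smax / emin) * qform S u.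
Proof.
pose z := v - w *: u.
have h1 := coef_lo hE z.
have h2 := coef_sqn u smin0 hS.
have h3 : 0 <= emin * sqn dot z - 2 * complex.Re (dot ('i%R *: S u) z) +
    sqn dot (S u) / emin.
  have := sqn_ge0 hd (emin%:C *: z - 'i%R *: S u).
  rewrite (sqnB hd) !(sqnZ hd) (dotZl hd emin%:C) reM /= mul0r subr0 (re_dotC hd).
  rewrite /csq /= !expr0n /= addr0 add0r expr1n mul1r => h.
  have : 0 <= (emin ^+ 2 * sqn dot z - 2 *
     (emin * complex.Re (dot ('i%R *: S u) z)) + sqn dot (S u)) / emin.
    by rewrite divr_ge0 // ltW.
  by congr (0 <= _); field; exact: lt0r_neq0.
have h4 : sqn dot (S u) / emin <= smax / emin * qform S u.
  by rewrite mulrAC ler_wpM2r // invr_ge0 ltW.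
have iS := coef_im u hS; have iE := coef_im u hE.
have e1 : dot (E v) u = conjc (dot (E u) v) by rewrite (coefC hE) (dotC hd).
have e2 : qform E z = qform E v - 2 * complex.Re (dot (w *: E u) v) +
    csq w * qform E u.
  rewrite /qform /z (coefD hE) -scaleN1r scalerA (coefZ hE) !(dotE hd) e1.
  rewrite !reimE iE /csq /=; ring.
have e3 : complex.Re (dot ('i%R *: S u) z) =
    complex.Re (dot ('i%R *: S u) v) - complex.Im w * qform S u.
  rewrite /z !(dotE hd) !reimE iS /qform /=; ring.
rewrite (dotDl hd) reD.
move: h1 h3 h4; rewrite e2 e3.
have -> : (2 * complex.Im w + smax / emin) * qform S u =
  2 * (complex.Im w * qform S u) + smax / emin * qform S u by ring.
set t := smax / emin * _; set r := sqn dot (S u) / emin.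
move: (complex.Im w * _) (csq w * _) => p1 p2; lra.
Qed.

(** The form of the pencil at the solution itself: the two curl terms cancel by
    adjointness. *)
Lemma balance w u v f g : pencil w (u, v) (f, g) ->
  complex.Re (dot f u - dot v g) = complex.Re w * (qform M v - qform E u) /\
  complex.Im (dot f u - dot v g) =
    - (complex.Im w * (qform M v + qform E u) + qform S u).
Proof.
move=> [c [d [/= uc vd n1 n2]]].
have iS := coef_im u hS; have iE := coef_im u hE; have iM := coef_im v hM.
rewrite (dot_null_eq hd _ n1) (dotC hd g v) (dot_null_eq hd _ n2).
rewrite !(dotE hd) (adj_curl hT uc vd) (dotC hd v c) !reimE iS iE iM /qform /=.
split; ring.
Qed.

(** The form of the pencil with u replaced by u0 in the first test vector.  The
    factor w makes the term of mu real. *)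
Lemma balance0 w u v f g u0 : pencil w (u, v) (f, g) -> T0 (u - u0) 0 ->
  complex.Re (w * dot (w *: E u + 'i%R *: S u) u0) =
  csq w * qform M v - complex.Re (w * (dot f u0 - dot v g)).
Proof.
move=> [c [d [/= uc vd n1 n2]]] hu0.
have iM := coef_im v hM.
have u0c : T0 u0 c by have := T0B hd hT uc hu0; rewrite opprB addrC subrK subr0.
rewrite (dot_null_eq hd _ n1) (dotC hd g v) (dot_null_eq hd _ n2).
rewrite !(dotE hd) (adj_curl hT u0c vd) (dotC hd v c) !reimE iM /csq /qform /=.
ring.
Qed.

(** The spectral gap applied to u0, whose curl is given by the second row of
    the system. *)
Lemma curl_bound w u v f g u0 : pencil w (u, v) (f, g) -> T0 (u - u0) 0 ->
  divfree dot G u0 ->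
  curl_bottom dot T0 G * sqn dot u0 <=
    csq w * (mmax * qform M v) + (sqn dot g + 2 * complex.Re (dot g (w *: M v))).
Proof.
move=> [c [d [/= uc vd n1 n2]]] hu0 Ku0.
have u0c : T0 u0 c by have := T0B hd hT uc hu0; rewrite opprB addrC subrK subr0.
apply: le_trans (bottom_le hd Ku0 u0c) _.
have -> : sqn dot c = sqn dot (g + w *: M v).
  have -> : sqn dot c = sqn dot (- 'i%R *: c).
    by rewrite (sqnZ hd) /csq !reimE /= oppr0 expr0n /= sqrrN expr1n add0r mul1r.
  have n3 : null_eq dot (g + w *: M v) (- 'i%R *: c).
    by move: n2; rewrite /null_eq opprB addrA addrAC.
  rewrite /sqn (dot_null_eq hd _ n3) [in RHS](dotC hd) (dot_null_eq hd _ n3).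
  by rewrite -(dotC hd).
rewrite (sqnD hd) (sqnZ hd) addrC lerD2r ler_wpM2l ?csq_ge0 //.
exact: coef_sqn (ltW mmin0) hM.
Qed.

Lemma re_young a b h : 0 < h ->
  `|complex.Re (dot a b)| <= (h * sqn dot b + sqn dot a / h) / 2.
Proof.
by move=> h0; apply: young; rewrite ?(sqn_ge0 hd) // (re_cauchy_schwarz hd).
Qed.
Lemma im_young a b h : 0 < h ->
  `|complex.Im (dot a b)| <= (h * sqn dot b + sqn dot a / h) / 2.
Proof.
by move=> h0; apply: young; rewrite ?(sqn_ge0 hd) // (im_cauchy_schwarz hd).
Qed.

(** The size of the terms with the data (f, g), for a small parameter h. *)
Definition err h u v f g : R :=
  h * (sqn dot u + sqn dot v) + (sqn dot f + sqn dot g) / h.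

Lemma data_error h u v f g u0 : 0 < h -> sqn dot u0 <= sqn dot u ->
  `|complex.Re (dot f u0 - dot v g)| <= err h u v f g /\
  `|complex.Im (dot f u0 - dot v g)| <= err h u v f g.
Proof.
move=> h0 hu0; rewrite /err.
have a1 : h * sqn dot u0 <= h * sqn dot u by rewrite ler_wpM2l // ltW.
have b1 : 0 <= h * sqn dot u0 by rewrite mulr_ge0 ?(sqn_ge0 hd) // ltW.
have b2 : 0 <= h * sqn dot v by rewrite mulr_ge0 ?(sqn_ge0 hd) // ltW.
have b3 : 0 <= sqn dot f / h by rewrite divr_ge0 ?(sqn_ge0 hd) // ltW.
have b4 : 0 <= sqn dot g / h by rewrite divr_ge0 ?(sqn_ge0 hd) // ltW.
rewrite mulrDr mulrDl !reimE (dotC hd g v) !reimE; split.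
  apply: le_trans (ler_normB _ _) _.
  by have := re_young f u0 h0; have := re_young g v h0; lra.
apply: le_trans (ler_normB _ _) _; rewrite normrN.
by have := im_young f u0 h0; have := im_young g v h0; lra.
Qed.

Hypothesis hK : exists u c d, [/\ T0 u c, T1 c d & sqn dot c != 0].

(** Compare both bounds at c, a vector of positive length. *)
Lemma coef_le A lo hi : coefficient A lo hi -> lo <= hi.
Proof.
move=> hA; have [_ [c [_ [_ _ c0]]]] := hK.
have cp : 0 < sqn dot c by rewrite lt0r c0 (sqn_ge0 hd).
by rewrite -(ler_pM2r cp); apply: le_trans (coef_lo hA c) (coef_hi hA c).
Qed.

Local Notation lam := (curl_bottom dot T0 G).
Local Notation tau := (smax / emin).

Definition enclosure : set R[i] :=
  imaginary_segment (- tau) 0 `|`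
  [set w : R[i] |
    [/\ ~ imaginary_axis w,
        - (1 / 2 * tau) <= complex.Im w <= - (1 / 2 * (smin / emax)) &
        lam / (emax * mmax) <=
          complex.Re w ^+ 2 - 3 * complex.Im w ^+ 2 +
          2 * tau * `|complex.Im w|]].

(** The forms of eps and mu dominate the norm, so that the error terms can be
    absorbed. *)
Lemma lower_bound_of_estimate w (C : R) : 0 <= C ->
  (forall u v f g h, 0 < h <= 1 -> pencil w (u, v) (f, g) ->
    qform E u + qform M v <= C * err h u v f g) ->
  exists C', forall U F, pencil w U F ->
    sqn (dotp dot dot) U <= C' * sqn (dotp dot dot) F.
Proof.
move=> C0 hC; have k0 : 0 < Num.min emin mmin by rewrite lt_min emin0.
have [C' C'0 hC'] := absorb k0 C0; exists C' => -[u v] [f g] UF.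
rewrite !sqn_prod /=; apply: hC'; rewrite ?addr_ge0 ?(sqn_ge0 hd) // => h hh.
apply: le_trans (hC _ _ _ _ _ hh UF); rewrite mulrDr; apply: lerD.
  by apply: le_trans (coef_lo hE u); rewrite ler_wpM2r ?(sqn_ge0 hd) // ge_min lexx.
apply: le_trans (coef_lo hM v); rewrite ler_wpM2r ?(sqn_ge0 hd) //.
by rewrite ge_min lexx orbT.
Qed.

Lemma maxwell_lower_bound w : ~ enclosure w -> exists C, forall U F,
  pencil w U F -> sqn (dotp dot dot) U <= C * sqn (dotp dot dot) F.
Proof.
move=> hw; pose x := complex.Re w; pose y := complex.Im w.
have emax0 : 0 < emax by apply: lt_le_trans emin0 (coef_le hE).
have mmax0 : 0 < mmax by apply: lt_le_trans mmin0 (coef_le hM).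
have smax0 : 0 <= smax by apply: le_trans smin0 (coef_le hS).
have t0 : 0 <= tau by rewrite divr_ge0 // ltW.
have e0 u : 0 <= qform E u by apply: qform_ge0 hE; exact: ltW.
have n0 u : 0 <= qform M u by apply: qform_ge0 hM; exact: ltW.
have s0 u : 0 <= qform S u by apply: qform_ge0 hS.
have se u : smin / emax * qform E u <= qform S u <= tau * qform E u.
  apply/andP; split.
    rewrite mulrAC ler_pdivrMr // (le_trans (ler_wpM2l smin0 (coef_hi hE u))) //.
    by rewrite mulrCA mulrC ler_wpM2r ?(ltW emax0) ?(coef_lo hS).
  rewrite mulrAC ler_pdivlMr // mulrC.
  apply: le_trans (ler_wpM2l (ltW emin0) (coef_hi hS u)) _.
  by rewrite mulrCA ler_wpM2l // (coef_lo hE).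
have data u v f g h : 0 < h <= 1 -> pencil w (u, v) (f, g) ->
    `|x * (qform M v - qform E u)| <= err h u v f g /\
    `|y * (qform M v + qform E u) + qform S u| <= err h u v f g.
  move=> /andP[h0 _] UF; have [b1 b2] := balance UF.
  have [] := data_error v f g h0 (lexx (sqn dot u)).
  by rewrite b1 b2 normrN.
(* Below or above the segment on the imaginary axis. *)
have [x0|x0] := eqVneq x 0.
  have yt : y < - tau \/ 0 < y.
    have [?|h1] := ltP y (- tau); [by left|right]; rewrite ltNge; apply/negP => h2.
    by apply: hw; left; split=> //; apply/andP.
  have [C C0 hC] := estimate_axis t0 yt.
  apply: (lower_bound_of_estimate C0) => u v f g h hh UF.
  have [_ d2] := data _ _ _ _ _ hh UF.
  apply: hC d2 => //; rewrite s0 /=; by case/andP: (se u).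
have hx : ~ imaginary_axis w by apply/eqP.
(* Off the axis and outside the strip. *)
have [ys|ys] := pselect (2 * y + tau < 0 \/ 0 < 2 * y + smin / emax).
  have [C C0 hC] := estimate_strip x0 ys.
  apply: (lower_bound_of_estimate C0) => u v f g h hh UF.
  have [d1 d2] := data _ _ _ _ _ hh UF.
  exact: hC d1 d2.
(* In the strip, where the spectral gap is needed. *)
have y1 : 0 <= 2 * y + tau by rewrite leNgt; apply/negP => ?; apply: ys; left.
have y2 : 2 * y + smin / emax <= 0.
  by rewrite leNgt; apply/negP => ?; apply: ys; right.
have y0 : y <= 0.
  have : 0 <= smin / emax by rewrite divr_ge0 // ltW.
  lra.
pose Lam := lam / (emax * mmax).
have hL : x ^+ 2 - 3 * y ^+ 2 - 2 * tau * y < Lam.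
  rewrite ltNge; apply/negP => h; apply: hw; right; split=> //.
    rewrite -/y; apply/andP; split; lra.
  by rewrite -/x -/y ler0_norm // mulrN.
have L0 : 0 < Lam.
  apply: le_lt_trans hL; have := sqr_ge0 x; nra.
have [C C0 hC] := estimate_gap x0 y1 L0 hL.
(* K collects the constants in front of the error terms of the four
   hypotheses of the estimate. *)
pose K := 1 + (`|x| + `|y|) + (2 + csq w * mmax ^+ 2) / mmax.
have K1 : 0 <= (2 + csq w * mmax ^+ 2) / mmax.
  by rewrite divr_ge0 ?addr_ge0 ?mulr_ge0 ?csq_ge0 ?sqr_ge0 // ltW.
have K0 : 0 <= K by rewrite /K !addr_ge0.
apply: (lower_bound_of_estimate (C := C * K)); first exact: mulr_ge0.
move=> u v f g h hh UF; have [d1 d2] := data _ _ _ _ _ hh UF.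
have /andP[h0 h1] := hh.
have [u0 Ku0 [hu0 ou0]] := helmholtz hd hc hT u.
have uu0 : sqn dot u0 <= sqn dot u.
  rewrite -[X in _ <= sqn _ X](subrK u0) (sqnD hd) ou0 //= mulr0 addr0.
  by rewrite lerDr (sqn_ge0 hd).
have [p1 p2] := data_error v f g h0 uu0.
set q := dot f u0 - dot v g in p1 p2.
have er0 : 0 <= err h u v f g by apply: le_trans d1.
have erK : err h u v f g <= K * err h u v f g.
  by rewrite ler_peMl // /K -addrA lerDl addr_ge0 // addr_ge0.
rewrite -mulrA; set D := K * _ in erK *.
apply: (hC _ _ _ _ (qform E u0) (complex.Re (w * q))
  ((sqn dot g + 2 * complex.Re (dot g (w *: M v))) / mmax)
  (le_trans d1 erK) (le_trans d2 erK)).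
- have b := curl_bound UF hu0 Ku0.
  have b1 : Lam * qform E u0 <= lam * sqn dot u0 / mmax.
    rewrite /Lam; have -> : lam * sqn dot u0 / mmax =
      lam / (emax * mmax) * (emax * sqn dot u0).
      by field; rewrite !lt0r_neq0.
    by rewrite ler_wpM2l ?(ltW L0) // (coef_hi hE).
  apply: le_trans b1 _; rewrite ler_pdivrMr // mulrDl mulfVK ?lt0r_neq0 //.
  apply: le_trans b _; rewrite /csq -/x -/y lerD2r le_eqVlt.
  by apply/orP; left; apply/eqP; ring.
- (* Young's inequality at t conj(omega) u0 produces the term controlled by
     the balance against u0. *)
  move=> t; have := energy_young w u ((t%:C * conjc w) *: u0).
  rewrite (dotZr hd) conjcM conjcI -mulrA.
  rewrite (_ : conjc t%:C = t%:C); last by apply: complex_eq; rewrite //= oppr0.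
  rewrite (reM t%:C) (balance0 UF hu0) -/q [complex.Re t%:C]/= [complex.Im t%:C]/=.
  rewrite mul0r subr0.
  have -> : qform E ((t%:C * conjc w) *: u0) =
      t ^+ 2 * (x ^+ 2 + y ^+ 2) * qform E u0.
    have iE := coef_im u0 hE.
    by rewrite /qform (coefZ hE) !(dotE hd) !reimE iE /= -/x -/y; ring.
  by rewrite mulrA.
- rewrite reM -/x -/y; apply: le_trans (ler_normB _ _) _; rewrite !normrM.
  have l1 : `|x| * `|complex.Re q| <= `|x| * err h u v f g by rewrite ler_wpM2l.
  have l2 : `|y| * `|complex.Im q| <= `|y| * err h u v f g by rewrite ler_wpM2l.
  have l3 : 0 <= (2 + csq w * mmax ^+ 2) / mmax * err h u v f g.
    exact: mulr_ge0.
  have -> : D = err h u v f g + `|x| * err h u v f g + `|y| * err h u v f g +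
      (2 + csq w * mmax ^+ 2) / mmax * err h u v f g by rewrite /D /K; ring.
  lra.
- have b1 : 0 <= h * sqn dot u by rewrite mulr_ge0 ?(sqn_ge0 hd) // ltW.
  have b2 : 0 <= h * sqn dot v by rewrite mulr_ge0 ?(sqn_ge0 hd) // ltW.
  have b3 : 0 <= sqn dot f / h by rewrite divr_ge0 ?(sqn_ge0 hd) // ltW.
  have b4 : 0 <= sqn dot g / h by rewrite divr_ge0 ?(sqn_ge0 hd) // ltW.
  have errE : err h u v f g =
      h * sqn dot u + h * sqn dot v + (sqn dot f / h + sqn dot g / h).
    by rewrite /err mulrDr mulrDl.
  have hgi : sqn dot g <= sqn dot g / h.
    by rewrite ler_pdivlMr // ler_piMr ?(sqn_ge0 hd).
  have l1 := le_trans (ler_norm _) (re_young g (w *: M v) h0).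
  have l2 : sqn dot (M v) <= mmax ^+ 2 * sqn dot v.
    apply: le_trans (coef_sqn v (ltW mmin0) hM) _.
    by rewrite expr2 -mulrA ler_wpM2l ?(ltW mmax0) // (coef_hi hM).
  have l3 : h * sqn dot (w *: M v) <= csq w * mmax ^+ 2 * err h u v f g.
    rewrite (sqnZ hd) mulrCA -mulrA ler_wpM2l ?csq_ge0 //.
    apply: le_trans (ler_wpM2l (ltW h0) l2) _; rewrite mulrCA.
    by rewrite ler_wpM2l ?sqr_ge0 // errE; lra.
  have l4 : (sqn dot g + 2 * complex.Re (dot g (w *: M v))) / mmax <=
      (2 + csq w * mmax ^+ 2) / mmax * err h u v f g.
    rewrite mulrAC ler_wpM2r ?invr_ge0 ?(ltW mmax0) // [leRHS]mulrDl.
    have l5 : sqn dot g / h <= err h u v f g by rewrite errE; lra.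
    move: l1 l3 l5 hgi; set a1 := h * sqn dot (w *: _); set a2 := sqn dot g / h.
    set a3 := csq w * _ * _; lra.
  apply: le_trans l4 _; rewrite /D ler_wpM2r // /K lerDr.
  by rewrite !addr_ge0.
Qed.

Theorem maxwell_enclosure :
  spectrum setT (null_eq (dotp dot dot)) (hnorm (dotp dot dot)) pencil
    `<=` enclosure.
Proof.
move=> w; apply: contra_notP => /maxwell_lower_bound[C hC].
exact: maxwell_resolvent hC.
Qed.

End MaxwellSystem.

(** * Lebesgue measure on three-space *)

Section Space.
Context {R : realType}.
Implicit Types (c x : R3 R) (U : set (R3 R)).

Definition cube c (r : R) : set (R3 R) :=
  (ball (c.1.1 : R) r `*` ball (c.1.2 : R) r) `*` ball (c.2 : R) r.

Lemma measurable_ballR (a r : R) :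
  measurable (ball (a : R) r : set (measurableTypeR R)).
Proof. by rewrite ball_itv; exact: measurable_itv. Qed.

Lemma measurable_cube c r : measurable (cube c r).
Proof.
by apply: measurableX; [apply: measurableX|]; exact: measurable_ballR.
Qed.

Lemma cubeE c r : cube c r = ball (c : R * R * R) r.
Proof. by []. Qed.

Lemma leb_ball (a r : R) : 0 <= r -> leb (ball a r) = (r *+ 2)%:E.
Proof. exact: lebesgue_measure_ball. Qed.

Lemma leb3_cube c r : 0 <= r -> leb3 (cube c r) = ((r *+ 2) ^+ 3)%:E.
Proof.
move=> r0.
have E1 : leb3 (cube c r) =
    ((leb \x leb)%E (ball (c.1.1 : R) r `*` ball (c.1.2 : R) r) *
     leb (ball (c.2 : R) r))%E.
  apply: (@product_measure1E _ _ _ _ R _ (@lebesgue_measure R)).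
    by apply: measurableX; exact: measurable_ballR.
  exact: measurable_ballR.
have E2 : ((leb \x leb)%E (ball (c.1.1 : R) r `*` ball (c.1.2 : R) r) =
    leb (ball (c.1.1 : R) r) * leb (ball (c.1.2 : R) r))%E.
  by apply: (@product_measure1E _ _ _ _ R _ (@lebesgue_measure R));
    exact: measurable_ballR.
rewrite E1 E2 !leb_ball // -!EFinM; congr EFin.
by rewrite -[r *+ 2]mulr_natl; ring.
Qed.

(** An open set is the union of the countably many cubes with rational centre
    and radius that it contains. *)
Lemma open_measurable3 U : open U -> measurable U.
Proof.
move=> oU.
pose Q := (rat * rat * rat * rat)%type.
pose B (q : Q) := cube (ratr q.1.1.1, ratr q.1.1.2, ratr q.1.2) (ratr q.2).
pose F (q : Q) := if `[< B q `<=` U >] then B q else set0.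
rewrite (_ : U = \bigcup_q F q); last first.
  apply/seteqP; split=> [x Ux|x [q _]]; last by rewrite /F; case: asboolP => // h /h.
  have /nbhs_ballP[e /= e0 he] : nbhs x U by exact: open_nbhs_nbhs.
  have e2 : 0 < e / 2 by rewrite divr_gt0.
  have rq (a b : R) : a < b -> exists q : rat, a < ratr q < b.
    by move=> /rat_in_itvoo[q]; rewrite in_itv /= => ?; exists q.
  have [r /andP[r1 r2]] := rq 0 (e / 2) e2.
  have hq (a : R) : exists q : rat, `|ratr q - a| < ratr r.
    have [q /andP[q1 q2]] := rq (a - ratr r) (a + ratr r) ltac:(lra).
    by exists q; rewrite ltr_norml; apply/andP; split; lra.
  have [q1 h1] := hq x.1.1; have [q2 h2] := hq x.1.2; have [q3 h3] := hq x.2.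
  exists (q1, q2, q3, r) => //; rewrite /F; case: asboolP => [_|[]].
    by split; [split|]; rewrite /= -ball_normE /=.
  move=> y; rewrite /B cubeE => By; apply: he.
  rewrite (splitr e); apply: (@ball_triangle R (R * R * R)%type (ratr q1, ratr q2, ratr q3)).
    apply: (@le_ball _ _ _ (ratr r)); first exact: ltW.
    by split; [split|]; rewrite /= -ball_normE /= distrC.
  by apply: (@le_ball _ _ _ (ratr r)) => //; exact: ltW.
apply: countable_bigcupT_measurable => [|q]; first exact: countableP.
rewrite /F.
by case: asboolP => // _; exact: measurable_cube.
Qed.

(** An open set contains a cube around each of its points. *)
Lemma leb3_open_gt0 U : open U -> U !=set0 -> (0 < leb3 U)%E.
Proof.
move=> oU [x Ux].
have /nbhs_ballP[e /= e0 he] : nbhs x U by exact: open_nbhs_nbhs.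
apply: (@lt_le_trans _ _ (leb3 (cube x e))).
  by rewrite leb3_cube ?(ltW e0) // lte_fin exprn_gt0 // pmulrn_lgt0.
apply: le_measure; rewrite ?inE //; first exact: measurable_cube.
exact: open_measurable3.
Qed.

Lemma continuous_measurable3 (f : R3 R -> R) (D : set (R3 R)) :
  continuous (f : R * R * R -> R) -> measurable D -> measurable_fun D f.
Proof.
move=> cf mD; apply: measurable_funS (measurableT) (subsetT _) _.
apply: (measurability _ (RGenOpens.measurableE R)).
move=> _ [_ [a [b ->] <-]]; rewrite setTI; apply: open_measurable3.
by apply: open_comp => //; exact: interval_open.
Qed.

End Space.

(** * Completeness of real square-integrable functions *)

Section SquareIntegral.
Context d (T : measurableType d) (R : realType).
Variables (mu : {measure set T -> \bar R}) (D : set T) (mD : measurable D).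
Implicit Types f g : T -> R.

Definition sqint f : \bar R := (\int[mu]_(x in D) ((f x) ^+ 2)%:E)%E.

Lemma measurable_sq (E : set T) f : measurable_fun E f ->
  measurable_fun E (fun x => ((f x) ^+ 2)%:E).
Proof. by move=> mf; apply/measurable_EFinP; exact: measurable_funX. Qed.

Lemma sq_ge0 f x : (0 <= ((f x) ^+ 2)%:E)%E.
Proof. by rewrite lee_fin sqr_ge0. Qed.

(** Riesz-Fischer.  Along a fast subsequence with increments a_k the function
    H = sum 2^k a_k^2 is integrable; where it is finite, the inequality
    |a_k| <= 2^-k + 2^k a_k^2 makes the subsequence converge, and Fatou's lemma
    identifies its limit as the limit in the mean. *)
Theorem sqint_complete (f : nat -> T -> R) :
  (forall n, measurable_fun D (f n)) ->
  (forall e : R, 0 < e -> exists N, forall m n, (N <= m)%N -> (N <= n)%N ->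
     (sqint (f m \- f n)%R <= e%:E)%E) ->
  exists2 g, measurable_fun D g & forall e : R, 0 < e ->
    exists N, forall n, (N <= n)%N -> (sqint (f n \- g)%R <= e%:E)%E.
Proof.
move=> mf cf.
have p0 k : 0 < (2 ^+ k : R) by rewrite exprn_gt0.
have q0 k : 0 < (2 ^+ k)^-1 / (2 ^ k.+1)%:R :> R.
  by rewrite divr_gt0 ?invr_gt0 // ltr0n expn_gt0.
(* The increments are so small that even 2^k a_k^2 has a summable integral. *)
pose N k := projT1 (cid (cf _ (q0 k))).
have hN k m n : (N k <= m)%N -> (N k <= n)%N ->
    (sqint (f m \- f n)%R <= ((2 ^+ k)^-1 / (2 ^ k.+1)%:R)%:E)%E.
  exact: (projT2 (cid (cf _ (q0 k)))).
pose n_ k := (k + \sum_(j < k.+1) N j)%N.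
have n_ge k : (N k <= n_ k)%N.
  by rewrite /n_ big_ord_recr /= addnA leq_addl.
have n_S k : (N k <= n_ k.+1)%N.
  apply: leq_trans (n_ge k) _; rewrite /n_ [X in (_ <= _ + X)%N]big_ord_recr /=.
  by rewrite leq_add // leq_addr.
pose a k x := f (n_ k.+1) x - f (n_ k) x.
have ma k : measurable_fun D (a k) by exact: measurable_funB.
pose h k x := (2 ^+ k * a k x ^+ 2)%:E : \bar R.
have h0 k x : (0 <= h k x)%E by rewrite lee_fin mulr_ge0 ?sqr_ge0 // ltW.
have mh k : measurable_fun D (h k).
  by apply/measurable_EFinP; apply: measurable_funM => //; exact: measurable_funX.
pose H x := (\sum_(k <oo) h k x)%E.
have iH : mu.-integrable D H.
  apply/integrableP; split; first exact: ge0_emeasurable_sum.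
  under eq_integral do rewrite gee0_abs ?nneseries_ge0 //.
  rewrite integral_nneseries //.
  apply: (@le_lt_trans _ _ 1%:E); last by rewrite ltry.
  apply: le_trans (epsilon_trick0 xpredT ler01); apply: lee_nneseries => //.
    by move=> k _ _; apply: integral_ge0.
  move=> k _; rewrite /h; under eq_integral do rewrite EFinM.
  rewrite ge0_integralZl_EFin ?(ltW (p0 k)) //; last 2 first.
  - by move=> x _; exact: sq_ge0.
  - exact: measurable_sq.
  rewrite mul1r; have := hN k _ _ (n_S k) (n_ge k).
  rewrite -(@lee_pmul2l _ (2 ^+ k)%:E) ?lte_fin // => /le_trans; apply.
  by rewrite -EFinM lee_fin mulrA mulfV ?mul1r // gt_eqF.
have [Z [mZ Z0 hZ]] := integrable_ae mD iH.
pose E := D `\` Z.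
have mE : measurable E by exact: measurableD.
have ED : E `<=` D by move=> x [].
have finH x : E x -> H x \is a fin_num.
  move=> [Dx Zx]; apply: contrapT => nf; apply: Zx; apply: hZ => /=.
  by move=> /(_ Dx).
have cvE x : E x -> cvgn (fun k => f (n_ k) x).
  move=> Ex.
  rewrite (_ : (fun k => f (n_ k) x) =
    (cst (f (n_ 0%N) x) \+ series (a ^~ x))); last first.
    by apply/funext => k /=; rewrite (eq_sum_telescope (fun k => f (n_ k) x)).
  apply: is_cvgD; first exact: is_cvg_cst.
  apply: normed_cvg; apply: nondecreasing_is_cvgn.
    by apply: nondecreasing_series => k _ _ /=.
  exists (2 + fine (H x)) => _ [k _ <-] /=.
  have b1 (j : nat) : `|a j x| <= 2 * (1 / (2 ^+ j.+1)) + 2 ^+ j * a j x ^+ 2.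
    set y := `|a j x|; have -> : a j x ^+ 2 = y ^+ 2.
      by rewrite /y real_normK ?num_real.
    set p := 2 ^+ j; have pp : 0 < p := p0 j.
    have -> : 2 * (1 / 2 ^+ j.+1) = p^-1.
      by rewrite exprS -/p; field; exact: lt0r_neq0.
    (* Complete the square. *)
    rewrite -subr_ge0 (_ : _ - _ = ((p * y - 1 / 2) ^+ 2 + 3 / 4) / p).
      by rewrite divr_ge0 ?addr_ge0 ?sqr_ge0 // ltW.
    by field; exact: lt0r_neq0.
  apply: (@le_trans _ _ (\sum_(0 <= j < k)
      (2 * (1 / 2 ^+ j.+1) + 2 ^+ j * a j x ^+ 2))).
    by apply: ler_sum => j _; exact: b1.
  rewrite big_split /=; apply: lerD.
    rewrite -big_distrr /= -[leRHS]mulr1 ler_wpM2l //.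
    rewrite -lee_fin -sumEFin.
    apply: le_trans (epsilon_trick0 xpredT ler01).
    under eq_bigr do rewrite -natrX.
    by apply: nneseries_lim_ge => j _ _; rewrite lee_fin divr_ge0.
  rewrite -lee_fin -sumEFin fineK; last exact: finH.
  by apply: nneseries_lim_ge => j _ _; exact: h0.
pose f' k := f (n_ k) \_ E.
pose g x := limn (fun k => f' k x).
have cf' x : D x -> f' ^~ x @ \oo --> g x.
  move=> Dx; rewrite /g; have [xE|xE] := boolP (x \in E).
    rewrite (_ : f' ^~ x = fun k => f (n_ k) x); last first.
      by apply/funext => k; rewrite /f' /patch xE.
    by move: xE; rewrite inE => /cvE.
  rewrite (_ : f' ^~ x = fun=> point); last first.
    by apply/funext => k; rewrite /f' /patch (negbTE xE).
  exact: is_cvg_cst.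
have mf' k : measurable_fun D (f' k).
  apply/measurable_restrict => //.
  by apply: measurable_funS (mf _) => // x [].
have mg : measurable_fun D g by apply: (measurable_fun_cvg mf' cf').
exists g => // e e0; have [M hM] := cf e e0; exists M => m Mm.
rewrite /sqint (ge0_negligible_integral mZ) //; last 2 first.
- by apply: measurable_sq; exact: measurable_funB.
- by move=> x _; exact: sq_ge0.
pose h' k x := ((f m x - f (n_ k) x) ^+ 2)%:E : \bar R.
have mh' k : measurable_fun E (h' k).
  by apply: measurable_sq; apply: measurable_funB;
    apply: measurable_funS (mf _).
have -> : (\int[mu]_(x in D `\` Z) ((f m \- g)%R x ^+ 2)%:E =
    \int[mu]_(x in E) limn_einf (h' ^~ x))%E.
  apply: eq_integral => x; rewrite inE => Ex.
  suff cv : h' ^~ x @ \oo --> ((f m \- g)%R x ^+ 2)%:E.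
    rewrite is_cvg_limn_einfE; last by apply/cvg_ex; eexists; exact: cv.
    by apply/esym/cvg_lim.
  apply: cvg_EFin; first exact: nearW.
  rewrite (_ : fine \o _ = fun k => (f m x - f' k x) ^+ 2); last first.
    by apply/funext => k /=; rewrite /f' /patch mem_set.
  rewrite expr2; under eq_fun do rewrite expr2.
  have c : (fun k => f m x - f' k x) @ \oo --> (f m \- g) x.
    apply: (@cvgB _ _ _ _ _ (cst (f m x)) (f' ^~ x)); first exact: cvg_cst.
    by apply: cf'; exact: ED.
  exact: cvgM.
have h'0 k x : E x -> (0 <= h' k x)%E.
  by move=> _; rewrite lee_fin sqr_ge0.
apply: le_trans (fatou mu mE mh' h'0) _.
rewrite limn_einf_lim; apply: lime_le; first exact: is_cvg_einfs.
near=> k.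
have kM : (M <= k)%N by near: k; exists M.
apply: (@le_trans _ _ (\int[mu]_(x in E) h' k x)%E).
  by apply: ereal_inf_lbound; exists k => /=.
apply: le_trans (hM m (n_ k) Mm _); last first.
  by apply: leq_trans kM _; rewrite leq_addr.
apply: ge0_subset_integral => //.
  by apply: measurable_sq; exact: measurable_funB.
by move=> x _; rewrite lee_fin sqr_ge0.
Unshelve. all: by end_near. Qed.

End SquareIntegral.

(** * Integrals of complex vector fields *)

Section Integration.
Context {R : realType} (Omega : set (R3 R)).
Hypothesis mO : measurable Omega.
Implicit Types (u v w : vfield R) (f g : R3 R -> R[i]) (a : R[i]).

Let int (h : R3 R -> R) := leb3.-integrable Omega (EFin \o h).

Definition cintegrable f :=
  int (fun x => complex.Re (f x)) /\ int (fun x => complex.Im (f x)).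

Lemma intD (h k : R3 R -> R) : int h -> int k -> int (fun x => h x + k x).
Proof. by move=> ih ik; have := integrableD mO ih ik. Qed.
Lemma intZ (r : R) (h : R3 R -> R) : int h -> int (fun x => r * h x).
Proof. by move=> ih; have := integrableZl mO r ih. Qed.

Lemma cintegralD f g : cintegrable f -> cintegrable g ->
  cintegral Omega (fun x => f x + g x) = cintegral Omega f + cintegral Omega g.
Proof.
move=> [f1 f2] [g1 g2]; apply: complex_eq; rewrite !reimE /cintegral /=.
  by under eq_Rintegral do rewrite reD; rewrite RintegralD.
by under eq_Rintegral do rewrite imD; rewrite RintegralD.
Qed.

Lemma cintegralZ a f : cintegrable f ->
  cintegral Omega (fun x => a * f x) = a * cintegral Omega f.
Proof.
move=> [f1 f2]; apply: complex_eq; rewrite !reimE /cintegral /=.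
  under eq_Rintegral do rewrite reM.
  by rewrite RintegralB ?RintegralZl //; exact: intZ.
under eq_Rintegral do rewrite imM.
by rewrite RintegralD ?RintegralZl //; exact: intZ.
Qed.

Lemma cintegral_conj f : cintegrable f ->
  cintegral Omega (fun x => conjc (f x)) = conjc (cintegral Omega f).
Proof.
move=> [f1 f2]; apply: complex_eq; rewrite !reimE /cintegral /=.
  by under eq_Rintegral do rewrite reJ.
under eq_Rintegral do rewrite imJ -mulN1r.
by rewrite RintegralZl // mulN1r.
Qed.

Lemma eq_cintegral f g : (forall x, Omega x -> f x = g x) ->
  cintegral Omega f = cintegral Omega g.
Proof.
move=> fg; congr (_ +i* _); apply: eq_Rintegral => x; rewrite inE => Ox;
  by rewrite fg.
Qed.

Lemma normsq_csq (b : 'cV[R[i]]_3) : normsq b = \sum_(k < 3) csq (b k 0).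
Proof. by []. Qed.
Lemma normsq_ge0 (b : 'cV[R[i]]_3) : 0 <= normsq b.
Proof. by apply: sumr_ge0 => k _; exact: csq_ge0. Qed.
Lemma csqD (z1 z2 : R[i]) : csq (z1 + z2) <= 2 * csq z1 + 2 * csq z2.
Proof.
case: z1 z2 => [x1 y1] [x2 y2]; rewrite /csq /=.
have := sqr_ge0 (x1 - x2); have := sqr_ge0 (y1 - y2); lra.
Qed.
Lemma csqM (z1 z2 : R[i]) : csq (z1 * z2) = csq z1 * csq z2.
Proof. by case: z1 z2 => [x1 y1] [x2 y2]; rewrite /csq /=; ring. Qed.
Lemma normsqD (b c : 'cV[R[i]]_3) : normsq (b + c) <= 2 * normsq b + 2 * normsq c.
Proof.
rewrite !normsq_csq !mulr_sumr -big_split /=; apply: ler_sum => k _.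
by rewrite mxE csqD.
Qed.
Lemma normsqZ a (b : 'cV[R[i]]_3) : normsq (a *: b) = csq a * normsq b.
Proof.
by rewrite !normsq_csq mulr_sumr; apply: eq_bigr => k _; rewrite mxE csqM.
Qed.

Definition measurable_field u := forall k,
  measurable_fun Omega (fun x => complex.Re (u x k 0) : R) /\
  measurable_fun Omega (fun x => complex.Im (u x k 0) : R).

Lemma measurable_normsq u : measurable_field u ->
  measurable_fun Omega (fun x => normsq (u x)).
Proof.
move=> mu; apply: measurable_sum => k; apply: measurable_funD;
  by apply: measurable_funX; case: (mu k).
Qed.

Lemma int_le (h k : R3 R -> R) : measurable_fun Omega h -> int k ->
  (forall x, Omega x -> `|h x| <= k x) -> int h.
Proof.
move=> mh ik hk; apply: le_integrable ik => //; first exact/measurable_EFinP.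
move=> x Ox /=; rewrite lee_fin; apply: le_trans (hk x Ox) (ler_norm _).
Qed.

Lemma L2P u : L2 Omega u <->
  measurable_field u /\ int (fun x => normsq (u x)).
Proof.
split=> [[mu iu]|[mu iu]]; split=> //.
  apply/integrableP; split; first by apply/measurable_EFinP; apply: (measurable_normsq mu).
  by under eq_integral do rewrite /= ger0_norm ?normsq_ge0 //.
exact: integrable_lty iu.
Qed.

Lemma L2_le u (h : R3 R -> R) : measurable_field u -> int h ->
  (forall x, Omega x -> normsq (u x) <= h x) -> L2 Omega u.
Proof.
move=> mu ih uh; apply/L2P; split=> //.
apply: int_le ih _ => [|x Ox]; first exact: measurable_normsq.
by rewrite ger0_norm ?normsq_ge0 ?uh.
Qed.

Lemma L2D u v : L2 Omega u -> L2 Omega v -> L2 Omega (u + v).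
Proof.
move=> /L2P[mu iu] /L2P[mv iv].
apply: (L2_le (h := fun x => 2 * normsq (u x) + 2 * normsq (v x))).
- move=> k; have [? ?] := mu k; have [? ?] := mv k; split.
    by under eq_fun do rewrite /= mxE reD; exact: measurable_funD.
  by under eq_fun do rewrite /= mxE imD; exact: measurable_funD.
- by apply: intD; exact: intZ.
- by move=> x _; exact: normsqD.
Qed.

Lemma L2Z a u : L2 Omega u -> L2 Omega (a *: u).
Proof.
move=> /L2P[mu iu].
apply: (L2_le (h := fun x => csq a * normsq (u x))).
- move=> k; have [? ?] := mu k; split.
    under eq_fun do rewrite /= mxE reM.
    by apply: measurable_funB; apply: measurable_funM => //; exact: measurable_cst.
  under eq_fun do rewrite /= mxE imM.
  by apply: measurable_funD; apply: measurable_funM => //; exact: measurable_cst.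
- exact: intZ.
- by move=> x _; rewrite normsqZ.
Qed.

Lemma normsq0 : normsq (0 : 'cV[R[i]]_3) = 0.
Proof.
rewrite normsq_csq big1 // => k _; rewrite mxE /csq. by rewrite !expr0n /= addr0.
Qed.

Lemma L20 : L2 Omega 0.
Proof.
split=> [k|].
  split; [under eq_fun do rewrite /= mxE|under eq_fun do rewrite /= mxE];
  exact: measurable_cst.
by under eq_integral do rewrite normsq0; rewrite integral0 ltry.
Qed.

Definition conjv u : vfield R := fun x => map_mx conjc (u x).

Lemma conjvE u x k : conjv u x k 0 = conjc (u x k 0).
Proof. by rewrite /conjv mxE. Qed.

Lemma L2_conj u : L2 Omega u -> L2 Omega (conjv u).
Proof.
move=> /L2P[mu iu]; apply: (L2_le (h := fun x => normsq (u x))) => //.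
- move=> k; have [? ?] := mu k; split.
    by under eq_fun do rewrite conjvE reJ.
  by under eq_fun do rewrite conjvE imJ; exact: measurable_funN.
- move=> x _; rewrite !normsq_csq; apply: ler_sum => k _.
  by rewrite conjvE /csq reJ imJ sqrrN.
Qed.

Lemma re_sum (F : 'I_3 -> R[i]) :
  complex.Re (\sum_k F k) = \sum_k complex.Re (F k).
Proof. exact: (big_morph _ reD). Qed.
Lemma im_sum (F : 'I_3 -> R[i]) :
  complex.Im (\sum_k F k) = \sum_k complex.Im (F k).
Proof. exact: (big_morph _ imD). Qed.

Lemma reM_le (z1 z2 : R[i]) : `|complex.Re (z1 * z2)| <= csq z1 + csq z2.
Proof.
case: z1 z2 => [x1 y1] [x2 y2]; rewrite /csq /= ler_norml; apply/andP; split.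
  have := sqr_ge0 (x1 + x2); have := sqr_ge0 (y1 - y2);
  have := sqr_ge0 x1; have := sqr_ge0 x2; have := sqr_ge0 y1;
  have := sqr_ge0 y2; nra.
have := sqr_ge0 (x1 - x2); have := sqr_ge0 (y1 + y2);
have := sqr_ge0 x1; have := sqr_ge0 x2; have := sqr_ge0 y1;
have := sqr_ge0 y2; nra.
Qed.

Lemma imM_le (z1 z2 : R[i]) : `|complex.Im (z1 * z2)| <= csq z1 + csq z2.
Proof.
have := reM_le z1 (z2 * (- 'i)); rewrite csqM.
have -> : csq (- 'i : R[i]) = 1.
  by rewrite /csq !reimE /= oppr0 expr0n /= sqrrN expr1n add0r.
rewrite mulr1; congr (`|_| <= _).
by rewrite !reimE /=; ring.
Qed.

Lemma pairing_integrable u v : L2 Omega u -> L2 Omega v ->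
  cintegrable (fun x => \sum_(k < 3) u x k 0 * v x k 0).
Proof.
move=> /L2P[mu iu] /L2P[mv iv].
have iuv : int (fun x => normsq (u x) + normsq (v x)) by exact: intD.
split; apply: int_le iuv _.
- under eq_fun do rewrite re_sum.
  apply: measurable_sum => k; under eq_fun do rewrite reM.
  have [? ?] := mu k; have [? ?] := mv k.
  by apply: measurable_funB; exact: measurable_funM.
- move=> x _; rewrite re_sum !normsq_csq -big_split /=.
  apply: le_trans (ler_norm_sum _ _ _) _; apply: ler_sum => k _; exact: reM_le.
- under eq_fun do rewrite im_sum.
  apply: measurable_sum => k; under eq_fun do rewrite imM.
  have [? ?] := mu k; have [? ?] := mv k.
  by apply: measurable_funD; exact: measurable_funM.
- move=> x _; rewrite im_sum !normsq_csq -big_split /=.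
  apply: le_trans (ler_norm_sum _ _ _) _; apply: ler_sum => k _; exact: imM_le.
Qed.

Definition dotf u v := pairing Omega u (conjv v).

Lemma pairingDl u v w : L2 Omega u -> L2 Omega v -> L2 Omega w ->
  pairing Omega (u + v) w = pairing Omega u w + pairing Omega v w.
Proof.
move=> Lu Lv Lw; rewrite /pairing -cintegralD; try exact: pairing_integrable.
apply: eq_cintegral => x _; rewrite -big_split /=; apply: eq_bigr => k _.
by rewrite mxE mulrDl.
Qed.

Lemma pairingZl a u w : L2 Omega u -> L2 Omega w ->
  pairing Omega (a *: u) w = a * pairing Omega u w.
Proof.
move=> Lu Lw; rewrite /pairing -cintegralZ; last exact: pairing_integrable.
apply: eq_cintegral => x _; rewrite mulr_sumr; apply: eq_bigr => k _.
by rewrite mxE mulrA.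
Qed.

Lemma pairingC u v : pairing Omega u v = pairing Omega v u.
Proof.
by apply: eq_cintegral => x _; apply: eq_bigr => k _; rewrite mulrC.
Qed.

Lemma pairing_conj u v : L2 Omega u -> L2 Omega v ->
  pairing Omega (conjv u) (conjv v) = conjc (pairing Omega u v).
Proof.
move=> Lu Lv; rewrite /pairing -cintegral_conj; last exact: pairing_integrable.
apply: eq_cintegral => x _.
rewrite (big_morph _ (@conjcD R) (_ : conjc 0 = 0)); last first.
  by apply: complex_eq; rewrite //= oppr0.
by apply: eq_bigr => k _; rewrite !conjvE conjcM.
Qed.

Lemma conjvK u : conjv (conjv u) = u.
Proof.
apply/funext => x; apply/matrixP => k j; rewrite !mxE.
by case: (u x k j) => p q /=; rewrite opprK.
Qed.

Lemma dotfC u v : L2 Omega u -> L2 Omega v -> dotf v u = conjc (dotf u v).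
Proof.
move=> Lu Lv; rewrite /dotf -pairing_conj //; last exact: L2_conj.
by rewrite conjvK pairingC.
Qed.

Lemma dotfvv u : dotf u u =
  (\int[leb3]_(x in Omega) normsq (u x))%:C.
Proof.
congr (_ +i* _).
  apply: eq_Rintegral => x _; rewrite re_sum; apply: eq_bigr => k _.
  by rewrite conjvE reM reJ imJ mulrN opprK.
under eq_Rintegral => x _.
  rewrite im_sum big1; first over.
  by move=> k _; rewrite conjvE imM reJ imJ mulrN mulrC addNr.
by rewrite Rintegral_cst // mul0r.
Qed.

Lemma int_normsq_ge0 u : 0 <= \int[leb3]_(x in Omega) normsq (u x).
Proof. by apply: Rintegral_ge0 => x _; exact: normsq_ge0. Qed.

Lemma normsq_eq0 (b : 'cV[R[i]]_3) : normsq b = 0 -> b = 0.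
Proof.
move=> /eqP; rewrite normsq_csq psumr_eq0; last by move=> k _; exact: csq_ge0.
move=> /allP h; apply/matrixP => k j; rewrite (ord1 j) mxE.
have := h k (mem_index_enum _) => /=.
rewrite /csq paddr_eq0 ?sqr_ge0 // !sqrf_eq0 => /andP[/eqP p /eqP q].
exact: complex_eq.
Qed.

Lemma int_normsq_eq0 u : L2 Omega u ->
  \int[leb3]_(x in Omega) normsq (u x) = 0 <-> eqae Omega u 0.
Proof.
move=> /L2P[mu iu].
have mE : measurable_fun Omega (EFin \o (fun x => normsq (u x))).
  by apply/measurable_EFinP; apply: (measurable_normsq mu).
have [h1 h2] := ae_eq_integral_abs leb3 mO mE.
have E : (\int[leb3]_(x in Omega) `|(EFin \o (fun x => normsq (u x))) x| =
    (\int[leb3]_(x in Omega) normsq (u x))%:E)%E.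
  rewrite /Rintegral fineK; last exact: integrable_fin_num.
  by apply: eq_integral => x _ /=; rewrite ger0_norm ?normsq_ge0.
split=> [h|h].
  have := h1 _; rewrite E h => /(_ erefl); apply: filterS => x /= hx Ox.
  by have := hx Ox => -[] /normsq_eq0.
apply: EFin_inj; rewrite -E; apply: h2; apply: filterS h => x /= hx Ox.
by rewrite /= hx // normsq0.
Qed.

End Integration.

(** * The Hilbert space of square-integrable fields *)

Section L2Space.
Context {R : realType} (Omega : set (R3 R)) (mO : measurable Omega).

(** A predicate indexed by the measurability of Omega, on which its closure
    under addition depends. *)
Definition L2pred of measurable Omega : {pred vfield R} :=
  fun u => `[< L2 Omega u >].

Lemma L2pred_submod : submod_closed (L2pred mO).
Proof.
split=> [|a u v /asboolP Lu /asboolP Lv]; apply/asboolP; first exact: L20.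
by apply: L2D => //; exact: L2Z.
Qed.

HB.instance Definition _ :=
  GRing.isSubmodClosed.Build R[i] (vfield R) (L2pred mO) L2pred_submod.

Definition L2fun : Type := {u : vfield R | L2pred mO u}.
HB.instance Definition _ := SubType.on L2fun.
HB.instance Definition _ := Choice.on L2fun.
HB.instance Definition _ := [SubChoice_isSubLmodule of L2fun by <:].

Implicit Types U W : L2fun.

Lemma L2funP U : L2 Omega (val U).
Proof. by apply/asboolP; exact: valP U. Qed.

Definition mkL2 (u : vfield R) (Lu : L2 Omega u) : L2fun :=
  exist _ u (introT (asboolP _) Lu).

Definition dot2 U W : R[i] := dotf Omega (val U) (val W).

Lemma semi_inner_dot2 : semi_inner dot2.
Proof.
split=> [U W Z|a U W|U W|U]; rewrite /dot2.
- by rewrite /dotf raddfD pairingDl //; try exact: L2funP;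
    apply: L2_conj => //; exact: L2funP.
- by rewrite /dotf linearZ pairingZl //; try exact: L2funP;
    apply: L2_conj => //; exact: L2funP.
- by apply: dotfC => //; exact: L2funP.
- by rewrite dotfvv // ler0c int_normsq_ge0.
Qed.

Lemma sqn_dot2 U : sqn dot2 U = \int[leb3]_(x in Omega) normsq (val U x).
Proof. by rewrite /sqn /dot2 dotfvv. Qed.

Lemma L2norm_hnorm U : L2norm Omega (val U) = hnorm dot2 U.
Proof. by rewrite /L2norm /hnorm sqn_dot2. Qed.

Lemma null_eqP U W : null_eq dot2 U W <-> eqae Omega (val U) (val W).
Proof.
rewrite /null_eq sqn_dot2 raddfB.
rewrite int_normsq_eq0 //; last by rewrite -raddfB; exact: L2funP.
split; apply: filterS => x /= h Ox.
  by have := h Ox; rewrite /= => /eqP; rewrite subr_eq0 => /eqP.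
by apply/eqP; rewrite subr_eq0; apply/eqP; exact: h.
Qed.

Lemma sqint_le_normsq (u : vfield R) (h : R3 R -> R) : L2 Omega u ->
  measurable_fun Omega h -> (forall x, h x ^+ 2 <= normsq (u x)) ->
  (sqint leb3 Omega h <= (\int[leb3]_(x in Omega) normsq (u x))%:E)%E.
Proof.
move=> /L2P[] // mu iu mh hu.
rewrite /Rintegral fineK; last exact: integrable_fin_num.
apply: ge0_le_integral => //.
- by move=> x _; rewrite lee_fin sqr_ge0.
- exact: measurable_sq.
- by apply/measurable_EFinP; apply: (measurable_normsq mu).
- by move=> x _; rewrite lee_fin.
Qed.

Lemma normsq_re (b : 'cV[R[i]]_3) k : complex.Re (b k 0) ^+ 2 <= normsq b.
Proof.
rewrite normsq_csq (bigD1 k) //= /csq -addrA lerDl addr_ge0 ?sqr_ge0 //.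
by apply: sumr_ge0 => j _; rewrite addr_ge0 ?sqr_ge0.
Qed.
Lemma normsq_im (b : 'cV[R[i]]_3) k : complex.Im (b k 0) ^+ 2 <= normsq b.
Proof.
rewrite normsq_csq (bigD1 k) //= /csq [_ ^+ 2 + _]addrC -addrA lerDl.
rewrite addr_ge0 ?sqr_ge0 //.
by apply: sumr_ge0 => j _; rewrite addr_ge0 ?sqr_ge0.
Qed.

Lemma integral_normsq (u : vfield R) : measurable_field Omega u ->
  (\int[leb3]_(x in Omega) (normsq (u x))%:E = \sum_(k < 3)
    (sqint leb3 Omega (fun x => complex.Re (u x k 0%R)) +
     sqint leb3 Omega (fun x => complex.Im (u x k 0%R))))%E.
Proof.
move=> mu; under eq_integral do rewrite normsq_csq -sumEFin.
rewrite ge0_integral_sum //; last 2 first.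
- move=> k; apply/measurable_EFinP; apply: measurable_funD;
    by apply: measurable_funX; case: (mu k).
- by move=> k x _; rewrite lee_fin csq_ge0.
apply: eq_bigr => k _; under eq_integral do rewrite /csq EFinD.
rewrite ge0_integralD //.
- by move=> x _; rewrite lee_fin sqr_ge0.
- by apply: measurable_sq; case: (mu k).
- by move=> x _; rewrite lee_fin sqr_ge0.
- by apply: measurable_sq; case: (mu k).
Qed.

(** Completeness reduces to Riesz-Fischer for the six real components. *)
Lemma complete_dot2 : complete_form dot2.
Proof.
move=> s hs.
have ms n : measurable_field Omega (val (s n)).
  by have /(L2P mO)[] := L2funP (s n).
have comp (p : R[i] -> R) k : (forall z1 z2, p (z1 - z2) = p z1 - p z2) ->
    (forall b : 'cV[R[i]]_3, p (b k 0) ^+ 2 <= normsq b) ->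
    (forall n, measurable_fun Omega (fun x => p (val (s n) x k 0))) ->
    exists2 g : R3 R -> R, measurable_fun Omega g & forall e : R, 0 < e ->
      exists N, forall n, (N <= n)%N ->
        (sqint leb3 Omega (fun x => p (val (s n) x k 0) - g x)%R <= e%:E)%E.
  move=> pB p_le mp.
  have := @sqint_complete _ _ R leb3 Omega mO _ mp; apply.
  move=> e /hs[N hN]; exists N => m n Nm Nn.
  have := hN m n Nm Nn; rewrite sqn_dot2 => /ltW h.
  apply: le_trans (_ : (_ <= _%:E)%E) _; last by rewrite lee_fin; exact: h.
  apply: sqint_le_normsq; first exact: L2funP.
    exact: measurable_funB.
  by move=> x; rewrite /= -pB; have := p_le (val (s m - s n) x); rewrite raddfB /= !mxE.
have re k := comp (@complex.Re R) k (fun z1 z2 => etrans (reD z1 (- z2))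
  (congr1 (+%R _) (reN z2))) (normsq_re ^~ k) (fun n => (ms n k).1).
have im k := comp (@complex.Im R) k (fun z1 z2 => etrans (imD z1 (- z2))
  (congr1 (+%R _) (imN z2))) (normsq_im ^~ k) (fun n => (ms n k).2).
pose gr k := s2val (cid2 (re k)); pose gi k := s2val (cid2 (im k)).
have mgr k : measurable_fun Omega (gr k) := s2valP (cid2 (re k)).
have mgi k : measurable_fun Omega (gi k) := s2valP (cid2 (im k)).
have cr k := s2valP' (cid2 (re k)); have ci k := s2valP' (cid2 (im k)).
pose l : vfield R := fun x => \col_k (gr k x +i* gi k x).
have msl n : measurable_field Omega (val (s n) - l).
  move=> k; split.
    under eq_fun do rewrite !mxE reD reN /=.
    by apply: measurable_funB; [case: (ms n k)|exact: mgr].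
  under eq_fun do rewrite !mxE imD imN /=.
  by apply: measurable_funB; [case: (ms n k)|exact: mgi].
have key e : 0 < e -> exists N, forall n, (N <= n)%N ->
    (\int[leb3]_(x in Omega) (normsq ((val (s n) - l) x))%:E <= e%:E)%E.
  move=> e0; have e6 : 0 < e / 6%:R by rewrite divr_gt0.
  pose Nr k := projT1 (cid (cr k _ e6)); pose Ni k := projT1 (cid (ci k _ e6)).
  exists (\max_(k < 3) maxn (Nr k) (Ni k)) => n Nn.
  rewrite integral_normsq //.
  have -> : e%:E = (\sum_(k < 3) ((e / 6%:R)%:E + (e / 6%:R)%:E))%E.
    by rewrite sumEFin; congr EFin; rewrite !big_ord_recl big_ord0; field.
  apply: lee_sum => k _.
  have Nk : (maxn (Nr k) (Ni k) <= n)%N.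
    by apply: leq_trans Nn; apply: (leq_bigmax k).
  rewrite geq_max in Nk; case/andP: Nk => nr ni; apply: leeD.
    under eq_fun do rewrite !mxE reD reN /=.
    exact: projT2 (cid (cr k _ e6)) n nr.
  under eq_fun do rewrite !mxE imD imN /=.
  exact: projT2 (cid (ci k _ e6)) n ni.
have Lsl n : (\int[leb3]_(x in Omega) (normsq ((val (s n) - l) x))%:E < +oo)%E ->
    L2 Omega (val (s n) - l).
  by move=> h; split=> //; exact: msl.
have Ll : L2 Omega l.
  have [N hN] := key 1 ltr01.
  have h := Lsl N (le_lt_trans (hN N (leqnn N)) (ltry 1)).
  rewrite (_ : l = val (s N) + (-1) *: (val (s N) - l)).
    by apply: L2D => //; [exact: L2funP|exact: L2Z].
  by rewrite scaleN1r opprB addrC subrK.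
exists (mkL2 Ll) => e e0; have e2 : 0 < e / 2 by rewrite divr_gt0.
have [N hN] := key _ e2; exists N => n Nn; rewrite sqn_dot2 raddfB /=.
apply: (@le_lt_trans _ _ (e / 2)); last by lra.
have h := hN n Nn; have /(L2P mO)[_ ih] := Lsl n (le_lt_trans h (ltry _)).
by rewrite -lee_fin /Rintegral fineK //; exact: integrable_fin_num.
Qed.

End L2Space.

(** * Partial derivatives along lines *)

Section Lines.
Context {R : realType}.
Local Notation V3 := (R * R * R)%type.
Implicit Types (F f : V3 -> R) (p x : V3) (i j : 'I_3) (s t : R).

Definition line i p t : V3 := t *: (basis3 i : V3) + p.

Lemma continuous_line i p : continuous (line i p).
Proof.
move=> t; apply: cvgD; last exact: cvg_cst.
by apply: cvgZr_tmp; exact: cvg_id.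
Qed.

Lemma is_derive_line F i p t : derivable F (line i p t) (basis3 i) ->
  is_derive t 1 (fun t => F (line i p t)) (partial i F (line i p t)).
Proof.
move=> dF.
have E : (fun h : R => h^-1 *: (((fun t => F (line i p t)) \o shift t) (h *: 1) -
    F (line i p t))) =
  (fun h : R => h^-1 *: ((F \o shift (line i p t)) (h *: (basis3 i : V3)) -
    F (line i p t))).
  apply/funext => h /=; congr (_ *: (F _ - _)).
  by rewrite /line /GRing.scale /= mulr1 addrA -scalerDl.
by apply: DeriveDef; rewrite /derivable /derive E.
Qed.

Lemma continuous_along F i p t : derivable F (line i p t) (basis3 i) ->
  {for t, continuous (fun t => F (line i p t))}.
Proof.
move=> /is_derive_line[d _].
by apply: differentiable_continuous; apply/derivable1_diffP.
Qed.

Lemma mvt_line F i p s : 0 < s -> (forall x, derivable F x (basis3 i)) ->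
  exists2 c, 0 < c < s &
    F (line i p s) - F p = s * partial i F (line i p c).
Proof.
move=> s0 dF.
have [||c] := @MVT R (fun t => F (line i p t))
  (fun t => partial i F (line i p t)) 0 s s0.
- by move=> x _; exact: is_derive_line.
- by apply: continuous_subspaceT => t; exact: continuous_along.
rewrite in_itv /= subr0 => cs; rewrite {2}/line scale0r add0r mulrC => h.
by exists c.
Qed.

Lemma line_ball p i j (e c d : R) : 0 < c < e / 2 -> 0 < d < e / 2 ->
  ball p e (line j (line i p c) d).
Proof.
move=> /andP[c0 ce] /andP[d0 de].
have N k : `|(basis3 k : V3)| <= 1.
  by case: k => -[|[|[]]] //= k; rewrite /basis3 /= !prod_normE /= !normr0 !normr1
    ?maxxx ?(max_l ler01) ?(max_r ler01) ?maxxx ?(max_l ler01) ?(max_r ler01).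
rewrite -ball_normE /= /line distrC addrA addrK.
apply: le_lt_trans (ler_normD _ _) _; rewrite !normrZ !gtr0_norm //.
have := N i; have := N j; nra.
Qed.

(** Schwarz's theorem.  The second difference over a small square, divided by
    the area, is a value of either mixed derivative near p. *)
Lemma partial_comm F i j p :
  (forall k x, derivable F x (basis3 k)) ->
  (forall k l x, derivable (partial k F) x (basis3 l)) ->
  (forall k l, continuous (partial l (partial k F) : V3 -> R)) ->
  partial i (partial j F) p = partial j (partial i F) p.
Proof.
move=> d1 d2 c2; apply/eqP; rewrite -subr_eq0 -normr_le0.
apply/ler_addgt0Pl => e e0; rewrite addr0.
have cc (k l : 'I_3) := c2 k l p.
have e2 : 0 < e / 2 by rewrite divr_gt0.
have /cvgrPdist_lt/(_ _ e2)/nbhs_ballP[r1 /= r10 h1] := cc j i.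
have /cvgrPdist_lt/(_ _ e2)/nbhs_ballP[r2 /= r20 h2] := cc i j.
pose r := Num.min r1 r2; have r0 : 0 < r by rewrite lt_min r10.
pose s := r / 4; have s0 : 0 < s by rewrite divr_gt0.
have sr : s < r / 2 by rewrite /s; lra.
have lt2 (u : R) : 0 < u < s -> 0 < u < r1 / 2 /\ 0 < u < r2 / 2.
  move=> /andP[u0 us]; have : r <= r1 by rewrite ge_min lexx.
  have : r <= r2 by rewrite ge_min lexx orbT.
  by move=> ? ?; split; apply/andP; split=> //; lra.
pose D := F (line i (line j p s) s) - F (line i p s) - F (line j p s) + F p.
have lineC k l u v : line k (line l p u) v = line l (line k p v) u.
  by rewrite /line addrCA.
(* The two increments can be taken in either order, and each order produces
   one of the two mixed derivatives. *)
have half k l : D = F (line l (line k p s) s) - F (line k p s) -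
    F (line l p s) + F p ->
  exists c d, [/\ 0 < c < s, 0 < d < s &
    D = s ^+ 2 * partial l (partial k F) (line l (line k p c) d)].
  move=> ->.
  pose G x := F (line l x s) - F x.
  have dG1 (x : V3) : derivable (fun x : V3 => F (line l x s)) x (basis3 k : V3).
    apply/derivable1P.
    rewrite (_ : (fun h => _) = fun h : R => F (line k (line l x s) h)).
      by have [] := @is_derive_line F k (line l x s) 0 (d1 k _).
    by apply/funext => h; rewrite /line addrCA.
  have dG (x : V3) : derivable (G : V3 -> R) x (basis3 k : V3).
    by apply: derivableB; [exact: dG1|exact: d1].
  have pG x : partial k G x = partial k F (line l x s) - partial k F x.
    have E : 'D_(basis3 k : V3) (fun x : V3 => F (line l x s)) x =
        partial k F (line l x s).
      rewrite /partial /derive.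
      rewrite (_ : (fun h => _) = fun h : R => h^-1 *:
        ((F \o shift (line l x s)) (h *: (basis3 k : V3)) - F (line l x s))) //.
      by apply/funext => h; rewrite /= /line addrCA.
    by rewrite -E /partial (deriveB (dG1 x) (d1 k x)).
  have [c cs Ec] := mvt_line p s0 dG.
  have [d ds Ed] := mvt_line (line k p c) s0 (d2 k l).
  exists c, d; split=> //.
  rewrite expr2 -mulrA -Ed -pG -Ec /G opprB addrA addrAC; ring.
have [|c [d [cs ds E1]]] := half i j; first by rewrite /D lineC.
have [|c' [d' [cs' ds' E2]]] := half j i; first by rewrite /D; ring.
have {}h1 : `|partial i (partial j F) p -
    partial i (partial j F) (line i (line j p c') d')| < e / 2.
  by apply: h1; apply: line_ball; [exact: (lt2 _ cs').1|exact: (lt2 _ ds').1].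
have {}h2 : `|partial j (partial i F) p -
    partial j (partial i F) (line j (line i p c) d)| < e / 2.
  by apply: h2; apply: line_ball; [exact: (lt2 _ cs).2|exact: (lt2 _ ds).2].
have E : partial j (partial i F) (line j (line i p c) d) =
    partial i (partial j F) (line i (line j p c') d').
  have s2 : s ^+ 2 != 0 by rewrite sqrf_eq0 gt_eqF.
  exact: mulfI s2 _ _ (etrans (esym E1) E2).
rewrite E in h2.
move: h1 h2; set a := partial i _ p; set b := partial j _ p; set m := partial i _ _.
move=> h1 h2; rewrite (_ : a - b = (a - m) - (b - m)); last by ring.
apply: le_trans (ler_normB _ _) _.
rewrite {1}(splitr e).
exact: lerD (ltW h1) (ltW h2).
Qed.

End Lines.

(** * Integration by parts for test functions *)

Section ProductSigmaFinite.
Context d1 d2 (T1 : measurableType d1) (T2 : measurableType d2) (R : realType).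
Variables (m1 : {sigma_finite_measure set T1 -> \bar R})
  (m2 : {sigma_finite_measure set T2 -> \bar R}).

(** A name for the product measure that carries its sigma-finiteness, so that
    Fubini's theorem can be applied to iterated products. *)
Definition prodm : set (T1 * T2)%type -> \bar R := (m1 \x m2)%E.

HB.instance Definition _ := Measure.on prodm.

Lemma prodm_sigma_finite : sigma_finite setT prodm.
Proof.
have /sigma_finiteP[F [TF ndF Foo]] := sigma_finiteT m1.
have /sigma_finiteP[G [TG ndG Goo]] := sigma_finiteT m2.
exists (fun n => F n `*` G n).
  apply/seteqP; split=> // -[x y] _.
  have : setT x by []; rewrite TF => -[n _ Fx].
  have : setT y by []; rewrite TG => -[k _ Gy].
  exists (maxn n k) => //; split.
    by move: x Fx; exact/subsetPset/ndF/leq_maxl.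
  by move: y Gy; exact/subsetPset/ndG/leq_maxr.
move=> k; have [? ?] := Foo k; have [? ?] := Goo k.
split; first exact: measurableX.
by rewrite /prodm product_measure1E // lte_mul_pinfty // ge0_fin_numE.
Qed.

HB.instance Definition _ :=
  Measure_isSigmaFinite.Build _ _ _ prodm prodm_sigma_finite.
End ProductSigmaFinite.

Section PartialIntegration.
Context {R : realType}.
Local Notation V3 := (R * R * R)%type.
Implicit Types (F h : V3 -> R) (p x : V3) (i j : 'I_3) (t M : R).

Lemma bounded_support_integrable d (T : measurableType d)
    (mu : {measure set T -> \bar R}) (A : set T) (f : T -> R) (B : R) :
  measurable A -> (mu A < +oo)%E -> measurable_fun setT f ->
  (forall x : T, `|f x| <= B) -> (forall x : T, ~ A x -> f x = 0) ->
  mu.-integrable setT (EFin \o f).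
Proof.
move=> mA muA mf fB f0.
have -> : EFin \o f = (EFin \o f) \_ A.
  apply/funext => x; rewrite /patch; case: ifPn => //.
  by rewrite notin_setE /= => /f0 ->.
apply: (iffLR (integrable_mkcond _ mA)).
apply: (measurable_bounded_integrable mA muA); first exact: measurable_funTS.
exists B; split; first exact: num_real.
by move=> b Bb x _ /=; apply: le_trans (fB x) _; exact: ltW.
Qed.

Lemma norm_coord x : [/\ `|x.1.1| <= `|x|, `|x.1.2| <= `|x| & `|x.2| <= `|x|].
Proof. by rewrite !prod_normE /= !le_max !lexx !orbT. Qed.

Lemma bounded_of_support h M : continuous h ->
  (forall x, M < `|x| -> h x = 0) -> exists B, forall x, `|h x| <= B.
Proof.
move=> ch h0; pose I : set R := `[- `|M|, `|M|]%classic; pose K := (I `*` I) `*` I.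
have cK : compact K.
  by apply: compact_setX; [apply: compact_setX|]; exact: segment_compact.
have K0 : K 0.
  by split; [split|]; rewrite /I /= in_itv /= lerNl oppr0 normr_ge0.
have [c _ hc] : exists2 c, c \in K & forall y : V3, y \in K -> `|h y| <= `|h c|.
  apply: (@compact_EVT_max V3 R (fun x => `|h x|)) => //.
    by exists 0.
  apply: continuous_subspaceT => x; apply: continuous_comp; first exact: ch.
  exact: norm_continuous.
exists `|h c| => x; have [/h0 ->|xM] := ltP M `|x|.
  by rewrite normr0 normr_ge0.
apply: hc; rewrite inE; have [n1 n2 n3] := norm_coord x.
have nM : `|x| <= `|M| by apply: le_trans xM (ler_norm _).
by split; [split|]; rewrite /I /= in_itv /= -ler_norml; apply: le_trans nM.
Qed.

Lemma integral_derivative0 (G g : R -> R) (N : R) : 0 < N ->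
  (forall t, is_derive t 1 G (g t)) -> continuous g ->
  (forall t, N <= `|t| -> G t = 0) -> (forall t, N <= `|t| -> g t = 0) ->
  (\int[leb]_t (g t)%:E)%E = 0%E.
Proof.
move=> N0 dG cg G0 g0.
have -> : (fun t => (g t)%:E) = (EFin \o g) \_ `[- N, N].
  apply/funext => t; rewrite /patch; case: ifPn => //.
  rewrite notin_setE /= in_itv /= => /negP h; rewrite g0 //.
  by rewrite ltW // ltNge ler_norml.
rewrite -integral_mkcond.
have cG t : {for t, continuous G}.
  by apply: differentiable_continuous; apply/derivable1_diffP; case: (dG t).
have := @continuous_FTC2 R g G (- N) N; rewrite /leb /= => ->.
- by rewrite !G0 ?subee // ?normrN ger0_norm // ltW.
- by lra.
- exact: continuous_subspaceT.
- split; first by move=> t _; case: (dG t).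
    by apply: cvg_at_right_filter; exact: cG.
  by apply: cvg_at_left_filter; exact: cG.
- by move=> t _; rewrite derive1E; case: (dG t).
Qed.

Lemma integral_line0 F i p N : 0 < N ->
  (forall x, derivable F x (basis3 i)) -> continuous (partial i F : V3 -> R) ->
  (forall t, N <= `|t| -> F (line i p t) = 0) ->
  (forall t, N <= `|t| -> partial i F (line i p t) = 0) ->
  (\int[leb]_t (partial i F (line i p t))%:E)%E = 0%E.
Proof.
move=> N0 dF cF F0 p0; apply: (integral_derivative0 N0 _ _ F0 p0).
  by move=> t; exact: is_derive_line.
by move=> t; apply: (continuous_comp (@continuous_line R i p t)); exact: cF.
Qed.

Lemma line0E (y z t : R) : line ord0 (0, y, z) t = (t, y, z).
Proof.
have -> : line ord0 (0, y, z) t = (t * 1 + 0, t * 0 + y, t * 0 + z) by [].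
by rewrite mulr1 !mulr0 addr0 !add0r.
Qed.
Lemma line1E (x z t : R) : line (inord 1) (x, 0, z) t = (x, t, z).
Proof.
rewrite /line /basis3 /= inordK //=.
have -> : t *: ((0, 1, 0) : V3) + (x, 0, z) = (t * 0 + x, t * 1 + 0, t * 0 + z).
  by [].
by rewrite mulr1 !mulr0 addr0 !add0r.
Qed.
Lemma line2E (x y t : R) : line (inord 2) (x, y, 0) t = (x, y, t).
Proof.
rewrite /line /basis3 /= inordK //=.
have -> : t *: ((0, 0, 1) : V3) + (x, y, 0) = (t * 0 + x, t * 0 + y, t * 1 + 0).
  by [].
by rewrite mulr1 !mulr0 addr0 !add0r.
Qed.

Definition sqr2 (M : R) : set (measurableTypeR R * measurableTypeR R) :=
  ball (0 : R) M `*` ball (0 : R) M.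

Lemma leb2_sqr2 M : 0 <= M -> ((leb \x leb)%E (sqr2 M) < +oo)%E.
Proof.
move=> M0.
have -> : (leb \x leb)%E (sqr2 M) = (leb (ball (0%R : R) M) * leb (ball (0%R : R) M))%E.
  by apply: (@product_measure1E _ _ _ _ R _ (@lebesgue_measure R));
    exact: measurable_ballR.
by rewrite leb_ball // -EFinM ltry.
Qed.

Let sleb : {sigma_finite_measure set (measurableTypeR R) -> \bar R} :=
  @lebesgue_measure R.
Let sleb2 : {sigma_finite_measure set
    (measurableTypeR R * measurableTypeR R)%type -> \bar R} := prodm sleb sleb.

(** Fubini's theorem lets the derivative be integrated along its own direction
    first, where the fundamental theorem of calculus gives zero. *)
Lemma integral_partial0 F i M : 0 < M ->
  (forall x, derivable F x (basis3 i)) -> continuous (partial i F : V3 -> R) ->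
  (forall x, M <= `|x| -> F x = 0) -> (forall x, M <= `|x| -> partial i F x = 0) ->
  (\int[leb3]_x (partial i F x)%:E)%E = 0%E.
Proof.
move=> M0 dF cF F0 P0; set h := partial i F.
have [B hB] : exists B, forall x, `|h x| <= B.
  by apply: (bounded_of_support (M := M) cF) => x /ltW; exact: P0.
have mh : measurable_fun setT (h : R3 R -> R) by exact: continuous_measurable3.
have big x : M <= `|x.1.1| \/ M <= `|x.1.2| \/ M <= `|x.2| -> M <= `|x|.
  by have [n1 n2 n3] := norm_coord x => -[|[|]] /le_trans; apply.
have ih : leb3.-integrable setT (EFin \o h).
  apply: (@bounded_support_integrable _ _ leb3 (cube 0 M) h B) => //.
  - exact: measurable_cube.
  - by rewrite leb3_cube ?(ltW M0) // ltry.
  - move=> x nx; apply: P0; rewrite leNgt; apply/negP => xM; apply: nx.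
    by rewrite cubeE -ball_normE /= sub0r normrN.
have ih2 (z : measurableTypeR R) : (leb \x leb)%E.-integrable setT
    (EFin \o (fun q : measurableTypeR R * measurableTypeR R => h (q, z))).
  apply: (@bounded_support_integrable _ _ (leb \x leb)%E (sqr2 M) _ B) => //.
  - by apply: measurableX; exact: measurable_ballR.
  - exact: leb2_sqr2 (ltW M0).
  - exact: measurable_fun_pair1 mh.
  - move=> x nx; apply: P0; rewrite leNgt; apply/negP => xM; apply: nx.
    have [n1 n2 _] := norm_coord (x, z).
    by split; rewrite /= -ball_normE /= sub0r normrN; apply: le_lt_trans xM.
have [i0|[i1|i2]] : i = ord0 \/ i = inord 1 \/ i = inord 2.
  case: i {dF cF P0 h hB mh ih ih2} => -[|[|[|//]]] ?; [left|right; left|right; right];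
    by apply/val_inj; rewrite /= ?inordK.
- apply: etrans (esym (@integral21_prod_meas1 _ _ _ _ R sleb2 sleb _ ih)) _.
  rewrite integral0_eq // => z _.
  apply: etrans (esym (@integral21_prod_meas1 _ _ _ _ R sleb sleb _ (ih2 z))) _.
  rewrite integral0_eq // => y _.
  have L t : line i (0, y, z) t = (t, y, z) by rewrite i0 line0E.
  rewrite -(@integral_line0 F i (0, y, z) M M0 dF cF); first last.
  - by move=> t tM; apply: P0; apply: big; left; rewrite L.
  - by move=> t tM; apply: F0; apply: big; left; rewrite L.
  by apply: eq_integral => t _; rewrite L.
- apply: etrans (esym (@integral21_prod_meas1 _ _ _ _ R sleb2 sleb _ ih)) _.
  rewrite integral0_eq // => z _.
  apply: etrans (esym (@integral12_prod_meas1 _ _ _ _ R sleb sleb _ (ih2 z))) _.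
  rewrite integral0_eq // => x _.
  have L t : line i (x, 0, z) t = (x, t, z) by rewrite i1 line1E.
  rewrite -(@integral_line0 F i (x, 0, z) M M0 dF cF); first last.
  - by move=> t tM; apply: P0; apply: big; right; left; rewrite L.
  - by move=> t tM; apply: F0; apply: big; right; left; rewrite L.
  by apply: eq_integral => t _; rewrite L.
- apply: etrans (esym (@integral12_prod_meas1 _ _ _ _ R sleb2 sleb _ ih)) _.
  rewrite integral0_eq // => -[x y] _.
  have L t : line i (x, y, 0) t = (x, y, t) by rewrite i2 line2E.
  rewrite -(@integral_line0 F i (x, y, 0) M M0 dF cF); first last.
  - by move=> t tM; apply: P0; apply: big; right; right; rewrite L.
  - by move=> t tM; apply: F0; apply: big; right; right; rewrite L.
  by apply: eq_integral => t _; rewrite L.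
Qed.

End PartialIntegration.

Section TestFunctions.
Context {R : realType} (Omega : set (R3 R)) (oO : open Omega).
Local Notation V3 := (R * R * R)%type.
Implicit Types (phi psi : R3 R -> R) (i j : 'I_3) (Phi Psi : R3 R -> 'cV[R]_3).

Let mO : measurable Omega := open_measurable3 oO.

Lemma test_derivable phi i (x : V3) :
  test_function Omega phi -> derivable phi x (basis3 i : V3).
Proof. by move=> [/(_ 1)[h _] _ _]; exact: h. Qed.

Lemma test_continuous phi : test_function Omega phi ->
  continuous (phi : V3 -> R).
Proof. by move=> [/(_ 0)]. Qed.

Lemma test_support phi (x : R3 R) : test_function Omega phi -> phi x != 0 ->
  Omega x.
Proof. by move=> [_ _ sub] x0; apply: sub; apply: subset_closure. Qed.

Lemma sub_support_test phi psi : smooth psi -> test_function Omega phi ->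
  closure [set x : V3 | psi x != 0] `<=` closure [set x : V3 | phi x != 0] ->
  test_function Omega psi.
Proof.
move=> sp [_ cp sub] h; split=> //; last exact: subset_trans sub.
by apply: subclosed_compact cp h; exact: closed_closure.
Qed.

(** A function vanishing near a point has zero partial derivatives there, so the
    support does not grow. *)
Lemma test_partial phi i : test_function Omega phi ->
  test_function Omega (partial i phi).
Proof.
move=> tp; apply: (sub_support_test (phi := phi)) => //.
  by move=> n; case: tp => /(_ n.+1)[_ h] _ _; exact: h.
rewrite [X in _ `<=` X](closure_id _).1; last exact: closed_closure.
apply: closureS => x /= px B nB; apply: contrapT => hB; case/negP: px.
apply/eqP; rewrite /partial (@near_eq_derive _ _ _ phi (cst 0) x).
  exact: derive_cst.
apply: filterS nB => y By /=; apply: contrapT => /eqP py; apply: hB.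
by exists y; split.
Qed.

Lemma Ck_sub n phi psi : Ck n phi -> Ck n psi -> Ck n (fun x => phi x - psi x).
Proof.
elim: n phi psi => [|n IH] phi psi /=.
  by move=> c1 c2 x; apply: (@continuousB _ _ (V3) phi psi x (c1 x) (c2 x)).
move=> [d1 c1] [d2 c2]; split=> [i x|i].
  exact: (derivableB (d1 i x) (d2 i x)).
have -> : partial i (fun x => phi x - psi x) =
    fun x => partial i phi x - partial i psi x.
  by apply/funext => x; rewrite /partial -(deriveB (d1 i x) (d2 i x)).
exact: IH.
Qed.

Lemma test_sub phi psi : test_function Omega phi -> test_function Omega psi ->
  test_function Omega (fun x => phi x - psi x).
Proof.
move=> [s1 c1 o1] [s2 c2 o2].
have sub : closure [set x : V3 | phi x - psi x != 0] `<=`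
    closure [set x : V3 | phi x != 0] `|` closure [set x : V3 | psi x != 0].
  rewrite -closureU; apply: closureS => x /= h.
  have [p0|p0] := eqVneq (phi x) 0; last by left.
  by right; apply: contraNN h => /eqP q0; rewrite p0 q0 subrr.
split; first by move=> n; exact: Ck_sub.
  apply: subclosed_compact sub; first exact: closed_closure.
  exact: compactU.
by apply: subset_trans sub _ => x [/o1|/o2].
Qed.

Lemma test_bound phi : test_function Omega phi ->
  exists2 M, 0 < M & forall x : V3, M <= `|x| -> phi x = 0.
Proof.
move=> [_ cp _]; have [M [_ hM]] := compact_bounded cp.
exists (`|M| + 1); first by rewrite ltr_wpDl.
move=> x xM; apply: contrapT => /eqP px.
have M1 : M < `|M| + 1 / 2.
  by apply: le_lt_trans (ler_norm M) _; rewrite ltrDl; lra.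
have /= h := hM _ M1 x (@subset_closure V3 [set y | phi y != 0] x px).
by have := le_trans xM h; lra.
Qed.

Lemma test_measurable phi : test_function Omega phi -> measurable_fun Omega phi.
Proof.
by move=> tp; apply: continuous_measurable3 => //; exact: test_continuous.
Qed.

Lemma test_mul_integrable phi psi : test_function Omega phi ->
  test_function Omega psi ->
  leb3.-integrable setT (EFin \o (fun x => phi x * psi x)).
Proof.
move=> tp ts; have [M M0 hM] := test_bound tp.
have c : continuous (fun x : V3 => phi x * psi x).
  move=> x; apply: continuousM; first exact: test_continuous.
  exact: test_continuous.
have [B hB] := bounded_of_support c (M := M) (fun x xM =>
  etrans (congr1 ( *%R ^~ (psi x)) (hM x (ltW xM))) (mul0r _)).
apply: (@bounded_support_integrable _ _ _ leb3 (cube 0 M) _ B) => //.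
- exact: measurable_cube.
- by rewrite leb3_cube ?(ltW M0) // ltry.
- exact: continuous_measurable3.
- move=> x nx; rewrite hM ?mul0r // leNgt; apply/negP => xM; apply: nx.
  by rewrite cubeE -ball_normE /= sub0r normrN.
Qed.

Lemma integral_test_mulT phi psi : test_function Omega phi ->
  \int[leb3]_(x in Omega) (phi x * psi x) = \int[leb3]_x (phi x * psi x).
Proof.
move=> tp; rewrite Rintegral_mkcond; apply: eq_Rintegral => x _.
rewrite /patch; case: ifPn => //; rewrite notin_setE /= => nO.
have [->|p0] := eqVneq (phi x) 0; first by rewrite mul0r.
by exfalso; apply: nO; exact: test_support p0.
Qed.

(** The integral of the partial derivative of the product phi psi is zero. *)
Lemma integral_by_parts phi psi i : test_function Omega phi ->
  test_function Omega psi ->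
  \int[leb3]_(x in Omega) (partial i phi x * psi x) =
  - \int[leb3]_(x in Omega) (phi x * partial i psi x).
Proof.
move=> tp ts; rewrite !integral_test_mulT //; last exact: test_partial.
apply/eqP; rewrite -subr_eq0 opprK; apply/eqP.
have [dp ds] := (test_partial i tp, test_partial i ts).
rewrite -RintegralD //; try exact: test_mul_integrable.
have [M M0 hM] := test_bound tp; have [M' M'0 hM'] := test_bound dp.
have E : partial i (fun x => phi x * psi x) =
    fun x => partial i phi x * psi x + phi x * partial i psi x.
  apply/funext => x; rewrite /partial.
  have := deriveM (@test_derivable phi i x tp) (@test_derivable psi i x ts).
  by rewrite /GRing.scale /= addrC [psi x * _]mulrC => <-.
have := @integral_partial0 R (fun x => phi x * psi x) i (M + M').
rewrite E /Rintegral => ->; rewrite ?addr_gt0 //.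
- by move=> x; apply: derivableM; exact: test_derivable.
- move=> x; apply: (@continuousD _ _ V3 (fun x => partial i phi x * psi x)
    (fun x => phi x * partial i psi x)); apply: continuousM;
    exact: test_continuous.
- by move=> x xM; rewrite hM ?mul0r //; apply: le_trans xM; rewrite lerDl ltW.
- move=> x xM; rewrite hM ?mul0r ?addr0; last by apply: le_trans xM; rewrite lerDl ltW.
  by rewrite hM' ?mul0r //; apply: le_trans xM; rewrite lerDr ltW.
Qed.

Lemma test_field_curl Phi : test_field Omega Phi ->
  test_field Omega (classical_curl Phi).
Proof.
move=> tP k; have -> : (fun x => classical_curl Phi x k 0) = fun x =>
    partial (k + 1) (fun y => Phi y (k + 1 + 1) 0) x -
    partial (k + 1 + 1) (fun y => Phi y (k + 1) 0) x.
  by apply/funext => x; rewrite mxE.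
by apply: test_sub; apply: test_partial; exact: tP.
Qed.

Lemma test_field_grad phi : test_function Omega phi ->
  test_field Omega (classical_grad phi).
Proof.
move=> tp k; have -> : (fun x => classical_grad phi x k 0) = partial k phi.
  by apply/funext => x; rewrite mxE.
exact: test_partial.
Qed.

Lemma curl_grad phi : test_function Omega phi ->
  classical_curl (classical_grad phi) = fun=> 0.
Proof.
move=> tp; apply/funext => x; apply/matrixP => k l; rewrite !mxE.
have E j : (fun y => classical_grad phi y j 0) = partial j phi.
  by apply/funext => y; rewrite mxE.
rewrite !E; apply/eqP; rewrite subr_eq0; apply/eqP; apply: partial_comm.
- by move=> j y; exact: test_derivable.
- by move=> j m y; apply: test_derivable; exact: test_partial.
- by move=> j m; apply: test_continuous; do 2 apply: test_partial.
Qed.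

Lemma cmx0 : cmx (0 : 'cV[R]_3) = 0.
Proof. by apply/matrixP => k l; rewrite !mxE; apply: complex_eq. Qed.

Lemma csq_real (r : R) : csq r%:C = r ^+ 2.
Proof. by rewrite /csq /= expr0n addr0. Qed.

Lemma L2_test Phi : test_field Omega Phi -> L2 Omega (fun x => cmx (Phi x)).
Proof.
move=> tP; apply/(L2P mO); split.
  move=> k; split; under eq_fun do rewrite mxE /=; last exact: measurable_cst.
  exact: test_measurable.
have -> : (EFin \o (fun x => normsq (cmx (Phi x)))) =
    fun x => (\sum_(k < 3) (Phi x k 0%R * Phi x k 0%R)%:E)%E.
  apply/funext => x; rewrite sumEFin /= normsq_csq; congr EFin.
  by apply: eq_bigr => k _; rewrite mxE csq_real expr2.
apply: integrable_sum => // k _.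
by apply: (integrableS measurableT) => //; exact: test_mul_integrable.
Qed.

Lemma sum3 (F : 'I_3 -> R) : \sum_k F k = F ord0 + F (lift ord0 ord0) +
  F (lift ord0 (lift ord0 ord0)).
Proof. by rewrite !big_ord_recl big_ord0 addr0 addrA. Qed.

Lemma Rintegral_sum3 (F : 'I_3 -> R3 R -> R) :
  (forall k, leb3.-integrable Omega (EFin \o F k)) ->
  \int[leb3]_(x in Omega) \sum_k F k x = \sum_k \int[leb3]_(x in Omega) F k x.
Proof.
move=> iF; under eq_Rintegral do rewrite sum3.
rewrite sum3 RintegralD //; first by rewrite RintegralD.
exact: intD.
Qed.

Lemma pairing_test Phi Psi : test_field Omega Phi -> test_field Omega Psi ->
  pairing Omega (fun x => cmx (Phi x)) (fun x => cmx (Psi x)) =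
  (\sum_(k < 3) \int[leb3]_(x in Omega) (Phi x k 0 * Psi x k 0))%:C.
Proof.
move=> tP tS.
have E x : \sum_(k < 3) cmx (Phi x) k 0 * cmx (Psi x) k 0 =
    (\sum_(k < 3) Phi x k 0 * Psi x k 0)%:C.
  by rewrite rmorph_sum; apply: eq_bigr => k _; rewrite !mxE -rmorphM.
apply: complex_eq; rewrite /pairing /cintegral /=.
  under eq_Rintegral do rewrite E.
  rewrite /= Rintegral_sum3 // => k.
  by apply: (integrableS measurableT) => //; exact: test_mul_integrable.
under eq_Rintegral do rewrite E.
by rewrite /= Rintegral_cst // mul0r.
Qed.

Lemma sum_shift (F : 'I_3 -> R) : \sum_k F k = \sum_k F (k + 1).
Proof. by rewrite (reindex_inj (addIr 1)). Qed.

Lemma ord3E k : k + 1 + 1 + 1 = k :> 'I_3.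
Proof. by apply/val_inj; case: k => -[|[|[|]]]. Qed.

(** Integrating each component by parts gives two cyclic sums, which agree after
    a shift of the summation index modulo 3. *)
Lemma pairing_curl_test Phi Psi : test_field Omega Phi -> test_field Omega Psi ->
  pairing Omega (fun x => cmx (classical_curl Phi x)) (fun x => cmx (Psi x)) =
  pairing Omega (fun x => cmx (Phi x)) (fun x => cmx (classical_curl Psi x)).
Proof.
move=> tP tS; rewrite !pairing_test //; try exact: test_field_curl.
congr (_ %:C).
pose A i j l := \int[leb3]_(x in Omega) (Phi x j 0 * partial i (fun y => Psi y l 0) x).
have iPS i j l : leb3.-integrable Omega
    (EFin \o (fun x => Phi x j 0 * partial i (fun y => Psi y l 0) x)).
  apply: (integrableS measurableT) => //; apply: test_mul_integrable; first exact: tP.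
  by apply: test_partial; exact: tS.
have iSP i j l : leb3.-integrable Omega
    (EFin \o (fun x => partial i (fun y => Phi y j 0) x * Psi x l 0)).
  apply: (integrableS measurableT) => //; apply: test_mul_integrable; last exact: tS.
  by apply: test_partial; exact: tP.
have L k : \int[leb3]_(x in Omega) (classical_curl Phi x k 0 * Psi x k 0) =
    A (k + 1 + 1) (k + 1) k - A (k + 1) (k + 1 + 1) k.
  under eq_Rintegral do rewrite mxE mulrBl.
  rewrite RintegralB // !integral_by_parts //; try exact: tP; try exact: tS.
  by rewrite opprK addrC.
have RR k : \int[leb3]_(x in Omega) (Phi x k 0 * classical_curl Psi x k 0) =
    A (k + 1) k (k + 1 + 1) - A (k + 1 + 1) k (k + 1).
  under eq_Rintegral do rewrite mxE mulrBr.
  by rewrite RintegralB.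
apply: etrans (eq_bigr _ (fun k _ => L k)) _.
apply: esym; apply: etrans (eq_bigr _ (fun k _ => RR k)) _; apply: esym.
clear L RR iPS iSP; move: A => A; rewrite !sumrB; congr (_ - _).
  by rewrite sum_shift sum_shift; apply: eq_bigr => k _; rewrite !ord3E.
by rewrite sum_shift; apply: eq_bigr => k _; rewrite !ord3E.
Qed.

End TestFunctions.

(** * curl and curl0 as an adjoint pair *)

Section CurlPair.
Context {R : realType} (Omega : set (R3 R)) (oO : open Omega).

Let mO : measurable Omega := open_measurable3 oO.
Local Notation V := (L2fun mO).
Local Notation dot := (@dot2 R Omega mO).
Implicit Types (U W C D : V).

Definition T0 U C := curl0 Omega (val U) (val C).
Definition T1 U C := curl Omega (val U) (val C).
Definition gradients : set V := [set U | exists phi, test_function Omega phi /\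
  val U = (fun x => cmx (classical_grad phi x))].

Definition cj U : V := mkL2 mO (L2_conj mO (L2funP U)).

Lemma conj_cmx (Phi : R3 R -> 'cV[R]_3) :
  conjv (fun x => cmx (Phi x)) = (fun x => cmx (Phi x)).
Proof.
apply/funext => x; apply/matrixP => k j; rewrite !mxE.
by apply: complex_eq; rewrite //= oppr0.
Qed.

Definition testL2 Phi (tP : test_field Omega Phi) : V :=
  mkL2 mO (L2_test oO tP).

Lemma dot_test U Phi (tP : test_field Omega Phi) :
  dot U (testL2 tP) = pairing Omega (val U) (fun x => cmx (Phi x)).
Proof. by rewrite /dot2 /dotf conj_cmx. Qed.

Lemma dot_cj U W : dot U (cj W) = pairing Omega (val U) (val W).
Proof. by rewrite /dot2 /dotf /= conjvK. Qed.

(** Test fields are real. *)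
Lemma curl_conj u w : curl Omega u w -> curl Omega (conjv u) (conjv w).
Proof.
move=> [Lu Lw h]; split; [exact: L2_conj|exact: L2_conj|].
move=> Phi tP; have tC := test_field_curl tP.
rewrite -(conj_cmx Phi) -(conj_cmx (classical_curl Phi)).
by rewrite !(pairing_conj mO) ?h //; exact: (L2_test oO).
Qed.

Lemma T1_test Phi (tP : test_field Omega Phi) :
  T1 (testL2 tP) (testL2 (test_field_curl tP)).
Proof.
split; [exact: (L2funP (testL2 _))|exact: (L2funP (testL2 (test_field_curl tP)))|].
by move=> Psi tS; exact: pairing_curl_test.
Qed.

(** The defining identity of the weak curl, read from the other side. *)
Lemma T0_test Phi (tP : test_field Omega Phi) :
  T0 (testL2 tP) (testL2 (test_field_curl tP)).
Proof.
split; first exact: T1_test.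
move=> v cv [Lv Lcv h]; rewrite /tangential_trace /=.
by rewrite pairingC -h // pairingC subrr.
Qed.

(** The trace vanishes on all of the domain of curl; conjugating the second
    field passes from the bilinear pairing to the inner product. *)
Lemma T0P U C : T0 U C <-> (forall W D, T1 W D -> dot C W = dot U D).
Proof.
split=> [[cU tU] W D WD|h].
  have := tU _ _ (curl_conj WD); rewrite /tangential_trace => /eqP.
  by rewrite subr_eq0 => /eqP.
split.
  split; [exact: L2funP|exact: L2funP|move=> Phi tP].
  by rewrite -(dot_test C tP) -(dot_test U (test_field_curl tP)); apply/h/T1_test.
move=> v cv cvv; have [Lv Lcv _] := cvv.
rewrite /tangential_trace.
have := h (cj (mkL2 mO Lv)) (cj (mkL2 mO Lcv)) (curl_conj cvv).
by rewrite !dot_cj /= => ->; rewrite subrr.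
Qed.

(** Test fields lie in the domain of curl0, and they already determine curl. *)
Lemma T1P W D : T1 W D <-> (forall U C, T0 U C -> dot D U = dot W C).
Proof.
have hd := semi_inner_dot2 mO.
split=> [WD U C /T0P h|h].
  by rewrite (dotC hd U) (dotC hd C) (h _ _ WD).
split; [exact: L2funP|exact: L2funP|move=> Phi tP].
rewrite -(dot_test D tP) -(dot_test W (test_field_curl tP)).
by apply: h; exact: T0_test.
Qed.

Lemma T0_grad U : gradients U -> T0 U 0.
Proof.
have hd := semi_inner_dot2 mO.
move=> [phi [tp EU]]; apply/T0P => W D [_ _ h].
have tG := test_field_grad tp.
rewrite (dot0l hd) (dotC hd D).
have -> : U = testL2 tG by apply: val_inj.
rewrite dot_test (h _ tG) (curl_grad tp).
rewrite (_ : pairing _ _ _ = 0); first by apply: complex_eq; rewrite //= oppr0.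
rewrite /pairing /cintegral.
have E x : \sum_(k < 3) (val W x) k 0 * cmx (0 : 'cV[R]_3) k 0 = 0.
  by rewrite big1 // => k _; rewrite cmx0 mxE mulr0.
under eq_Rintegral do rewrite E.
under [X in _ +i* X]eq_Rintegral do rewrite E.
by rewrite /= !Rintegral_cst // !mul0r.
Qed.

Lemma curl_pair_L2 : curl_pair dot T0 T1 gradients.
Proof. by split; [exact: T0P|exact: T1P|exact: T0_grad]. Qed.

Lemma divfreeP U : divfree dot gradients U <-> Hdiv0 Omega (val U).
Proof.
split=> [h|[_ h] W [phi [tp EW]]].
  split; first exact: L2funP.
  move=> phi tp; have tG := test_field_grad tp.
  by rewrite -(dot_test U tG); apply: h; exists phi.
have tG := test_field_grad tp.
have -> : W = testL2 tG by apply: val_inj.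
by rewrite dot_test h.
Qed.

Lemma conjugation_L2 : conjugation dot T1 cj.
Proof.
split.
- by move=> U W; apply: val_inj; apply/funext => x; apply/matrixP => k j;
    rewrite !mxE conjcD.
- by move=> a U; apply: val_inj; apply/funext => x; apply/matrixP => k j;
    rewrite !mxE conjcM.
- by move=> U; apply: val_inj; exact: conjvK.
- by move=> U W; exact: (pairing_conj mO (L2funP U) (L2_conj mO (L2funP W))).
- by move=> U W; exact: curl_conj.
Qed.

End CurlPair.

(** * Bump functions and a non-zero curl *)

Section Bump.
Context {R : realType}.
Local Notation V3 := (R * R * R)%type.
Implicit Types (t a b : R) (k n : nat) (i j : 'I_3) (x : V3) (f g : V3 -> R).

(** The derivatives of exp(-1/t) are combinations of the functions
    t^-k exp(-1/t), all extended by zero to t <= 0. *)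
Definition flat k t : R := if 0 < t then t^-1 ^+ k * expR (- t^-1) else 0.

(** The exponential series bounds s^(k+2) by (k+2)! exp s at s = 1/t; the factor
    t^2 gives the derivative zero at the origin. *)
Lemma flat_bound k t : `|flat k t| <= k.+2`!%:R * t ^+ 2.
Proof.
rewrite /flat; case: ifPn => t0; last by rewrite normr0 mulr_ge0 ?sqr_ge0.
set s := t^-1; have s0 : 0 < s by rewrite invr_gt0.
rewrite ger0_norm ?mulr_ge0 ?exprn_ge0 ?expR_ge0 ?(ltW s0) //.
have f0 : 0 < k.+2`!%:R :> R by rewrite ltr0n fact_gt0.
have h : s ^+ k.+2 <= k.+2`!%:R * expR s.
  rewrite -ler_pdivrMl // mulrC.
  by apply: le_trans (expR_ge1Dxn k.+1 (ltW s0)); rewrite lerDr.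
have -> : t ^+ 2 = (s ^+ 2)^-1 by rewrite /s exprVn invrK.
rewrite expRN ler_pdivrMr ?expR_gt0 // mulrAC ler_pdivlMr ?exprn_gt0 //.
by rewrite -exprD addn2.
Qed.

Lemma is_derive_flat k t :
  is_derive t 1 (flat k) (- k%:R * flat k.+1 t + flat k.+2 t).
Proof.
have [t0|t0|t0] := ltrgt0P t.
- apply: (@near_eq_is_derive R R R (fun s : R => s^-1 ^+ k * expR (- s^-1))).
    near=> s; rewrite /flat ifT //; near: s; exact: lt_nbhsr.
  have tn : t != 0 by rewrite gt_eqF.
  have dV : is_derive t 1 (fun s : R => s^-1) (- t ^- 2).
    by have := is_deriveV tn (is_derive_id t 1); rewrite /GRing.scale /= mulr1.
  have dX : is_derive t 1 (fun s : R => s^-1 ^+ k)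
      (k%:R * t^-1 ^+ k.-1 * - t ^- 2).
    rewrite (_ : (fun s => _) = (fun s : R => s^-1) ^+ k); last by rewrite exprfctE.
    by apply: is_derive_eq.
  have dE : is_derive t 1 (fun s : R => expR (- s^-1))
      (expR (- t^-1) * t ^- 2).
    have := is_derive1_comp (is_derive_expR _) (is_deriveN dV).
    by rewrite opprK.
  have := is_deriveM dX dE; rewrite /GRing.scale /=; congr (is_derive _ _ _ _).
  rewrite /flat t0 !exprS; case: k {dX} => [|k] /=.
    by rewrite expr0; field.
  by rewrite !exprS; field.
- apply: (@near_eq_is_derive R R R (cst 0)).
    near=> s; rewrite /flat ifN //= -leNgt ltW //; near: s; exact: lt_nbhsl.
  rewrite /flat !ltNge ltW //= mulr0 addr0; exact: is_derive_cst.
- rewrite /flat t0 ltxx mulr0 addr0.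
  have f0 : flat k 0 = 0 by rewrite /flat ltxx.
  have lim : (fun h : R => h^-1 *: ((flat k \o shift 0) (h *: 1) - flat k 0))
      @ 0^' --> (0 : R).
    rewrite f0; apply/cvgr0Pnorm_lt => e e0.
    have C0 : 0 < k.+2`!%:R :> R by rewrite ltr0n fact_gt0.
    near=> h; have hn : h != 0 by near: h; exact: nbhs_dnbhs_neq.
    rewrite /= addr0 subr0 normrM normfV.
    rewrite [_ *: 1]mulr1 ltr_pdivrMl ?normr_gt0 //.
    apply: le_lt_trans (flat_bound k h) _.
    rewrite -real_normK ?num_real // expr2 mulrA mulrC ltr_pM2l ?normr_gt0 //.
    rewrite mulrC -ltr_pdivlMr //; near: h.
    apply: dnbhs0_lt; exact: divr_gt0.
  apply: DeriveDef; first by apply/cvg_ex; exists 0.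
  exact: cvg_lim lim.
Unshelve. all: by end_near. Qed.

Definition coord (j : 'I_3) (x : V3) : R :=
  match val j with 0 => x.1.1 | 1 => x.1.2 | _ => x.2 end.

(** An algebra of functions stable under partial derivatives: all its members
    are smooth as soon as they are differentiable. *)
Inductive elementary : (V3 -> R) -> Prop :=
| elem_cst (c : R) : elementary (fun=> c)
| elem_flat k j (a b : R) : elementary (fun x => flat k (a * coord j x + b))
| elem_add f g : elementary f -> elementary g -> elementary (fun x => f x + g x)
| elem_mul f g : elementary f -> elementary g -> elementary (fun x => f x * g x).

Lemma coord_line i j x t :
  coord j (line i x t) = (i == j)%:R * t + coord j x.
Proof.
case: i j => -[|[|[|//]]] i0 [[|[|[|//]]] j0]; rewrite /coord /line /basis3 /=;
  by rewrite ?mulr1n ?mulr0n /GRing.scale /= ?mulr1 ?mulr0 ?mul1r ?mul0r.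
Qed.

Lemma derive_lineE f i x :
  'D_(basis3 i : V3) f x = 'D_1 (fun t => f (line i x t)) 0.
Proof.
have E : (fun h : R => h^-1 *: ((f \o shift x) (h *: (basis3 i : V3)) - f x)) =
  (fun h : R => h^-1 *:
    (((fun t => f (line i x t)) \o shift 0) (h *: 1) - f (line i x 0))).
  apply/funext => h /=.
  by rewrite /line addr0 scale0r add0r [_ *: 1]mulr1.
by rewrite /derive E.
Qed.

Lemma differentiable_coord3 j x : differentiable (coord j : V3 -> R) x.
Proof.
have dfst (U W : normedModType R) (y : U * W) : differentiable (fst : U * W -> U) y.
  by apply: linear_differentiable => z; exact: cvg_fst.
have dsnd (U W : normedModType R) (y : U * W) : differentiable (snd : U * W -> W) y.
  by apply: linear_differentiable => z; exact: cvg_snd.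
case: j => -[|[|[|//]]] j0; rewrite /coord /=; last exact: dsnd.
  by apply: (@differentiable_comp _ _ _ _ fst fst).
by apply: (@differentiable_comp _ _ _ _ fst snd).
Qed.

Lemma elementary_differentiable f : elementary f ->
  forall x, differentiable f x.
Proof.
elim=> {f} [c|k j a b|f g _ IHf _ IHg|f g _ IHf _ IHg] x.
- exact: differentiable_cst.
- apply: (@differentiable_comp _ _ _ _ (fun x : V3 => a * coord j x + b) (flat k)).
    apply: differentiableD; last exact: differentiable_cst.
    apply: differentiableM; first exact: differentiable_cst.
    exact: differentiable_coord3.
  by apply/derivable1_diffP; case: (is_derive_flat k (a * coord j x + b)).
- exact: differentiableD.
- exact: differentiableM.
Qed.

Lemma elementary_partial f i : elementary f -> elementary (partial i f).
Proof.
elim=> {f} [c|k j a b|f g ef IHf eg IHg|f g ef IHf eg IHg].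
- rewrite (_ : partial _ _ = fun=> 0); first exact: elem_cst.
  by apply/funext => x; rewrite /partial derive_cst.
- rewrite (_ : partial _ _ = fun x => (- k%:R * flat k.+1 (a * coord j x + b) +
      flat k.+2 (a * coord j x + b)) * (a * (i == j)%:R)).
    apply: elem_mul; last exact: elem_cst.
    apply: elem_add; last exact: elem_flat.
    by apply: elem_mul; [exact: elem_cst|exact: elem_flat].
  apply/funext => x; rewrite /partial derive_lineE.
  pose c := a * (i == j)%:R; pose d := a * coord j x + b.
  rewrite (_ : (fun t => _) = flat k \o (fun t => c * t + d)); last first.
    by apply/funext => t /=; rewrite coord_line /c /d; congr (flat k _); ring.
  have dl : is_derive (0 : R) (1 : R) (fun t : R => c * t + d) c.
    have := is_deriveD (is_deriveZ c (is_derive_id (0 : R) (1 : R))) (is_derive_cst d (0 : R) (1 : R)).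
    by rewrite /GRing.scale /= mulr1 addr0.
  have dF : is_derive (c * 0 + d) 1 (flat k)
    (- k%:R * flat k.+1 d + flat k.+2 d).
    by rewrite mulr0 add0r; exact: is_derive_flat.
  by have [_ ->] := @is_derive1_comp _ (flat k) (fun t : R => c * t + d) 0 _ _ dF dl.
- rewrite (_ : partial _ _ = fun x => partial i f x + partial i g x).
    exact: elem_add.
  apply/funext => x; rewrite /partial.
  by have := deriveD (diff_derivable (elementary_differentiable ef x))
    (diff_derivable (elementary_differentiable eg x)).
- rewrite (_ : partial _ _ = fun x => f x * partial i g x + g x * partial i f x).
    by apply: elem_add; exact: elem_mul.
  apply/funext => x; rewrite /partial.
  by have := deriveM (diff_derivable (elementary_differentiable ef x))
    (diff_derivable (elementary_differentiable eg x)).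
Qed.

Lemma elementary_smooth f : elementary f -> smooth f.
Proof.
move=> ef n; elim: n f ef => [|n IH] f ef /=.
  by move=> x; apply: differentiable_continuous; exact: elementary_differentiable.
split=> [i x|i]; last by apply: IH; exact: elementary_partial.
by apply: diff_derivable; exact: elementary_differentiable.
Qed.

(** Written so that both factors are literally of the form elem_flat. *)
Definition bump1 (j : 'I_3) (c : V3) (r : R) x : R :=
  flat 0 (1 * coord j x + (r - coord j c)) *
  flat 0 (-1 * coord j x + (coord j c + r)).

Definition bump (c : V3) (r : R) x : R :=
  bump1 ord0 c r x * bump1 (inord 1) c r x * bump1 (inord 2) c r x.

Lemma elementary_bump c r : elementary (bump c r).
Proof.
by rewrite /bump /bump1; apply: elem_mul; [apply: elem_mul|];
  apply: elem_mul; exact: elem_flat.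
Qed.

Lemma flat0_eq0 t : (flat 0 t == 0) = (t <= 0).
Proof.
rewrite /flat expr0 mul1r; case: ltP => t0; last by rewrite eqxx.
by rewrite gt_eqF // expR_gt0.
Qed.

Lemma bump1_neq0 j c r x :
  (bump1 j c r x != 0) = (`|coord j x - coord j c| < r).
Proof.
rewrite /bump1 mulf_eq0 negb_or !flat0_eq0 -!ltNge ltr_norml.
by apply/andP/andP => -[h1 h2]; split; lra.
Qed.

Lemma bump_neq0 c r x : bump c r x != 0 <-> cube c r x.
Proof.
rewrite /bump mulf_eq0 [X in X || _]mulf_eq0 !negb_or !bump1_neq0 /coord /= !inordK //=.
rewrite /cube; split=> [/andP[/andP[h1 h2] h3]|[[h1 h2] h3]].
  by split; [split|]; rewrite /= -ball_normE /= distrC.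
by move: h1 h2 h3; rewrite /= -ball_normE /= => h1 h2 h3;
  rewrite distrC h1 distrC h2 distrC h3.
Qed.

Lemma test_bump (Omega : set (R3 R)) (c : V3) : open Omega -> Omega c ->
  exists2 r, 0 < r & test_function Omega (bump c r).
Proof.
move=> oO Oc; have /nbhs_ballP[e /= e0 he] : nbhs c Omega.
  exact: open_nbhs_nbhs.
exists (e / 2); first by rewrite divr_gt0.
pose I (a : R) : set R := `[a - e / 2, a + e / 2]%classic.
pose K : set V3 := (I c.1.1 `*` I c.1.2) `*` I c.2.
have cK : compact K.
  by apply: compact_setX; [apply: compact_setX|]; exact: segment_compact.
have sK : closure [set x : V3 | bump c (e / 2) x != 0] `<=` K.
  rewrite [X in _ `<=` X](closure_id _).1; last first.
    by apply: compact_closed => //; exact: norm_hausdorff.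
  apply: closureS => x /= /bump_neq0[[h1 h2] h3].
  by split; [split|]; rewrite /I /= in_itv /=;
    move: h1 h2 h3; rewrite /= -!ball_normE /= !ltr_norml
      => /andP[? ?] /andP[? ?] /andP[? ?]; apply/andP; split; lra.
split.
- exact: elementary_smooth (elementary_bump c _).
- by apply: subclosed_compact sK; first exact: closed_closure.
- apply: subset_trans sK _ => x [[]]; rewrite /I /= !in_itv /= => h1 h2 h3.
  apply: he; split; [split|]; rewrite /= -ball_normE /= ltr_norml;
    move: h1 h2 h3 => /andP[? ?] /andP[? ?] /andP[? ?]; apply/andP; split; lra.
Qed.

End Bump.

Section NonzeroCurl.
Context {R : realType} (Omega : set (R3 R)) (oO : open Omega).
Hypothesis O0 : Omega !=set0.
Local Notation V3 := (R * R * R)%type.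

Let mO : measurable Omega := open_measurable3 oO.

(** The curl of (0, 0, phi) has first component the derivative of the bump phi
    along the second axis, which the mean value theorem makes non-zero
    somewhere, hence on an open set. *)
Lemma nonzero_curl : exists u c d : L2fun mO,
  [/\ T0 u c, T1 c d & sqn (@dot2 R Omega mO) c != 0].
Proof.
have [p Op] := O0; have [r r0 tb] := test_bump (c := p) oO Op.
set phi := bump p r in tb.
(* The zero components are written phi - phi, a test function because phi is. *)
pose Phi x : 'cV[R]_3 := \col_k (if k == inord 2 then phi x else phi x - phi x).
have tP : test_field Omega Phi.
  move=> k; have [k2|k2] := boolP (k == inord 2).
    by rewrite (_ : (fun x => _) = phi) //; apply/funext => x; rewrite mxE k2.
  rewrite (_ : (fun x => _) = fun x => phi x - phi x); first exact: test_sub.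
  by apply/funext => x; rewrite mxE (negbTE k2).
pose tC := test_field_curl tP.
exists (testL2 oO tP), (testL2 oO tC), (testL2 oO (test_field_curl tC)).
split; [exact: T0_test|exact: T1_test|].
have E x : classical_curl Phi x ord0 0 = partial (inord 1) phi x.
  rewrite mxE (_ : ord0 + 1 = inord 1); last by apply/val_inj; rewrite /= inordK.
  rewrite (_ : inord 1 + 1 = inord 2); last by apply/val_inj; rewrite /= !inordK.
  rewrite (_ : (fun y => Phi y (inord 2) 0) = phi); last first.
    by apply/funext => y; rewrite mxE eqxx.
  rewrite (_ : (fun y => Phi y (inord 1) 0) = fun y => phi y - phi y); last first.
    by apply/funext => y; rewrite mxE -val_eqE /= !inordK.
  rewrite [X in _ - X](_ : _ = 0) ?subr0 // (_ : (fun y => _) = cst 0).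
    by rewrite /partial derive_cst.
  by apply/funext => y; rewrite subrr.
have [q pq] : exists q : V3, partial (inord 1) phi q != 0.
  have [|c /andP[c0 cr] Ec] := mvt_line (F := phi) (i := inord 1) p r0.
    by move=> x; exact: test_derivable tb.
  exists (line (inord 1) p c); apply/eqP => h.
  have l0 : phi (line (inord 1) p r) = 0.
    have b0 : bump1 (inord 1) p r (line (inord 1) p r) = 0.
      apply/eqP; rewrite -[_ == 0]negbK bump1_neq0 coord_line eqxx mul1r addrK.
      by rewrite gtr0_norm // ltxx.
    by rewrite /phi /bump b0 mulr0 mul0r.
  move: Ec; rewrite h mulr0 l0 sub0r => /eqP; rewrite oppr_eq0; apply/negP.
  apply/bump_neq0; split; [split|]; rewrite /= -ball_normE /= subrr normr0 //.
apply/eqP; rewrite sqn_dot2 => /(int_normsq_eq0 mO (L2funP _)) ae0.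
pose U : set (R3 R) := [set x | partial (inord 1) phi x != 0].
have oU : open U.
  have := @open_comp V3 R (partial (inord 1) phi : V3 -> R) [set y | y != 0].
  apply; last exact: open_neq.
  by move=> x _; exact: (test_continuous (test_partial (inord 1) tb)).
have : (0 < leb3 U)%E by apply: leb3_open_gt0 => //; exists q.
have [N [mN N0 hN]] := ae0.
rewrite lt0e => /andP[/eqP U0 _]; apply: U0.
apply: (@subset_measure0 _ _ _ leb3 U N) => //; first exact: open_measurable3.
move=> x Ux; apply: hN => /= h.
have Ox : Omega x by exact: (test_support (test_partial (inord 1) tb) Ux).
have re_cmx (M : 'cV[R]_3) : complex.Re (cmx M ord0 0) = M ord0 0 by rewrite mxE.
case/negP: Ux; apply/eqP; rewrite -E -re_cmx.
have -> : cmx (classical_curl Phi x) = 0 by exact: h Ox.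
by rewrite mxE.
Qed.
End NonzeroCurl.

(** * Matrix coefficients as operators *)

Section AeIntegral.
Context {R : realType} (Omega : set (R3 R)) (mO : measurable Omega).

Lemma ae_le_Rintegral (f g : R3 R -> R) :
  leb3.-integrable Omega (EFin \o f) -> leb3.-integrable Omega (EFin \o g) ->
  {ae leb3, forall x, Omega x -> f x <= g x} ->
  \int[leb3]_(x in Omega) f x <= \int[leb3]_(x in Omega) g x.
Proof.
move=> fi gi [N [mN N0 hN]]; rewrite /Rintegral.
rewrite (negligible_integral mN mO fi N0) (negligible_integral mN mO gi N0).
have sub : Omega `\` N `<=` Omega by move=> x [].
have mD : measurable (Omega `\` N) by exact: measurableD.
apply: le_Rintegral => //; [exact: integrableS fi|exact: integrableS gi|].
move=> x [Ox Nx]; apply: contrapT => h; apply: Nx; apply: hN => /=.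
by move=> /(_ Ox).
Qed.

Lemma ae_eq_Rintegral (f g : R3 R -> R) :
  leb3.-integrable Omega (EFin \o f) -> leb3.-integrable Omega (EFin \o g) ->
  {ae leb3, forall x, Omega x -> f x = g x} ->
  \int[leb3]_(x in Omega) f x = \int[leb3]_(x in Omega) g x.
Proof.
move=> fi gi fg; apply: le_anti; apply/andP; split;
  apply: ae_le_Rintegral => //; apply: filterS fg => x h Ox; by rewrite h.
Qed.

Lemma ae_eq_cintegral (f g : R3 R -> R[i]) :
  cintegrable Omega f -> cintegrable Omega g ->
  {ae leb3, forall x, Omega x -> f x = g x} ->
  cintegral Omega f = cintegral Omega g.
Proof.
move=> [f1 f2] [g1 g2] fg; congr (_ +i* _); apply: ae_eq_Rintegral => //;
  apply: filterS fg => x h Ox; by rewrite h.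
Qed.
End AeIntegral.

Section Coefficients.
Context {R : realType} (Omega : set (R3 R)) (mO : measurable Omega).
Implicit Types (A : mfield R) (u v : vfield R).

Definition mulf A u : vfield R := fun x => cmx (A x) *m u x.

Lemma mulfE A u x k :
  mulf A u x k 0 = \sum_l (A x k l)%:C * u x l 0.
Proof. by rewrite /mulf mxE; apply: eq_bigr => l _; rewrite mxE. Qed.

Lemma re_mulf A u x k :
  complex.Re (mulf A u x k 0) = \sum_l A x k l * complex.Re (u x l 0).
Proof.
rewrite mulfE re_sum; apply: eq_bigr => l _.
by rewrite reM /= mul0r subr0.
Qed.

Lemma im_mulf A u x k :
  complex.Im (mulf A u x k 0) = \sum_l A x k l * complex.Im (u x l 0).
Proof.
rewrite mulfE im_sum; apply: eq_bigr => l _.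
by rewrite imM /= mul0r addr0.
Qed.

Lemma sqr_sum3 (F : 'I_3 -> R) : (\sum_k F k) ^+ 2 <= 3 * \sum_k F k ^+ 2.
Proof.
rewrite !sum3; set a := F _; set b := F _; set c := F _.
have := sqr_ge0 (a - b); have := sqr_ge0 (b - c); have := sqr_ge0 (a - c); nra.
Qed.

Lemma normsq_mulf A u x (B : R) : (forall i j, `|A x i j| <= B) ->
  normsq (mulf A u x) <= 9 * B ^+ 2 * normsq (u x).
Proof.
move=> hA.
have b (r : 'I_3 -> R) k : (\sum_l A x k l * r l) ^+ 2 <=
    3 * (B ^+ 2 * \sum_l r l ^+ 2).
  apply: le_trans (sqr_sum3 _) _; rewrite ler_wpM2l // mulr_sumr.
  apply: ler_sum => l _; rewrite exprMn ler_wpM2r ?sqr_ge0 //.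
  rewrite -[A x k l ^+ 2]real_normK ?num_real // ler_pXn2r ?nnegrE //.
  exact: le_trans (hA k l).
have c k : csq (mulf A u x k 0) <= 3 * (B ^+ 2 * normsq (u x)).
  rewrite /csq re_mulf im_mulf; apply: le_trans (lerD (b _ _) (b _ _)) _.
  by rewrite -mulrDr -mulrDr -big_split.
rewrite normsq_csq; apply: le_trans (ler_sum _ (fun k _ => c k)) _.
by rewrite sum3; set z := B ^+ 2 * _; rewrite -mulrA -/z; lra.
Qed.

Lemma measurable_mulf A u : (forall i j, measurable_fun Omega (fun x => A x i j : R)) ->
  measurable_field Omega u -> measurable_field Omega (mulf A u).
Proof.
move=> mA mu k; split.
  under eq_fun do rewrite re_mulf.
  by apply: measurable_sum => l; apply: measurable_funM => //; case: (mu l).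
under eq_fun do rewrite im_mulf.
by apply: measurable_sum => l; apply: measurable_funM => //; case: (mu l).
Qed.

Lemma L2_mulf A u : bounded_coefficient Omega A -> L2 Omega u ->
  L2 Omega (mulf A u).
Proof.
move=> [mA [B hB] _ _] /(L2P mO)[mu iu].
have mAu := measurable_mulf mA mu; split=> //.
have iB := intZ mO (9 * B ^+ 2) iu.
apply: le_lt_trans (integrable_lty mO iB).
apply: ae_ge0_le_integral => //.
- by move=> x _; rewrite lee_fin normsq_ge0.
- by apply/measurable_EFinP; exact: measurable_normsq mAu.
- by move=> x _; rewrite lee_fin mulr_ge0 ?normsq_ge0 // mulr_ge0 ?sqr_ge0.
- exact: measurable_int iB.
- apply: filterS hB => x h Ox; rewrite lee_fin.
  by apply: normsq_mulf; exact: h.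
Qed.

Definition opA A (hA : bounded_coefficient Omega A) (U : L2fun mO) : L2fun mO :=
  mkL2 mO (L2_mulf hA (L2funP U)).

Definition rform (M : 'M[R]_3) (b : 'cV[R]_3) : R := (b^T *m M *m b) 0 0.

Lemma rformE M b : rform M b = \sum_k (\sum_l M k l * b l 0) * b k 0.
Proof.
rewrite /rform -mulmxA mxE; apply: eq_bigr => k _.
by rewrite !mxE mulrC.
Qed.

(** Homogeneity extends the bounds from unit vectors. *)
Lemma rform_bounds (M : 'M[R]_3) (lo hi : R) :
  (forall eta : 'cV[R]_3, (eta^T *m eta) 0 0 = 1 -> lo <= rform M eta <= hi) ->
  forall b : 'cV[R]_3, lo * (\sum_k b k 0 ^+ 2) <= rform M b <=
    hi * (\sum_k b k 0 ^+ 2).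
Proof.
move=> h b; set n := \sum_k _.
have n0 : 0 <= n by apply: sumr_ge0 => k _; exact: sqr_ge0.
have [n_eq0|n_neq0] := eqVneq n 0.
  have b0 : b = 0.
    apply/matrixP => k l; rewrite (ord1 l) mxE; apply/eqP.
    have /eqP := n_eq0; rewrite psumr_eq0; last by move=> *; exact: sqr_ge0.
    by move/allP/(_ k (mem_index_enum _)); rewrite /= sqrf_eq0.
  by rewrite n_eq0 !mulr0 rformE b0 big1 ?lexx // => k _; rewrite mxE mulr0.
have np : 0 < n by rewrite lt0r n_neq0.
pose s := Num.sqrt n; have s0 : 0 < s by rewrite sqrtr_gt0.
have s2 : s ^+ 2 = n by rewrite sqr_sqrtr.
have := h (s^-1 *: b).
have -> : ((s^-1 *: b)^T *m (s^-1 *: b)) 0 0 = 1.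
  rewrite mxE (eq_bigr (fun k => n^-1 * b k 0 ^+ 2)).
    by rewrite -mulr_sumr mulVf.
  by move=> k _; rewrite !mxE mulrACA -!expr2 exprVn s2.
have -> : rform M (s^-1 *: b) = rform M b / n.
  rewrite !rformE mulr_suml; apply: eq_bigr => k _; rewrite mxE.
  under eq_bigr do rewrite mxE mulrCA.
  by rewrite -mulr_sumr -s2 -exprVn expr2; ring.
by move=> /(_ erefl) /andP[h1 h2]; rewrite -ler_pdivlMr // h1 -ler_pdivrMr.
Qed.

(** For a real matrix, the real part of the Hermitian form is the sum of the
    quadratic forms at the real and at the imaginary part. *)
Lemma re_pairing_form A u x :
  complex.Re (\sum_k mulf A u x k 0 * conjv u x k 0) =
  rform (A x) (\col_k complex.Re (u x k 0)) +
  rform (A x) (\col_k complex.Im (u x k 0)).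
Proof.
rewrite re_sum !rformE -big_split; apply: eq_bigr => k _ /=.
rewrite conjvE reM re_mulf im_mulf reJ imJ mulrN opprK !mxE.
by congr (_ * _ + _ * _); apply: eq_bigr => l _; rewrite mxE.
Qed.

Lemma normsq_split (b : 'cV[R[i]]_3) : normsq b =
  \sum_k (\col_k complex.Re (b k 0) : 'cV[R]_3) k 0 ^+ 2 +
  \sum_k (\col_k complex.Im (b k 0) : 'cV[R]_3) k 0 ^+ 2.
Proof.
by rewrite /normsq -big_split; apply: eq_bigr => k _; rewrite !mxE.
Qed.

Lemma mulf_conj A u : mulf A (conjv u) = conjv (mulf A u).
Proof.
apply/funext => x; apply/matrixP => k l; rewrite (ord1 l) conjvE.
apply: complex_eq; rewrite ?reJ ?imJ ?re_mulf ?im_mulf.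
  by apply: eq_bigr => j _; rewrite conjvE reJ.
by rewrite -sumrN; apply: eq_bigr => j _; rewrite conjvE imJ mulrN.
Qed.

End Coefficients.

Section CoefficientOperators.
Context {R : realType} (Omega : set (R3 R)) (oO : open Omega).

Let mO : measurable Omega := open_measurable3 oO.

Lemma coefficient_opA (A : mfield R) lo hi (hA : bounded_coefficient Omega A)
    (hb : form_bounds Omega A lo hi) :
  coefficient (@dot2 R Omega mO) (@cj R Omega oO) (@opA R Omega mO A hA) lo hi.
Proof.
have iQ (U : L2fun mO) : cintegrable Omega
    (fun x => \sum_k mulf A (val U) x k 0 * conjv (val U) x k 0).
  by apply: pairing_integrable => //; [exact: (L2_mulf mO hA (L2funP U))|exact: (L2_conj mO (L2funP U))].
have iN (U : L2fun mO) : leb3.-integrable Omega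
    (EFin \o (fun x => normsq (val U x))).
  by have /(L2P mO)[] := L2funP U.
have ab : {ae leb3, forall x, Omega x -> forall b : 'cV[R[i]]_3,
    lo * normsq b <= rform (A x) (\col_k complex.Re (b k 0)) +
      rform (A x) (\col_k complex.Im (b k 0)) <= hi * normsq b}.
  apply: filterS hb => x h Ox b.
  have /andP[r1 r2] := rform_bounds (h Ox) (\col_k complex.Re (b k 0)).
  have /andP[i1 i2] := rform_bounds (h Ox) (\col_k complex.Im (b k 0)).
  by rewrite normsq_split !mulrDr; apply/andP; split; exact: lerD.
split.
- by move=> U W; apply: val_inj; apply/funext => x; exact: mulmxDr.
- by move=> a U; apply: val_inj; apply/funext => x; exact: esym (scalemxAr _ _ _).
- move=> U W; apply: ae_eq_cintegral => //.
  + by apply: pairing_integrable => //; [exact: (L2_mulf mO hA (L2funP U))|exact: (L2_conj mO (L2funP W))].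
  + by apply: pairing_integrable => //; [exact: L2funP|exact: (L2_conj mO (L2_mulf mO hA (L2funP W)))].
  have [_ _ sA _] := hA; apply: filterS sA => x h Ox /=.
  have {}h k l : A x k l = A x l k by rewrite -{1}(h Ox) mxE.
  rewrite -mulf_conj.
  under eq_bigr do rewrite mulfE mulr_suml.
  rewrite exchange_big /=; apply: eq_bigr => k _.
  rewrite mulfE mulr_sumr; apply: eq_bigr => l _.
  by rewrite (h l k) mulrAC mulrC mulrA.
- by move=> U; apply: val_inj; exact: mulf_conj.
- move=> U; rewrite sqn_dot2 -RintegralZl //.
  apply: ae_le_Rintegral => //; [exact: intZ|exact: (iQ U).1|].
  apply: filterS ab => x h Ox.
  by have /andP[+ _] := h Ox (val U x); rewrite -re_pairing_form.
- move=> U; rewrite sqn_dot2 -RintegralZl //.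
  apply: ae_le_Rintegral => //; [exact: (iQ U).1|exact: intZ|].
  apply: filterS ab => x h Ox.
  by have /andP[_] := h Ox (val U x); rewrite -re_pairing_form.
Qed.

End CoefficientOperators.

(** * From fields to vectors of the Hilbert space *)

Section SpectrumTransfer.
Context {R : realType} {E E' : Type}.
Variables (K : set E) (eqE : E -> E -> Prop) (nrm : E -> R)
  (T : R[i] -> E -> E -> Prop).
Variables (K' : set E') (eqE' : E' -> E' -> Prop) (nrm' : E' -> R)
  (T' : R[i] -> E' -> E' -> Prop).
Variable i : E' -> E.

Hypotheses (K_lift : forall f, K f -> exists2 f', K' f' & i f' = f)
  (K_img : forall f', K' f' -> K (i f'))
  (T_lift : forall z u f, T z u f -> exists u', i u' = u)
  (iE : forall u v, eqE (i u) (i v) <-> eqE' u v)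
  (iN : forall u, nrm (i u) = nrm' u)
  (iT : forall z u f, T z (i u) (i f) <-> T' z u f).

(** Spectra agree along a map that preserves and reflects the equivalence, the
    norm and the operators, and that reaches all of the space and all of the
    domains. *)
Lemma spectrum_transfer : spectrum K eqE nrm T = spectrum K' eqE' nrm' T'.
Proof.
congr (~` _); apply/seteqP; split=> z [C hC]; exists C.
  move=> f /K_img /hC[u [uf un uu]]; have [u' Eu] := T_lift uf; subst u.
  exists u'; rewrite -!iN; split=> //; first exact/iT.
  by move=> v /iT /uu /iE.
move=> _ /K_lift[f Kf <-]; have [u [uf un uu]] := hC f Kf.
exists (i u); rewrite !iN; split=> //; first exact/iT.
by move=> v vf; have [v' Ev] := T_lift vf; subst v; apply/iE/uu/iT.
Qed.
End SpectrumTransfer.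

Section Translation.
Context {R : realType} (Omega : set (R3 R)) (oO : open Omega).

Let mO : measurable Omega := open_measurable3 oO.
Local Notation V := (L2fun mO).
Local Notation dot := (@dot2 R Omega mO).
Local Notation T0 := (@T0 R Omega oO).
Local Notation T1 := (@T1 R Omega oO).
Local Notation G := (@gradients R Omega oO).

Lemma val_lift (u : vfield R) : L2 Omega u -> exists U : V, val U = u.
Proof. by move=> Lu; exists (mkL2 mO Lu). Qed.

Lemma spectrum_curlcurl0E :
  spectrum_curlcurl0 Omega = curlcurl_spectrum dot T0 T1 G.
Proof.
apply: (@spectrum_transfer _ _ _ _ _ _ _ _ _ _ _ (fun U : V => val U)).
- move=> f Hf; have [F EF] := val_lift Hf.1; exists F => //.
  by apply/divfreeP; rewrite EF.
- by move=> F /divfreeP.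
- by move=> z u f [w [Hu _ _] _]; exact: val_lift Hu.1.
- by move=> u v; split=> /null_eqP.
- exact: L2norm_hnorm.
- move=> z U F; split=> [[w [Hu Hw [c cu cw]] e]|[W [/divfreeP Hu /divfreeP Hw [C CU CW]] e]].
    have [_ Lc _] := cu.1; have [W EW] := val_lift Hw.1.
    have [C EC] := val_lift Lc; subst w c.
    exists W; first by split; [exact/divfreeP|exact/divfreeP|exists C].
    exact/null_eqP.
  exists (val W); first by split=> //; exists (val C).
  exact/(null_eqP F (W - z *: U)).
Qed.

Lemma lambda_minE (O0 : Omega !=set0) :
  is_minimum (spectrum_curlcurl0 Omega) (curl_bottom dot T0 G) /\
  lambda_min Omega = curl_bottom dot T0 G.
Proof.
have hd := semi_inner_dot2 mO; have hc := complete_dot2 (mO := mO).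
have hT := curl_pair_L2 oO; have hK := nonzero_curl oO O0.
have hmin := curlcurl_minimum hd hc hT hK.
rewrite spectrum_curlcurl0E; split=> //.
rewrite /lambda_min spectrum_curlcurl0E; set S := [set x | _].
have [Sb lb] := hmin; apply/le_anti/andP; split.
  by apply: ge_inf => //; exists (curl_bottom dot T0 G) => x /lb; rewrite lecR.
by apply: lb_le_inf => [|x /lb]; [exists (curl_bottom dot T0 G)|rewrite lecR].
Qed.

Lemma spectrum_maxwellE (eps mu sigma : mfield R)
    (he : bounded_coefficient Omega eps) (hm : bounded_coefficient Omega mu)
    (hs : bounded_coefficient Omega sigma) :
  spectrum_maxwell Omega eps mu sigma =
  spectrum setT (null_eq (dotp dot dot)) (hnorm (dotp dot dot))
    (mpencil dot T0 T1 (@opA R Omega mO eps he) (@opA R Omega mO mu hm)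
       (@opA R Omega mO sigma hs)).
Proof.
apply: (@spectrum_transfer _ _ _ _ _ _ _ _ _ _ _
  (fun U : V * V => (val U.1, val U.2))).
- move=> [f g] [/= Lf Lg]; have [F <-] := val_lift Lf.
  by have [F' <-] := val_lift Lg; exists (F, F').
- by move=> F _; split; exact: L2funP.
- move=> w [u v] _ [c [d [[[/= Lu _ _] _] [Lv _ _] _]]].
  have [U <-] := val_lift Lu; have [W <-] := val_lift Lv; by exists (U, W).
- move=> [u1 u2] [v1 v2]; rewrite /null_eq sqn_prod /=; split.
    move=> [/= /null_eqP h1 /null_eqP h2].
    by move: h1 h2; rewrite /null_eq => -> ->; rewrite addr0.
  move/eqP; rewrite paddr_eq0 ?sqn_ge0 //; try exact: semi_inner_dot2.
  by move=> /andP[/eqP h1 /eqP h2]; split; apply/null_eqP.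
- move=> [U W]; rewrite /L2pair_norm /= !L2norm_hnorm /hnorm sqn_prod /=.
  by rewrite !sqr_sqrtr ?sqn_ge0 //; exact: semi_inner_dot2.
- move=> w [U W] [F F']; split.
    move=> [c [d [/= cU dW [e1 e2]]]].
    have [_ Lc _] := cU.1; have [_ Ld _] := dW.
    have [C EC] := val_lift Lc; have [D ED] := val_lift Ld; subst c d.
    by exists C, D; split=> //=; exact/null_eqP.
  move=> [C [D [/= CU DW e1 e2]]]; exists (val C), (val D); split=> //.
  by split; [exact: (iffLR (null_eqP _ _) e1)|exact: (iffLR (null_eqP _ _) e2)].
Qed.
End Translation.

(** * The enclosure of the spectrum *)

Theorem theorem2p1 (R : realType) (Omega : set (R3 R))
    (eps mu sigma : mfield R)
    (eps_min eps_max mu_min mu_max sigma_min sigma_max : R)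
    (hOmega : domain Omega) (hLip : lipschitz_boundary Omega)
    (heps : bounded_coefficient Omega eps)
    (hmu : bounded_coefficient Omega mu)
    (hsigma : bounded_coefficient Omega sigma)
    (eps_min_gt0 : 0 < eps_min) (mu_min_gt0 : 0 < mu_min)
    (sigma_min_ge0 : 0 <= sigma_min)
    (eps_bounds : form_bounds Omega eps eps_min eps_max)
    (mu_bounds : form_bounds Omega mu mu_min mu_max)
    (sigma_bounds : form_bounds Omega sigma sigma_min sigma_max) :
  let lam := lambda_min Omega in
  let S := spectrum_maxwell Omega eps mu sigma in
  [/\ is_minimum (spectrum_curlcurl0 Omega) lam /\ 0 <= lam,
      S `<=` imaginary_segment (- (sigma_max / eps_min)) 0 `|`
        [set w : R[i] |
          [/\ ~ imaginary_axis w,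
              - (1 / 2 * (sigma_max / eps_min)) <= complex.Im w
                <= - (1 / 2 * (sigma_min / eps_max)) &
              lam / (eps_max * mu_max) <=
                complex.Re w ^+ 2 - 3 * complex.Im w ^+ 2 +
                2 * (sigma_max / eps_min) * `|complex.Im w|]],
      0 < lam ->
        let r := Num.sqrt (lam / (eps_max * mu_max)) in
        S `&` ([set x%:C | x in `]- r, 0[] `|` [set x%:C | x in `]0, r[]) = set0 &
      1 / 3 * (sigma_max ^+ 2 * eps_max * mu_max / eps_min ^+ 2) < lam ->
        S `&` imaginary_axis `<=` imaginary_segment (- (sigma_max / eps_min)) 0 /\
        exists2 d : R, 0 < d &
          forall z w, (S `&` imaginary_axis) z -> (S `\` imaginary_axis) w ->
            d%:C <= `|z - w|].
Proof.
move=> lam S.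
have [ne0 oO _] := hOmega.
have hd := @semi_inner_dot2 R Omega (open_measurable3 oO).
have hc := @complete_dot2 R Omega (open_measurable3 oO).
have hT := curl_pair_L2 oO; have hK := nonzero_curl oO ne0.
have coefE := coefficient_opA oO heps eps_bounds.
have coefM := coefficient_opA oO hmu mu_bounds.
have coefS := coefficient_opA oO hsigma sigma_bounds.
have [lmin lamE] := lambda_minE oO ne0.
have lam0 : 0 <= lam by rewrite /lam lamE (bottom_ge0 hd hc hT hK).
have emax0 : 0 < eps_max by apply: lt_le_trans eps_min_gt0 (coef_le hd hK coefE).
have mmax0 : 0 < mu_max by apply: lt_le_trans mu_min_gt0 (coef_le hd hK coefM).
have smax0 : 0 <= sigma_max.
  by apply: le_trans sigma_min_ge0 (coef_le hd hK coefS).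
have em0 : 0 < eps_max * mu_max by exact: mulr_gt0.
pose tau := sigma_max / eps_min.
have tau0 : 0 <= tau by rewrite divr_ge0 // ltW.
have enc := maxwell_enclosure hd hc hT (conjugation_L2 oO) coefE coefM coefS
  eps_min_gt0 mu_min_gt0 sigma_min_ge0 hK.
rewrite -spectrum_maxwellE -/S /enclosure -lamE -/lam in enc.
have lmin' : is_minimum (spectrum_curlcurl0 Omega) lam by rewrite /lam lamE.
clearbody lam S; clear lamE lmin coefE coefM coefS hd hc hT hK.
pose Lam := lam / (eps_max * mu_max).
split=> //.
- move=> lamp r; rewrite -subset0 => w [Sw Aw].
  have [x xE [x0 xr]] : exists2 x : R, w = x%:C & x != 0 /\ `|x| < r.
    case: Aw => -[x /=]; rewrite in_itv /= => /andP[x1 x2] <-; exists x => //.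
      by rewrite lt_eqF // ltr0_norm // ltrNl.
    by rewrite gt_eqF // gtr0_norm.
  case: (enc _ Sw); rewrite xE => -[]; first by move=> /= /eqP; rewrite (negbTE x0).
  move=> _ _; rewrite /= expr0n normr0 !mulr0 subr0 addr0.
  apply/negP; rewrite -ltNge -[x ^+ 2]real_normK ?num_real //.
  have L0 : 0 < Lam by rewrite divr_gt0.
  by rewrite -[ltRHS](sqr_sqrtr (ltW L0)) ltr_pXn2r ?nnegrE ?sqrtr_ge0.
- rewrite -/tau => gap; split.
    by move=> w [/enc[//|[]]].
  have Lt : tau ^+ 2 / 3 < Lam.
    rewrite /Lam ltr_pdivlMr //; apply: le_lt_trans gap.
    rewrite le_eqVlt; apply/orP; left; apply/eqP; rewrite /tau; field.
    by rewrite gt_eqF.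
  have D0 : 0 < Lam - tau ^+ 2 / 3 by rewrite subr_gt0.
  (* 3 y^2 - 2 tau |y| is least at |y| = tau / 3, where it is - tau^2 / 3. *)
  exists (Num.sqrt (Lam - tau ^+ 2 / 3)); first by rewrite sqrtr_gt0.
  move=> z w [_ z0] [Sw w0].
  have [//|[_ _ hw]] := enc _ Sw; first by case.
  apply: (@le_trans _ _ `|complex.Re (z - w)|%:C); last exact: normc_ge_Re.
  rewrite lecR reD reN z0 sub0r normrN -sqrtr_sqr ler_sqrt ?sqr_ge0 //.
  have := sqr_ge0 (3 * `|complex.Im w| - tau).
  have y2 : complex.Im w ^+ 2 = `|complex.Im w| ^+ 2 by rewrite real_normK ?num_real.
  by move: hw; rewrite y2 -/tau -/Lam; nra.
Qed.
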